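(* Let $n\ge 1$, and let $\mathcal O^{\mathrm{GS}}$ and $\mathcal O^{\mathrm{fGS}}$ be the (partially defined) operations on $n$-tuples from convenient algebras given as follows. $\mathcal O^{\mathrm{GS}}(A_1,\ldots,A_n)=(Q_1,\ldots,Q_n)$, where recursively $Q_1=\mathrm{pol}\,A_1$ and $Q_k=\mathrm{pol}\left((A_k){}^1_{Q_1}{}^1_{Q_2}\cdots{}^1_{Q_{k-1}}\right)$ for $2\le k\le n$ (defined iff every $Q_k$ is well-defined). $\mathcal O^{\mathrm{fGS}}(A_1,\ldots,A_n)=(A_1,\tilde Q_2A_1,\ldots,\tilde Q_nA_1)$, where $(\tilde Q_2,\ldots,\tilde Q_n)=\mathcal O^{\mathrm{GS}}(A_2A_1^{-1},\ldots,A_nA_1^{-1})$. Then: (a) $\mathcal O^{\mathrm{GS}}$ is an FQ orthogonalization procedure (i.e. it satisfies (vR), (Nat), (Ana), (CP)), it satisfies (vC), (vL), (H$^0$), it generalizes the Gram–Schmidt orthogonalization procedure in the sense that (PGS), (Fil), (Par) hold, and it satisfies (FSt). (b) $\mathcal O^{\mathrm{fGS}}$ is an FQ conform-orthogonalization procedure (i.e. it satisfies (vR), (Nat), (Biv'), (Ana'), (CP')), it satisfies (vC'), (vL), it generalizes the Gram–Schmidt conform-orthogonalization procedure in the sense that (PGS'), (Fil), (Par) hold, and it satisfies (FSt). (c) $\mathcal O^{\mathrm{GS}}$ and $\mathcal O^{\mathrm{fGS}}$ are defined on $0$-open subsets of $\mathfrak A^n$ (for every convenient algebra $\mathfrak 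A$).
   Context: Convenient algebra: a unital real algebra $\mathfrak A$ with a decreasing filtration $\mathfrak A=\mathfrak A^{(0)}\supset\mathfrak A^{(1)}\supset\cdots$, $\mathfrak A^{(i)}\mathfrak A^{(j)}\subset\mathfrak A^{(i+j)}$, complete and Hausdorff ($\bigcap_i\mathfrak A^{(i)}=0$) for the filtration, with all $\mathfrak A/\mathfrak A^{(i)}$ finite-dimensional. Convergence means convergence in every $\mathfrak A/\mathfrak A^{(i)}$. The $0$-topology is the one induced from $\mathfrak A/\mathfrak A^{(1)}$ only. $\Theta:\mathfrak A\to\mathfrak A/\mathfrak A^{(1)}$ is the projection. Clifford system: $(Q_1,\ldots,Q_n)$ with $Q_iQ_j+Q_jQ_i=-2\delta_{ij}1$. Floating Clifford system: $(C_1,\ldots,C_n)$ (with $C_1$ invertible) such that $(C_2C_1^{-1},\ldots,C_nC_1^{-1})$ is a Clifford system. For $Q^2=\pm1$: $R^0_Q=\frac12(R+Q^{-1}RQ)$, $R^1_Q=\frac12(R-Q^{-1}RQ)$; $R^{\iota_1}_{Q_1}{}^{\iota_2}_{Q_2}\cdots$ denotes iteration. Polarization: $\mathrm{pol}\,H=\int_0^{2\pi}\frac{H}{\cos^2t-H^2\sin^2t}\frac{dt}{2\pi}$, defined iff $(\cos t+H\sin t)^{-1}$ exists for all real $t$. Operations $\Psi$ are partially defined. Conditions: (vR): $\Psi$ may assign to an $n$-tuple from a convenient algebra $\mathfrak A$ another $n$-tuple from $\mathfrak A$. (Nat): (i) if $\Psi(A_1,\ldots,A_n)=(B_1,\ldots,B_n)$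 and $\phi:\mathfrak A\to\tilde{\mathfrak A}$ is a (unital) homomorphism, then $\Psi(\phi(A_1),\ldots,\phi(A_n))=(\phi(B_1),\ldots,\phi(B_n))$; (ii) the domain of $\Psi$ on $\mathfrak A\oplus\mathfrak B$ contains the direct product of the domains on $\mathfrak A$ and $\mathfrak B$. (Ana): if $Q$ is a Clifford system and $\Theta(R_1),\ldots,\Theta(R_n)$ are sufficiently close to $0$, then the $k$th component of $\Psi(Q_1+R_1,\ldots,Q_n+R_n)$ is $\sum_{r\ge0}E_k^{\langle r\rangle}$ with $$E_k^{\langle r\rangle}=\sum_{\iota_0,\ldots,\iota_r\in\{0,1\}^n,\ j_1,\ldots,j_r\in\{1,\ldots,n\}}\psi^{[k],j_1,\ldots,j_r}_{\iota_0,\ldots,\iota_r}\,Q^{\iota_0}R_{j_1}Q^{\iota_1}R_{j_2}\cdots R_{j_r}Q^{\iota_r},$$ with fixed real coefficients $\psi$ independent of $Q$, where $Q^\iota=Q_1^{\iota_1}\cdots Q_n^{\iota_n}$. (Ana'): if $Q$ is a floating Clifford system and the $\Theta(R_i)$ are sufficiently close to $0$, the $k$th component of $\Psi(Q+R)$ is $\sum_{r\ge 0} E_k^{\langle r\rangle}$ with $$E_k^{\langle r\rangle}=\sum_{\iota_0,\ldots,\iota_r\in\{0,1\}^{n-1},\ j_1,\ldots,j_r}\psi^{[k],j_1,\ldots,j_r}_{\iota_0,\ldots,\iota_r}\,\tilde Q^{\iota_0}\tilde R_{j_1}\tilde Q^{\iota_1}\cdots\tilde R_{j_r}\tilde Q^{\iota_r}Q_1,$$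 with real $\psi$ independent of $Q$, $\tilde R_k=R_kQ_1^{-1}$, $\tilde Q=(Q_2Q_1^{-1},\ldots,Q_nQ_1^{-1})$. (Biv'): if $\Psi(A)=B$ and $\theta_1,\theta_2\in\mathfrak A$ are invertible then $\Psi(\theta_1A_1\theta_2,\ldots,\theta_1A_n\theta_2)=(\theta_1B_1\theta_2,\ldots,\theta_1B_n\theta_2)$. (CP): $\Psi$ yields Clifford systems. (CP'): $\Psi$ yields floating Clifford systems. (vC): $\Psi(Q)=Q$ for every Clifford system $Q$. (vC'): $\Psi(Q)=Q$ for every floating Clifford system $Q$. (vL): if $\Psi(A_1,\ldots,A_n)=(B_1,\ldots,B_n)$ then $\Psi((-1)^{\iota_1}A_1,\ldots,(-1)^{\iota_n}A_n)=((-1)^{\iota_1}B_1,\ldots,(-1)^{\iota_n}B_n)$ for $\iota\in\{0,1\}^n$. (H$^0$): if $\Psi(A)=B$ and $t>0$ then $\Psi(tA_1,\ldots,tA_n)=B$. (PGS), resp. (PGS'): for a finite-dimensional real vector space $V$ with positive definite metric $q$ and linearly independent $a_1,\ldots,a_n\in V$, $\Psi(\mathrm{cl}(a_1),\ldots,\mathrm{cl}(a_n))=(\mathrm{cl}(\hat a_1),\ldots,\mathrm{cl}(\hat a_n))$, resp. $=(\mathrm{cl}(\check a_1),\ldots,\mathrm{cl}(\check a_n))$, in the Clifford algebra $\mathrm{Cl}(V,q)$ (with $\mathrm{cl}(v)^2=-q(v,v)$ and $\mathrm{Cl}(V,q)^{(1)}=0$). Here $\tilde a_k$ is the component of $a_k$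 orthogonal to $a_1,\ldots,a_{k-1}$, $\hat a_k=\tilde a_k/\sqrt{q(\tilde a_k,\tilde a_k)}$, and $\check a_k=\sqrt{q(\tilde a_1,\tilde a_1)/q(\tilde a_k,\tilde a_k)}\,\tilde a_k$. (Fil): in $\Psi(A_1,\ldots,A_n)=(B_1,\ldots,B_n)$, the term $B_i$ depends only on $A_1,\ldots,A_i$ in the analytic expansion. (Par): if $\Psi(A)=B$ and $U$ is a real lower triangular matrix with positive diagonal entries and $U_{11}=1$, then $\Psi(U(A_1,\ldots,A_n))=B$, where $(UA)_i=\sum_jU_{ij}A_j$. (FSt): if $\Psi(A)=B$ and $t\in[0,1]$, then $\Psi(tA_1+(1-t)B_1,\ldots,tA_n+(1-t)B_n)=B$. *)

(* Defs.v *)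
From HB Require Import structures.
From mathcomp Require Import all_boot all_order all_algebra.
From mathcomp Require Import all_classical all_reals all_analysis.

Set Implicit Arguments.
Unset Strict Implicit.
Unset Printing Implicit Defensive.

Import Order.TTheory GRing.Theory Num.Theory.
Import numFieldNormedType.Exports.
Local Open Scope classical_set_scope.
Local Open Scope ring_scope.

(* [c] induces a linear isomorphism V/W ~ R^d.  Topological notions on the
   finite-dimensional space V/W are those of R^d, transported along such a [c];
   they do not depend on the choice of [c]. *)
Definition quot_coord (R : realType) (V : lmodType R) (W : set V) (d : nat)
    (c : {linear V -> 'rV[R]_d}) : Prop :=
  (forall x, W x <-> c x = 0) /\ (forall y, exists x, c x = y).

HB.mixin Record UnitAlgebra_isConvenient (R : realType) A
    of GRing.UnitAlgebra R A := {
  filt : nat -> set A;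
  filt0 : filt 0 = setT;
  filt_linear : forall i (a : R) x y,
    filt i x -> filt i y -> filt i (a *: x + y);
  filtS : forall i, filt i.+1 `<=` filt i;
  filtM : forall i j x y, filt i x -> filt j y -> filt (i + j)%N (x * y);
  filt_hausdorff : \bigcap_i filt i = [set 0];
  filt_complete : forall u : nat -> A,
    (forall i, exists N, forall m n,
      (N <= m)%N -> (N <= n)%N -> filt i (u m - u n)) ->
    exists l, forall i, exists N, forall n, (N <= n)%N -> filt i (u n - l);
  filt_fin_dim : forall i, exists d (c : {linear A -> 'rV[R]_d}),
    quot_coord (filt i) c
}.

#[short(type="convAlgType")]
HB.structure Definition ConvenientAlgebra (R : realType) :=
  {A of UnitAlgebra_isConvenient R A & GRing.UnitAlgebra R A}.

Section ProductAlgebra.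
Variables (R : realType) (A B : convAlgType R).

Definition pair_filt (i : nat) : set (A * B) :=
  [set x | filt i x.1 /\ filt i x.2].

Fact pair_filt0 : pair_filt 0 = setT.
Proof. by rewrite /pair_filt !filt0; apply/seteqP; split. Qed.

Fact pair_filt_linear i (a : R) (x y : A * B) :
  pair_filt i x -> pair_filt i y -> pair_filt i (a *: x + y).
Proof. by move=> [? ?] [? ?]; split => /=; apply: filt_linear. Qed.

Fact pair_filtS i : pair_filt i.+1 `<=` pair_filt i.
Proof. by move=> x [? ?]; split; apply: filtS. Qed.

Fact pair_filtM i j (x y : A * B) :
  pair_filt i x -> pair_filt j y -> pair_filt (i + j)%N (x * y).
Proof. by move=> [? ?] [? ?]; split => /=; apply: filtM. Qed.

Fact pair_filt_hausdorff : \bigcap_i pair_filt i = [set 0].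
Proof.
apply/seteqP; split=> [[x y] xy|_ -> i _]; last first.
  have z (C : convAlgType R) : filt i (0 : C).
    have : [set 0 : C] 0 by [].
    by rewrite -filt_hausdorff; apply.
  by split; apply: z.
have : [set 0] x by rewrite -filt_hausdorff => i _; have [] := xy i I.
have : [set 0] y by rewrite -filt_hausdorff => i _; have [] := xy i I.
by move=> -> ->.
Qed.

Fact pair_filt_complete (u : nat -> A * B) :
  (forall i, exists N, forall m n,
    (N <= m)%N -> (N <= n)%N -> pair_filt i (u m - u n)) ->
  exists l, forall i, exists N, forall n, (N <= n)%N -> pair_filt i (u n - l).
Proof.
move=> cu.
have [|l hl] := @filt_complete R A (fun n => (u n).1).
  by move=> i; have [N hN] := cu i; exists N => m n Nm Nn; case: (hN m n Nm Nn).
have [|l' hl'] := @filt_complete R B (fun n => (u n).2).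
  by move=> i; have [N hN] := cu i; exists N => m n Nm Nn; case: (hN m n Nm Nn).
exists (l, l') => i; have [N hN] := hl i; have [N' hN'] := hl' i.
exists (maxn N N') => n; rewrite geq_max => /andP[Nn N'n].
by split=> /=; [apply: hN|apply: hN'].
Qed.

Fact pair_filt_fin_dim i : exists d (c : {linear (A * B)%type -> 'rV[R]_d}),
  quot_coord (pair_filt i) c.
Proof.
have [d [c [ck cs]]] := @filt_fin_dim R A i.
have [e [f [fk fs]]] := @filt_fin_dim R B i.
pose g (x : A * B) : 'rV[R]_(d + e) := row_mx (c x.1) (f x.2).
have gl : linear g.
  by move=> a x y; rewrite /g !linearP scale_row_mx add_row_mx.
pose gL := GRing.isLinear.Build _ _ _ _ g gl.
pose G : {linear (A * B)%type -> 'rV[R]_(d + e)} := HB.pack g gL.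
exists (d + e)%N, G; split=> [x|y].
  rewrite /= /g -(row_mx0 R 1 d e); split=> [[h1 h2]|/eq_row_mx[h1 h2]].
    by move/ck: h1 => ->; move/fk: h2 => ->.
  by split; [apply/ck|apply/fk].
have [x xy] := cs (lsubmx y); have [x' x'y] := fs (rsubmx y).
by exists (x, x'); rewrite /= /g /= xy x'y hsubmxK.
Qed.

HB.instance Definition _ := UnitAlgebra_isConvenient.Build R (A * B)%type
  pair_filt0 pair_filt_linear pair_filtS pair_filtM pair_filt_hausdorff
  pair_filt_complete pair_filt_fin_dim.

End ProductAlgebra.

Section Analysis.
Variables (R : realType) (A : convAlgType R).

Definition conv_to (u : nat -> A) (l : A) : Prop :=
  forall i d (c : {linear A -> 'rV[R]_d}), quot_coord (filt i) c ->
    c (u N) @[N --> \oo] --> c l.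

(* The sets of n-tuples which are open for the 0-topology, i.e. the preimages
   of the open subsets of (A/A^(1))^n ~ 'M[R]_(n, d). *)
Definition zero_open (n : nat) (U : set ('I_n -> A)) : Prop :=
  forall d (c : {linear A -> 'rV[R]_d}), quot_coord (filt 1) c ->
    exists2 W : set 'M[R]_(n, d), open W &
      U = [set a | W (\matrix_(k, j) c (a k) 0 j)].

(* [P] is the integral of [f t dt / 2pi] over [0, 2pi], computed in every
   quotient A/A^(i). *)
Definition is_mean (f : R -> A) (P : A) : Prop :=
  forall i d (c : {linear A -> 'rV[R]_d}), quot_coord (filt i) c ->
    forall j : 'I_d,
      (@lebesgue_measure R).-integrable `[0, 2 * pi]
        (EFin \o (fun t => c (f t) 0 j)) /\
      c P 0 j = (2 * pi)^-1 *
        \int[@lebesgue_measure R]_(t in `[0, 2 * pi]) c (f t) 0 j.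

Definition pol_dom (H : A) : Prop :=
  forall t : R, (cos t)%:A + sin t *: H \is a GRing.unit.

Definition pol (H : A) : A :=
  xget 0 [set P | is_mean
    (fun t => H / ((cos t ^+ 2)%:A - sin t ^+ 2 *: H ^+ 2)) P].

Definition clifford_system (n : nat) (q : 'I_n -> A) : Prop :=
  forall i j, q i * q j + q j * q i = (- 2 * (i == j)%:R)%:A.

Definition floating_clifford_system (n : nat) (q : 'I_n.+1 -> A) : Prop :=
  q ord0 \is a GRing.unit /\
  clifford_system (fun i => q (lift ord0 i) / q ord0).

(* The component R^1_Q. *)
Definition odd_part (Q r : A) : A := 2^-1 *: (r - Q^-1 * r * Q).

Definition cliff_mon (m : nat) (q : 'I_m -> A) (iota : {ffun 'I_m -> bool}) : A :=
  \prod_(i < m) q i ^+ iota i.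

(* Q^iota_0 R_j_1 Q^iota_1 ... R_j_r Q^iota_r *)
Definition cliff_word (m n : nat) (q : 'I_m -> A) (x : 'I_n -> A) (r : nat)
    (j : {ffun 'I_r -> 'I_n}) (iota : {ffun 'I_r.+1 -> {ffun 'I_m -> bool}}) : A :=
  cliff_mon q (iota ord0) *
  \prod_(s < r) (x (j s) * cliff_mon q (iota (lift ord0 s))).

End Analysis.

(* [psi k r j iota] is the coefficient of the word of degree r in n variables,
   with m Clifford generators, in the expansion of the kth component. *)
Definition coeffs (R : realType) (m n : nat) : Type :=
  'I_n -> forall r : nat,
    {ffun 'I_r -> 'I_n} -> {ffun 'I_r.+1 -> {ffun 'I_m -> bool}} -> R.

Definition hom_term (R : realType) (A : convAlgType R) (m n : nat)
    (psi : coeffs R m n) (k : 'I_n) (q : 'I_m -> A) (x : 'I_n -> A) (r : nat) : A :=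
  \sum_(iota : {ffun 'I_r.+1 -> {ffun 'I_m -> bool}})
    \sum_(j : {ffun 'I_r -> 'I_n}) psi k r j iota *: cliff_word q x j iota.

(* A partially defined operation on n-tuples, as a graph: [Psi A a b] reads
   "Psi(a) is defined and equal to b". *)
Definition operation (R : realType) (n : nat) : Type :=
  forall A : convAlgType R, ('I_n -> A) -> ('I_n -> A) -> Prop.

Section Operations.
Variable R : realType.

Definition domain n (Psi : operation R n) (A : convAlgType R) :
  set ('I_n -> A) := [set a | exists b, Psi A a b].

Definition vR n (Psi : operation R n) : Prop :=
  forall (A : convAlgType R) (a b b' : 'I_n -> A),
    Psi A a b -> Psi A a b' -> b = b'.

Definition Nat n (Psi : operation R n) : Prop :=
  (forall (A B : convAlgType R) (phi : {lrmorphism A -> B}) (a b : 'I_n -> A),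
    Psi A a b -> Psi B (phi \o a) (phi \o b)) /\
  (forall (A B : convAlgType R) (a : 'I_n -> A) (b : 'I_n -> B),
    domain Psi a -> domain Psi b ->
    domain Psi (fun k => (a k, b k) : (A * B)%type)).

Definition analytic_expansion n (Psi : operation R n) (psi : coeffs R n n) : Prop :=
  forall (A : convAlgType R) (q : 'I_n -> A), clifford_system q ->
    exists U : set ('I_n -> A), [/\ zero_open U, U (fun=> 0) &
      forall x, U x -> exists2 b, Psi A (fun k => q k + x k) b &
        forall k, conv_to (fun N => \sum_(r < N) hom_term psi k q x r) (b k)].

Definition Ana n (Psi : operation R n) : Prop :=
  exists psi, analytic_expansion Psi psi.

Definition analytic_expansion' n (Psi : operation R n.+1)
    (psi : coeffs R n n.+1) : Prop :=
  forall (A : convAlgType R) (q : 'I_n.+1 -> A), floating_clifford_system q ->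
    exists U : set ('I_n.+1 -> A), [/\ zero_open U, U (fun=> 0) &
      forall x, U x -> exists2 b, Psi A (fun k => q k + x k) b &
        forall k, conv_to
          (fun N => \sum_(r < N)
            hom_term psi k (fun i => q (lift ord0 i) / q ord0)
                           (fun i => x i / q ord0) r * q ord0)
          (b k)].

Definition Ana' n (Psi : operation R n.+1) : Prop :=
  exists psi, analytic_expansion' Psi psi.

Definition Biv' n (Psi : operation R n) : Prop :=
  forall (A : convAlgType R) (a b : 'I_n -> A) (theta1 theta2 : A),
    theta1 \is a GRing.unit -> theta2 \is a GRing.unit -> Psi A a b ->
    Psi A (fun k => theta1 * a k * theta2) (fun k => theta1 * b k * theta2).

Definition CP n (Psi : operation R n) : Prop :=
  forall (A : convAlgType R) (a b : 'I_n -> A), Psi A a b -> clifford_system b.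

Definition CP' n (Psi : operation R n.+1) : Prop :=
  forall (A : convAlgType R) (a b : 'I_n.+1 -> A),
    Psi A a b -> floating_clifford_system b.

Definition vC n (Psi : operation R n) : Prop :=
  forall (A : convAlgType R) (q : 'I_n -> A), clifford_system q -> Psi A q q.

Definition vC' n (Psi : operation R n.+1) : Prop :=
  forall (A : convAlgType R) (q : 'I_n.+1 -> A),
    floating_clifford_system q -> Psi A q q.

Definition vL n (Psi : operation R n) : Prop :=
  forall (A : convAlgType R) (a b : 'I_n -> A) (iota : 'I_n -> bool),
    Psi A a b ->
    Psi A (fun k => (-1) ^+ iota k * a k) (fun k => (-1) ^+ iota k * b k).

Definition H_0 n (Psi : operation R n) : Prop :=
  forall (A : convAlgType R) (a b : 'I_n -> A) (t : R),
    0 < t -> Psi A a b -> Psi A (fun k => t *: a k) b.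

(* Cl(V,q), by its universal property, with the filtration Cl(V,q)^(1) = 0. *)
Definition is_clifford_algebra (V : vectType R) (q : {dot V for idfun})
    (A : convAlgType R) (cl : {linear V -> A}) : Prop :=
  [/\ filt 1 = [set 0 : A],
      forall v, cl v ^+ 2 = (- q v v)%:A &
      forall (B : algType R) (f : {linear V -> B}),
        (forall v, f v ^+ 2 = (- q v v)%:A) ->
        exists2 g : {lrmorphism A -> B}, (forall v, g (cl v) = f v) &
          forall g' : {lrmorphism A -> B},
            (forall v, g' (cl v) = f v) -> g' =1 g].

Definition orthogonal_components (V : vectType R) (q : {dot V for idfun}) n
    (a c : 'I_n -> V) : Prop :=
  forall k : 'I_n,
    a k - c k \in <<[seq a j | j : 'I_n <- enum 'I_n & (j < k)%N]>>%VS /\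
    forall j : 'I_n, (j < k)%N -> q (c k) (a j) = 0.

Definition PGS n (Psi : operation R n) : Prop :=
  forall (V : vectType R) (q : {dot V for idfun}) (A : convAlgType R)
    (cl : {linear V -> A}) (a c : 'I_n -> V),
    is_clifford_algebra q cl -> free (codom a) ->
    orthogonal_components q a c ->
    Psi A (cl \o a) (fun k => cl ((Num.sqrt (q (c k) (c k)))^-1 *: c k)).

Definition PGS' n (Psi : operation R n.+1) : Prop :=
  forall (V : vectType R) (q : {dot V for idfun}) (A : convAlgType R)
    (cl : {linear V -> A}) (a c : 'I_n.+1 -> V),
    is_clifford_algebra q cl -> free (codom a) ->
    orthogonal_components q a c ->
    Psi A (cl \o a)
      (fun k => cl (Num.sqrt (q (c ord0) (c ord0) / q (c k) (c k)) *: c k)).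

(* In the expansion of the kth component at A = Q + R, only the words in
   Q_1, ..., Q_k and R_1, ..., R_k occur. *)
Definition Fil n (Psi : operation R n) : Prop :=
  exists2 psi, analytic_expansion Psi psi &
    forall (k : 'I_n) r j iota, psi k r j iota != 0 ->
      (forall s, (j s <= k)%N) /\
      (forall s (i : 'I_n), iota s i -> (i <= k)%N).

(* Same as above; the ith Clifford generator, of index i from 0, is
   Q_(lift ord0 i) Q_1^-1. *)
Definition Fil' n (Psi : operation R n.+1) : Prop :=
  exists2 psi, analytic_expansion' Psi psi &
    forall (k : 'I_n.+1) r j iota, psi k r j iota != 0 ->
      (forall s, (j s <= k)%N) /\
      (forall s (i : 'I_n), iota s i -> (lift ord0 i <= k)%N).

Definition Par n (Psi : operation R n.+1) : Prop :=
  forall (A : convAlgType R) (a b : 'I_n.+1 -> A) (U : 'M[R]_n.+1),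
    is_trig_mx U -> (forall i, 0 < U i i) -> U ord0 ord0 = 1 ->
    Psi A a b -> Psi A (fun i => \sum_j U i j *: a j) b.

Definition FSt n (Psi : operation R n) : Prop :=
  forall (A : convAlgType R) (a b : 'I_n -> A) (t : R),
    0 <= t <= 1 -> Psi A a b ->
    Psi A (fun k => t *: a k + (1 - t) *: b k) b.

Definition FQ_orthogonalization n (Psi : operation R n) : Prop :=
  [/\ vR Psi, Nat Psi, Ana Psi & CP Psi].

Definition FQ_conform_orthogonalization n (Psi : operation R n.+1) : Prop :=
  [/\ vR Psi, Nat Psi, Biv' Psi, Ana' Psi & CP' Psi].

(* The element whose polarization is Q_k, given Q_1, ..., Q_(k-1). *)
Definition GS_arg (A : convAlgType R) n (a q : 'I_n -> A) (k : 'I_n) : A :=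
  foldl (fun r j => odd_part (q j) r) (a k) [seq j : 'I_n <- enum 'I_n | (j < k)%N].

Definition OGS n : operation R n := fun A a q =>
  forall k, pol_dom (GS_arg a q k) /\ q k = pol (GS_arg a q k).

Definition OfGS n : operation R n.+1 := fun A a b =>
  a ord0 \is a GRing.unit /\
  exists2 q : 'I_n -> A, OGS (fun i => a (lift ord0 i) / a ord0) q &
    b ord0 = a ord0 /\ forall i, b (lift ord0 i) = q i * a ord0.

End Operations.

(* Main.v *)
Require Import Defs.
From HB Require Import structures.
From mathcomp Require Import all_boot all_order all_algebra.
From mathcomp Require Import all_classical all_reals all_analysis.
From mathcomp Require Import complex.
From mathcomp Require Import ring lra.

Set Implicit Arguments.
Unset Strict Implicit.
Unset Printing Implicit Defensive.

Import Order.TTheory GRing.Theory Num.Theory.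
Import numFieldNormedType.Exports.
Local Open Scope classical_set_scope.
Local Open Scope ring_scope.

(** The polarization [Q] of [H] is characterized without integrals: [Q^2 = -1], [Q] commutes
   with [H], and [H + x + y Q] is invertible for all real [x] and [y >= 0]. Modulo [A^(1)] such
   a [Q] is [p(H)], where the real polynomial [p] takes the values [+i] and [-i] on the spectrum
   in the upper and lower half plane; a series in [A^(1)] corrects it. Writing [H = Q S], the
   Cayley transform [r = (S - 1) / (S + 1)] has spectral radius below 1, and the integral
   defining [pol H] is [Q] times the mean of a Poisson kernel, which is 1. The algebraic
   properties of the procedures follow from the characterization and its uniqueness, which are
   compatible with homomorphisms, signs, positive scalings and segments towards [Q].

   For the expansions, [pol H = H (- H^2)^(-1/2)] is a binomial series near a Clifford system.
   Functions of [(Q, R)] which are sums of noncommutative power series, with geometric bounds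
   uniform in the algebra, are closed under sums, products, [pol], and inverses of [1 + f] with
   [f] vanishing at [R = 0]; the Clifford relations bring every word to the required shape. *)

(** * A reflexive tactic for identities in noncommutative rings *)

(** The neighbourhoods in (Ana) are open for the 0-topology, so they restrict R modulo A^(1) only,
    whereas the expansions must converge in every A/A^(i). This obstacle is met by [snorm_adapted]:
    for each i there is a submultiplicative norm of A/A^(i) which, on a prescribed finite set,
    exceeds a given norm of A/A^(1) by as little as desired. Smallness modulo A^(1) is thus
    inherited by all levels, with norms that depend on the point. The coefficients psi may depend
    neither on the algebra nor on Q. Hence expansions are carried as lists of weighted words fixed
    before the algebra is, and their bounds have constants which depend only on a bound kappa for
    the norms of 1 and of the generators. Invertibility in A is decided in A/A^(1)
    ([unit_mod_filt1]). This is why the domains are 0-open, and why the half-plane condition in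
    [polar] can be checked by polynomial algebra or by a norm estimate at the first level. *)

Inductive nc_expr : Type :=
  | NCvar of nat | NC0 | NC1 | NCadd of nc_expr & nc_expr | NCopp of nc_expr
  | NCmul of nc_expr & nc_expr.

Fixpoint nc_eval (A : pzRingType) (env : seq A) (e : nc_expr) : A :=
  match e with
  | NCvar n => nth 0 env n
  | NC0 => 0
  | NC1 => 1
  | NCadd a b => nc_eval env a + nc_eval env b
  | NCopp a => - nc_eval env a
  | NCmul a b => nc_eval env a * nc_eval env b
  end.

Fixpoint nc_expand (e : nc_expr) : seq (bool * seq nat) :=
  match e with
  | NCvar n => [:: (false, [:: n])]
  | NC0 => [::]
  | NC1 => [:: (false, [::])]
  | NCadd a b => nc_expand a ++ nc_expand b
  | NCopp a => [seq (~~ t.1, t.2) | t <- nc_expand a]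
  | NCmul a b => flatten [seq [seq (t.1 (+) u.1, t.2 ++ u.2) | u <- nc_expand b] | t <- nc_expand a]
  end.

(** Each term is cancelled against a single opposite occurrence: multiplicities are not collected
    into integer coefficients. *)
Definition nc_cancel (l : seq (bool * seq nat)) : seq (bool * seq nat) :=
  foldr (fun t l => if (~~ t.1, t.2) \in l then rem (~~ t.1, t.2) l else t :: l) [::] l.

Section NCRing.
Variables (A : pzRingType) (env : seq A).

Definition nc_term (t : bool * seq nat) : A :=
  (-1) ^+ t.1 * \prod_(i <- t.2) nth 0 env i.

Lemma nc_termN t : nc_term (~~ t.1, t.2) = - nc_term t.
Proof. by rewrite /nc_term /= signrN mulNr. Qed.

Lemma nc_expandE e : nc_eval env e = \sum_(t <- nc_expand e) nc_term t.
Proof.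
elim: e => [n|||a IHa b IHb|a IHa|a IHa b IHb] /=.
- by rewrite big_seq1 /nc_term big_seq1 /= expr0 mul1r.
- by rewrite big_nil.
- by rewrite big_seq1 /nc_term big_nil /= expr0 mul1r.
- by rewrite big_cat /= IHa IHb.
- by rewrite big_map IHa -sumrN; apply: eq_bigr => t _; rewrite nc_termN.
- rewrite big_flatten big_map IHa mulr_suml; apply: eq_bigr => t _.
  rewrite big_map IHb mulr_sumr; apply: eq_bigr => u _.
  rewrite /nc_term /= big_cat /= signr_addb -!mulrA; congr (_ * _).
  by rewrite !mulrA commr_sign.
Qed.

Lemma nc_cancelE l : \sum_(t <- nc_cancel l) nc_term t = \sum_(t <- l) nc_term t.
Proof.
elim: l => [//|t l IH] /=; rewrite big_cons -IH; case: ifP => h; last by rewrite big_cons.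
by rewrite [in RHS](big_rem _ h) /= nc_termN addrA subrr add0r.
Qed.

Lemma nc_eq e1 e2 : nilp (nc_cancel (nc_expand (NCadd e1 (NCopp e2)))) ->
  nc_eval env e1 = nc_eval env e2.
Proof.
move=> /nilP h; apply/eqP; rewrite -subr_eq0; apply/eqP.
by have := nc_expandE (NCadd e1 (NCopp e2)); rewrite -nc_cancelE h big_nil.
Qed.

End NCRing.

Ltac nc_index x env :=
  match env with
  | x :: _ => constr:(O)
  | _ :: ?env' => let n := nc_index x env' in constr:(S n)
  end.

Ltac nc_mem x env :=
  match env with
  | nil => constr:(false)
  | x :: _ => constr:(true)
  | _ :: ?env' => nc_mem x env'
  end.

Ltac nc_env t env :=
  lazymatch t with
  | (?a + ?b)%R => let env1 := nc_env a env in nc_env b env1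
  | (- ?a)%R => nc_env a env
  | (?a * ?b)%R => let env1 := nc_env a env in nc_env b env1
  | 0%R => env
  | 1%R => env
  | _ => lazymatch nc_mem t env with true => env | false => constr:(t :: env) end
  end.

Ltac nc_reify t env :=
  lazymatch t with
  | (?a + ?b)%R => let x := nc_reify a env in let y := nc_reify b env in constr:(NCadd x y)
  | (- ?a)%R => let x := nc_reify a env in constr:(NCopp x)
  | (?a * ?b)%R => let x := nc_reify a env in let y := nc_reify b env in constr:(NCmul x y)
  | 0%R => constr:(NC0)
  | 1%R => constr:(NC1)
  | _ => let n := nc_index t env in constr:(NCvar n)
  end.

Ltac nc_ring :=
  rewrite ?expr2;
  lazymatch goal with
  | |- @eq ?T ?a ?b =>
      let env0 := nc_env a (@nil T) in
      let env := nc_env b env0 in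
      let x := nc_reify a env in
      let y := nc_reify b env in
      apply: (@nc_eq _ env x y); vm_compute; reflexivity
  end.

(** * Norms on the finite-dimensional quotients *)

Section Filtration.
Variables (R : realType) (A : convAlgType R).
Implicit Types (x y : A) (i j : nat).

Lemma filt_0 i : filt i (0 : A).
Proof.
have : [set 0 : A] 0 by [].
by rewrite -filt_hausdorff; apply.
Qed.

Lemma filtZ i (a : R) x : filt i x -> filt i (a *: x).
Proof. by move=> ix; rewrite -[_ *: _]addr0; apply: filt_linear => //; exact: filt_0. Qed.

Lemma filtD i x y : filt i x -> filt i y -> filt i (x + y).
Proof. by move=> ix iy; rewrite -[x]scale1r; apply: filt_linear. Qed.

Lemma filtN i x : filt i x -> filt i (- x).
Proof. by rewrite -scaleN1r; apply: filtZ. Qed.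

Lemma filtB i x y : filt i x -> filt i y -> filt i (x - y).
Proof. by move=> ix /filtN; apply: filtD. Qed.

Lemma filt_le i j : (i <= j)%N -> filt j `<=` (filt i : set A).
Proof.
move=> /subnK <-; elim: (j - i)%N => [|k IH] x; first by rewrite add0n.
by rewrite addSn => /filtS; apply: IH.
Qed.

Lemma filtMl i x y : filt i x -> filt i (x * y).
Proof. by move=> ix; rewrite -(addn0 i); apply: filtM => //; rewrite filt0. Qed.

Lemma filtMr i x y : filt i y -> filt i (x * y).
Proof. by move=> ix; rewrite -(add0n i); apply: filtM => //; rewrite filt0. Qed.

Lemma filt_eq0 x : (forall i, filt i x) -> x = 0.
Proof.
move=> h; have : [set 0] x by rewrite -filt_hausdorff => i _; apply: h.
by [].
Qed.

Lemma filtX i x n : filt i x -> filt (n * i)%N (x ^+ n).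
Proof.
move=> ix; elim: n => [|n IH]; first by rewrite filt0.
by rewrite exprS mulSn; apply: filtM.
Qed.

Lemma filt_transD i x y z : filt i (x - y) -> filt i (y - z) -> filt i (x - z).
Proof. by move=> h1 h2; rewrite -[x](subrK y) -addrA; apply: filtD. Qed.

(** The limit is reached at a definite rate: l agrees with the nth term modulo A^(n). Identities for
    l are then read off modulo A^(n) from the nth term, and [filt_eq0] concludes. *)
Lemma filt_cauchy_lim (u : nat -> A) :
  (forall n, filt n (u n.+1 - u n)) -> exists l, forall n, filt n (u n - l).
Proof.
move=> h; have h2 n k : filt n (u (n + k)%N - u n).
  elim: k => [|k IH]; first by rewrite addn0 subrr; exact: filt_0.
  apply: filt_transD IH; rewrite addnS.
  by apply: filt_le (h (n + k)%N); rewrite leq_addr.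
have [|l hl] := @filt_complete R A u.
  move=> i; exists i => m n im in_.
  rewrite -(subnKC im) -(subnKC in_); apply: (@filt_transD _ _ (u i)) => //.
  by rewrite -opprB; apply: filtN.
exists l => n; have [N hN] := hl n.
apply: (@filt_transD _ _ (u (n + N)%N)); last by apply: hN; rewrite leq_addl.
by rewrite -opprB; apply: filtN.
Qed.

Lemma filt_series (f : nat -> A) : (forall n, filt n (f n)) ->
  exists l, forall n, filt n (\sum_(k < n) f k - l).
Proof.
move=> h; apply: filt_cauchy_lim => n.
by rewrite big_ord_recr /= addrAC subrr add0r.
Qed.

Lemma filt1_notin1 : ~ filt 1 (1 : A).
Proof.
move=> h; have : (1 : A) = 0.
  by apply: filt_eq0 => i; have := filtX i h; rewrite expr1n muln1.
by move/eqP; rewrite oner_eq0.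
Qed.

(** The Neumann series converges for the filtration because x^n lies in A^(n). *)
Lemma unit_1sub_filt1 x : filt 1 x -> 1 - x \is a GRing.unit.
Proof.
move=> h1; have hX n : filt n (x ^+ n) by have := filtX n h1; rewrite muln1.
have [l hl] := filt_series hX.
have hs n : (1 - x) * \sum_(k < n) x ^+ k = 1 - x ^+ n.
  by rewrite -[1 - x ^+ n]opprB subrX1 -mulNr opprB.
have hc n : (\sum_(k < n) x ^+ k) * (1 - x) = 1 - x ^+ n.
  rewrite -hs; apply/esym/commr_sum => k _.
  by apply/commrX/commr_sym/commrD; [apply: commr1|apply/commrN].
apply/unitrP; exists l; split; apply/eqP; rewrite -subr_eq0; apply/eqP;
  apply: filt_eq0 => n.
  have -> : l * (1 - x) - 1 = - ((\sum_(k < n) x ^+ k - l) * (1 - x)) - x ^+ n.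
    by rewrite mulrBl hc; nc_ring.
  by apply: filtB => //; apply/filtN/filtMl.
have -> : (1 - x) * l - 1 = - ((1 - x) * (\sum_(k < n) x ^+ k - l)) - x ^+ n.
  by rewrite mulrBr hs; nc_ring.
by apply: filtB => //; apply/filtN/filtMr.
Qed.

(** Both x y and y x differ from 1 by elements of A^(1), hence are units, so x has a right and a
    left inverse. *)
Lemma unit_mod_filt1 x y : filt 1 (x * y - 1) -> filt 1 (y * x - 1) ->
  x \is a GRing.unit.
Proof.
move=> /filtN/unit_1sub_filt1 + /filtN/unit_1sub_filt1.
rewrite !opprK !subrKC => /unitrP[u [_ hu]] /unitrP[v [hv _]].
apply/unitrP; exists (v * y); rewrite -mulrA hv; split=> //.
have e : v * y = y * u by rewrite -[y * u]mul1r -hv -!mulrA [x * (y * u)]mulrA hu mulr1.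
by rewrite e mulrA hu.
Qed.

End Filtration.

Section Seminorms.
Variable R : realType.

Definition seminorm (V : lmodType R) (p : V -> R) : Prop :=
  (forall x y, p (x + y) <= p x + p y) /\ (forall (a : R) x, p (a *: x) = `|a| * p x).

Section SeminormTheory.
Variables (V : lmodType R) (p : V -> R).
Hypothesis hp : seminorm p.

Lemma seminorm0 : p 0 = 0.
Proof. by case: hp => _ h; rewrite -(scale0r (0 : V)) h normr0 mul0r. Qed.

Lemma seminormN x : p (- x) = p x.
Proof. by case: hp => _ h; rewrite -scaleN1r h normrN1 mul1r. Qed.

Lemma seminorm_ge0 x : 0 <= p x.
Proof.
have := proj1 hp x (- x); rewrite subrr seminorm0 seminormN.
by rewrite -mulr2n pmulrn_lge0.
Qed.

Lemma seminormB x y : p (x - y) <= p x + p y.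
Proof. by rewrite -[p y]seminormN; apply: (proj1 hp). Qed.

Lemma seminorm_sum (I : Type) (r : seq I) (P : pred I) (F : I -> V) :
  p (\sum_(k <- r | P k) F k) <= \sum_(k <- r | P k) p (F k).
Proof.
apply: (big_ind2 (fun x b => p x <= b)); first by rewrite seminorm0.
  by move=> x a y b hx hy; apply: le_trans (proj1 hp _ _) (lerD hx hy).
by [].
Qed.

Lemma seminorm_eqP x y : p (x - y) = 0 -> p x = p y.
Proof.
move=> h; apply/eqP; rewrite eq_le; apply/andP; split.
  by rewrite -[x](subrK y) (le_trans (proj1 hp _ _))// h add0r.
rewrite -[y](subrK x) (le_trans (proj1 hp _ _))// -opprB seminormN h add0r //.
Qed.

End SeminormTheory.

Definition coord_norm (V : lmodType R) d (c : {linear V -> 'rV[R]_d}) (x : V) : R :=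
  \sum_j `|c x 0 j|.

Lemma seminorm_coord_norm (V : lmodType R) d (c : {linear V -> 'rV[R]_d}) :
  seminorm (coord_norm c).
Proof.
split=> [x y|a x]; rewrite /coord_norm.
  by rewrite -big_split /=; apply: ler_sum => j _; rewrite linearD mxE ler_normD.
by rewrite mulr_sumr; apply: eq_bigr => j _; rewrite linearZ mxE normrM.
Qed.

Lemma quot_coord_section (V : lmodType R) (W : set V) d (c : {linear V -> 'rV[R]_d}) :
  quot_coord W c -> exists e : 'I_d -> V,
    (forall x, W (x - \sum_j c x 0 j *: e j)).
Proof.
move=> [cK cs]; have [e he] := fin_all_exists (fun j => cs (delta_mx 0 j)).
exists e => x; apply/cK; rewrite linearB linear_sum /=.
rewrite [X in X - _]row_sum_delta; apply/eqP; rewrite subr_eq0; apply/eqP.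
by apply: eq_bigr => j _; rewrite linearZ /= he.
Qed.

Lemma seminorm_le_coord (V : lmodType R) (W : set V) d (c : {linear V -> 'rV[R]_d})
    (p : V -> R) : quot_coord W c -> seminorm p -> (forall x, W x -> p x = 0) ->
  exists2 K, 0 <= K & forall x, p x <= K * coord_norm c x.
Proof.
move=> /quot_coord_section[e he] hp hW.
exists (\sum_j p (e j)); first by apply: sumr_ge0 => j _; apply: seminorm_ge0.
move=> x; rewrite (seminorm_eqP hp (hW _ (he x))).
apply: le_trans (seminorm_sum hp _ _ _) _.
rewrite mulr_sumr; apply: ler_sum => j _; rewrite (proj2 hp) mulrC.
apply: ler_wpM2r => //; rewrite (bigD1 j) //= lerDl.
by apply: sumr_ge0 => k _; apply: seminorm_ge0.
Qed.

Variable A : convAlgType R.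

(* A submultiplicative seminorm which induces the topology of A/A^(i). *)
Definition snorm (i : nat) (nu : A -> R) : Prop :=
  [/\ seminorm nu,
      forall x y, nu (x * y) <= nu x * nu y,
      forall x, filt i x -> nu x = 0 &
      forall d (c : {linear A -> 'rV[R]_d}), (forall x, filt i x -> c x = 0) ->
        exists2 K, 0 <= K & forall x, coord_norm c x <= K * nu x].

Lemma snorm_dominates i nu (p : A -> R) : snorm i nu -> seminorm p ->
  (forall x, filt i x -> p x = 0) -> exists2 K, 0 <= K & forall x, p x <= K * nu x.
Proof.
move=> [_ _ _ hd] hp hW; have [d [c hc]] := @filt_fin_dim R A i.
have [K K0 hK] := seminorm_le_coord hc hp hW.
have [|L L0 hL] := hd d c; first by move=> x /(proj1 hc).
exists (K * L); first exact: mulr_ge0.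
by move=> x; apply: le_trans (hK x) _; rewrite -mulrA ler_wpM2l.
Qed.

Lemma snorm_eq0 i nu x : snorm i nu -> nu x = 0 -> filt i x.
Proof.
move=> hnu h0; have [d [c hc]] := @filt_fin_dim R A i.
have [|K K0 hK] := snorm_dominates hnu (seminorm_coord_norm c).
  by move=> y /(proj1 hc) cy; apply: big1 => j _; rewrite cy mxE normr0.
apply/(proj1 hc); apply/rowP => j; rewrite mxE.
apply/eqP; rewrite -normr_le0; apply: le_trans (_ : coord_norm c x <= 0).
  by rewrite /coord_norm (bigD1 j) //= lerDl; apply: sumr_ge0.
by apply: le_trans (hK x) _; rewrite h0 mulr0.
Qed.

Lemma snorm_coord_le i nu d (c : {linear A -> 'rV[R]_d}) : snorm i nu ->
  (forall x, filt i x -> c x = 0) ->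
  exists2 K, 0 < K & forall x j, `|c x 0 j| <= K * nu x.
Proof.
move=> hnu hc; have [hs _ _ hd] := hnu; have [K K0 hK] := hd d c hc.
exists (K + 1); first by rewrite ltr_wpDl.
move=> x j; apply: le_trans (_ : _ <= K * nu x) _; last first.
  by apply: ler_wpM2r; [exact: seminorm_ge0|rewrite lerDl].
by apply: le_trans (hK x); rewrite /coord_norm (bigD1 j) //= lerDl; apply: sumr_ge0.
Qed.

(** Expanding y along lifts e_k of a basis leaves finitely many linear maps x -> x e_k, each bounded
    by [seminorm_le_coord]. *)
Lemma bilinear_bound i d (c : {linear A -> 'rV[R]_d}) (p : A -> R) :
  quot_coord (filt i) c -> seminorm p -> (forall x, filt i x -> p x = 0) ->
  exists2 K, 0 <= K & forall x y, p (x * y) <= K * coord_norm c x * coord_norm c y.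
Proof.
move=> hc hp hW; have [e he] := quot_coord_section hc.
have hpe k : exists2 K, 0 <= K & forall x, p (x * e k) <= K * coord_norm c x.
  apply: seminorm_le_coord hc _ _.
    split=> [x y|a x]; first by rewrite mulrDl; apply: (proj1 hp).
    by rewrite -scalerAl (proj2 hp).
  by move=> x ix; apply/hW/filtMl.
have [K hK0 hK] := fin_all_exists2 hpe.
exists (\sum_k K k); first by apply: sumr_ge0 => k _.
move=> x y; have -> : p (x * y) = p (x * \sum_j c y 0 j *: e j).
  apply: (seminorm_eqP hp); rewrite -mulrBr; exact/hW/filtMr.
rewrite mulr_sumr; apply: le_trans (seminorm_sum hp _ _ _) _.
rewrite [leRHS]mulr_sumr; apply: ler_sum => j _; rewrite -scalerAr (proj2 hp) mulrC.
apply: ler_wpM2r => //; apply: le_trans (hK j x) _.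
apply: ler_wpM2r; first by apply/seminorm_ge0/seminorm_coord_norm.
by rewrite (bigD1 j) //= lerDl; apply: sumr_ge0 => k _.
Qed.

Lemma snorm_exists i : exists nu, snorm i nu.
Proof.
have [d [c hc]] := @filt_fin_dim R A i.
have hn := seminorm_coord_norm c.
have h0 x : filt i x -> coord_norm c x = 0.
  by move=> /(proj1 hc) cx; apply: big1 => j _; rewrite cx mxE normr0.
have [K K0 hK] := bilinear_bound hc hn h0.
have K1 : 0 < K + 1 by rewrite ltr_wpDl.
(* If p (x y) <= K p(x) p(y), a multiple of p by a factor at least K is submultiplicative; K + 1 is
   moreover at least 1, so the multiple still dominates coordinates. *)
exists (fun x => (K + 1) * coord_norm c x); split.
- split=> [x y|a x].
    by rewrite -mulrDr ler_wpM2l ?(ltW K1)//; apply: (proj1 hn).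
  by rewrite (proj2 hn) mulrCA.
- move=> x y; rewrite mulrACA -[_ * _ * (_ * _)]mulrA ler_wpM2l ?(ltW K1)//.
  apply: le_trans (hK x y) _; rewrite -mulrA; apply: ler_wpM2r.
    by apply: mulr_ge0; apply: seminorm_ge0.
  by rewrite lerDl.
- by move=> x /h0 ->; rewrite mulr0.
- move=> d' c' h; have [|L L0 hL] := seminorm_le_coord hc (seminorm_coord_norm c').
    by move=> x /h cx; apply: big1 => j _; rewrite cx mxE normr0.
  exists L => // x; apply: le_trans (hL x) _; rewrite ler_wpM2l //.
  rewrite ler_peMl ?(seminorm_ge0 hn)// lerDr //.
Qed.

End Seminorms.

(** * Norms of A/A^(i) close to a given norm of A/A^(1) *)

Section AdaptedNorms.
Variables (R : realType) (A : convAlgType R).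

Lemma filt_section i : exists s : A -> A,
  [/\ forall x y, s (x + y) = s x + s y, forall (a : R) x, s (a *: x) = a *: s x,
      forall x, filt i (x - s x) & forall x, filt i x -> s x = 0].
Proof.
have [d [c hc]] := @filt_fin_dim R A i; have [e he] := quot_coord_section hc.
exists (fun x => \sum_j c x 0 j *: e j); split=> //.
- by move=> x y; rewrite -big_split /=; apply: eq_bigr => j _; rewrite linearD mxE scalerDl.
- by move=> a x; rewrite scaler_sumr; apply: eq_bigr => j _; rewrite linearZ mxE scalerA.
- by move=> x /(proj1 hc) cx; apply: big1 => j _; rewrite cx mxE scale0r.
Qed.

Lemma snorm1_gt0 i nu : (0 < i)%N -> snorm i nu -> 0 < nu (1 : A).
Proof.
move=> i0 hnu; rewrite lt_def seminorm_ge0 ?andbT; last by case: hnu.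
apply/eqP => /(snorm_eq0 hnu); move/(filt_le i0); exact: filt1_notin1.
Qed.

(** [mu] measures the bilinear map (a, b) -> a m b relative to nu. The conclusion keeps the two
    inequalities which define a supremum; from them mu is a seminorm on A^(i) contracted by nu on
    both sides. *)
Lemma sup_quotient_bimodule i nu (phi : A -> R) :
  (0 < i)%N -> snorm i nu -> seminorm phi -> (forall x, filt i.+1 x -> phi x = 0) ->
  (exists2 T, 0 <= T & forall a m b, filt i m ->
     phi (a * m * b) <= T * phi m * (nu a * nu b)) ->
  exists mu : A -> R,
    (forall m a b, filt i m -> phi (a * m * b) <= mu m * (nu a * nu b)) /\
    (forall m M, 0 <= M -> (forall a b, phi (a * m * b) <= M * (nu a * nu b)) -> mu m <= M).
Proof.
move=> i0 [hs hm hv hd] hphi phi0 [T T0 hT].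
pose S m := [set s | exists a, exists b, s = phi (a * m * b) / (nu a * nu b)].
have ge0 a b : 0 <= nu a * nu b by apply: mulr_ge0; apply: seminorm_ge0.
have S0 m : S m !=set0 by exists (phi (1 * m * 1) / (nu 1 * nu 1)), 1, 1.
have Sle m M : 0 <= M -> (forall a b, phi (a * m * b) <= M * (nu a * nu b)) -> ubound (S m) M.
  move=> M0 hM _ [a [b ->]]; have [->|n0] := eqVneq (nu a * nu b) 0.
    by rewrite invr0 mulr0.
  by rewrite ler_pdivrMr ?hM// lt_def n0 ge0.
exists (fun m => sup (S m)); split=> [m a b im|m M M0 hM]; last first.
  by apply: ge_sup; [exact: S0|exact: Sle].
(* Where nu a nu b = 0, the quotient is 0 by convention and says nothing; the bound then comes from
   the hypothesis on T. *)
have [n0|n0] := eqVneq (nu a * nu b) 0.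
  by rewrite n0 mulr0; apply: le_trans (hT a m b im) _; rewrite n0 mulr0.
rewrite -ler_pdivrMr; last by rewrite lt_def n0 ge0.
apply: ub_le_sup; last by exists a, b.
exists (T * phi m); apply: Sle => [|a' b']; last exact: hT.
by apply: mulr_ge0 => //; apply: seminorm_ge0.
Qed.

(* The kernel A^(i)/A^(i+1) of A/A^(i+1) -> A/A^(i) has zero square, and it is a
   bimodule over A/A^(i); the norm mu on it is contracted by nu.  Scaling mu by a small l
   makes the new norm almost equal to nu. *)
Lemma snorm_step i nu : (0 < i)%N -> snorm i nu ->
  exists C (theta : A -> R), [/\ 0 <= C, forall x, 0 <= theta x &
    forall l, 0 < l -> snorm i.+1 (fun x => (1 + l * C) * (nu x + l * theta x))].
Proof.
move=> i0 hnu; have [hs hm hv hd] := hnu.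
have nu0 x : 0 <= nu x by apply: seminorm_ge0.
have [d [c hc]] := @filt_fin_dim R A i.+1.
pose phi := coord_norm c; have hphi : seminorm phi := seminorm_coord_norm c.
have p0 x : 0 <= phi x by apply: seminorm_ge0.
have phi0 x : filt i.+1 x -> phi x = 0.
  by move=> /(proj1 hc) cx; apply: big1 => j _; rewrite cx mxE normr0.
have [K K0 hK] := bilinear_bound hc hphi phi0.
have secb j (s : A -> A) : (0 < j <= i)%N -> (forall x y, s (x + y) = s x + s y) ->
    (forall (a : R) x, s (a *: x) = a *: s x) -> (forall x, filt j x -> s x = 0) ->
    exists2 L, 0 <= L & forall x, phi (s x) <= L * nu x.
  move=> /andP[_ ji] sD sZ s0; apply: (snorm_dominates hnu).
    by split=> [x y|a x]; rewrite ?sD ?sZ; [apply: (proj1 hphi)|apply: (proj2 hphi)].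
  by move=> x ix; rewrite s0 ?(seminorm0 hphi)//; apply: filt_le ix.
(* A^(1) A^(i) and A^(i) A^(1) lie in A^(i+1): modulo A^(i+1) the factors a and b act on A^(i)
   through A/A^(1), so they may be replaced by representatives which nu controls. *)
have [s1 [s1D s1Z s1f s10]] := filt_section 1.
have [L1 L10 hL1] := secb 1%N s1 i0 s1D s1Z s10.
have [s [sD sZ sf s0]] := filt_section i.
have [L L0 hL] : exists2 L, 0 <= L & forall x, phi (s x) <= L * nu x.
  by apply: (secb i s) => //; rewrite i0 leqnn.
have [|mu [mu1 mu2]] := sup_quotient_bimodule i0 hnu hphi phi0.
  exists (K * K * L1 * L1); first by rewrite !mulr_ge0.
  move=> a m b im.
  have -> : phi (a * m * b) = phi (s1 a * m * s1 b).
    apply/(seminorm_eqP hphi)/phi0.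
    have -> : a * m * b - s1 a * m * s1 b = (a - s1 a) * m * b + s1 a * m * (b - s1 b).
      by nc_ring.
    apply: filtD; first by apply: filtMl; rewrite -add1n; apply: filtM.
    by rewrite -addn1; apply: filtM => //; apply: filtMr.
  apply: le_trans (hK _ _) _.
  apply: (@le_trans _ _ (K * (K * phi (s1 a) * phi m) * phi (s1 b))).
    by apply: ler_wpM2r => //; apply: ler_wpM2l.
  have -> : K * K * L1 * L1 * phi m * (nu a * nu b) =
      K * (K * (L1 * nu a) * phi m) * (L1 * nu b) by ring.
  have la := hL1 a; have lb := hL1 b.
  apply: ler_pM => //; first by rewrite !mulr_ge0.
  by apply: ler_wpM2l => //; apply: ler_wpM2r => //; apply: ler_wpM2l.
have nu1 := snorm1_gt0 i0 hnu.
have mu0 m : filt i m -> 0 <= mu m.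
  move=> im; have := mu1 m 1 1 im; rewrite mul1r mulr1 => h.
  by have := le_trans (p0 m) h; rewrite pmulr_lge0 // mulr_gt0.
have muD m m' : filt i m -> filt i m' -> mu (m + m') <= mu m + mu m'.
  move=> im im'; apply: mu2 => [|a b]; first by rewrite addr_ge0 ?mu0.
  rewrite mulrDr mulrDl; apply: le_trans (proj1 hphi _ _) _.
  by rewrite mulrDl; apply: lerD; apply: mu1.
have muZle (a : R) m : filt i m -> mu (a *: m) <= `|a| * mu m.
  move=> im; apply: mu2 => [|x y]; first by rewrite mulr_ge0 ?mu0.
  by rewrite -scalerAr -scalerAl (proj2 hphi) -[leRHS]mulrA ler_wpM2l // mu1.
have muZ (a : R) m : filt i m -> mu (a *: m) = `|a| * mu m.
  move=> im; apply/eqP; rewrite eq_le muZle //=.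
  have [->|a0] := eqVneq a 0.
    by rewrite normr0 mul0r scale0r mu0 //; apply: filt_0.
  have := muZle a^-1 (a *: m) (filtZ a im).
  rewrite scalerA mulVf // scale1r normfV mulrC ler_pdivlMr ?normr_gt0 //.
  by rewrite mulrC.
have mul0 m : filt i.+1 m -> mu m = 0.
  move=> im; apply/eqP; rewrite eq_le mu0 ?andbT; last exact: filtS.
  by apply: mu2 => // a b; rewrite mul0r phi0 //; apply/filtMl/filtMr.
have muMr m y : filt i m -> mu (m * y) <= mu m * nu y.
  move=> im; apply: mu2 => [|a b]; first by rewrite mulr_ge0 ?mu0.
  have -> : a * (m * y) * b = a * m * (y * b) by nc_ring.
  apply: le_trans (mu1 _ _ _ im) _.
  rewrite -mulrA; apply: ler_wpM2l; first exact: mu0.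
  by rewrite mulrCA ler_wpM2l.
have muMl m x : filt i m -> mu (x * m) <= nu x * mu m.
  move=> im; apply: mu2 => [|a b]; first by rewrite mulr_ge0 ?mu0.
  rewrite mulrA; apply: le_trans (mu1 _ _ _ im) _.
  have -> : nu x * mu m * (nu a * nu b) = mu m * (nu a * nu x * nu b) by ring.
  apply: ler_wpM2l; first exact: mu0.
  by rewrite ler_wpM2r // hm.
(* [s] lifts A/A^(i) linearly but not multiplicatively: the products s x * s y are the source of the
   term with C below. *)
pose pr x := x - s x; have prf x : filt i (pr x) by apply: sf.
have prD x y : pr (x + y) = pr x + pr y by rewrite /pr sD; nc_ring.
have prZ (a : R) x : pr (a *: x) = a *: pr x by rewrite /pr sZ scalerBr.
have prid x : filt i x -> pr x = x by move=> ix; rewrite /pr s0 // subr0.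
pose theta x := mu (pr x).
have th0 x : 0 <= theta x by apply: mu0.
have hth : seminorm theta.
  by split=> [x y|a x]; rewrite /theta ?prD ?prZ ?muZ //; apply: muD.
have thv x : filt i.+1 x -> theta x = 0.
  by move=> ix; rewrite /theta prid ?mul0 //; apply: filtS.
have [K' K'0 hK'] := bilinear_bound hc hth thv.
pose C := K' * L * L; have C0 : 0 <= C by rewrite !mulr_ge0.
have thM x y : theta (x * y) <= theta x * nu y + nu x * theta y + C * (nu x * nu y).
  have -> : x * y = pr x * y + s x * pr y + s x * s y by rewrite /pr; nc_ring.
  rewrite /theta 2!prD [pr (pr x * y)]prid; last exact: filtMl.
  rewrite [pr (s x * pr y)]prid; last exact: filtMr.
  apply: le_trans (muD _ _ _ _) _ => //; first by apply: filtD; [apply: filtMl|apply: filtMr].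
  apply: lerD; last first.
    apply: le_trans (hK' _ _) _; rewrite -/phi.
    have -> : C * (nu x * nu y) = K' * (L * nu x) * (L * nu y) by rewrite /C; ring.
    have la := hL x; have lb := hL y.
    apply: ler_pM => //; first by rewrite !mulr_ge0.
    by apply: ler_wpM2l.
  apply: le_trans (muD _ _ _ _) _ => //; [exact: filtMl|exact: filtMr|].
  apply: lerD; first exact: muMr.
  apply: le_trans (muMl _ _ _) _ => //; apply: ler_wpM2r; first exact: th0.
  by rewrite (seminorm_eqP hs (hv _ (sf x))).
exists C, theta; split=> // l l0.
have lC : 0 <= l * C by rewrite mulr_ge0 // ltW.
have l0' := ltW l0; split.
- split=> [x y|a x]; last by rewrite (proj2 hs) (proj2 hth); ring.
  rewrite -mulrDr ler_wpM2l ?addr_ge0 //.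
  have := proj1 hs x y; have := ler_wpM2l l0' (proj1 hth x y); lra.
- move=> x y; rewrite mulrACA -mulrA; apply: ler_wpM2l; first by rewrite addr_ge0.
  have h1 := hm x y; have h2 := ler_wpM2l l0' (thM x y).
  have g1 : 0 <= nu x * nu y by rewrite mulr_ge0.
  have g2 : 0 <= l * (theta x * nu y) by rewrite !mulr_ge0.
  have g3 : 0 <= l * (nu x * theta y) by rewrite !mulr_ge0.
  have g4 : 0 <= l * theta x * (l * theta y) by rewrite !mulr_ge0.
  have -> : (1 + l * C) * ((nu x + l * theta x) * (nu y + l * theta y)) =
    nu x * nu y + l * (theta x * nu y + nu x * theta y + C * (nu x * nu y))
     + l * theta x * (l * theta y) + l * C * (l * (theta x * nu y) + l * (nu x * theta y)
     + l * theta x * (l * theta y)) by ring.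
  have g5 := mulr_ge0 lC (addr_ge0 (addr_ge0 g2 g3) g4); lra.
- by move=> x ix; rewrite thv // hv ?mulr0 ?addr0 ?mulr0 //; apply: filtS.
- move=> d' c' h; have [|L' L'0 hL'] := seminorm_le_coord hc (seminorm_coord_norm c').
    by move=> x /h cx; apply: big1 => j _; rewrite cx mxE normr0.
  (* The new norm dominates phi: s x is controlled by nu x, and pr x = 1 * pr x * 1 by theta x, at
     the price of a factor 1 / l. *)
  pose B := L + nu 1 * nu 1 / l; have B0 : 0 <= B.
    by rewrite addr_ge0 // divr_ge0 // ltW // mulr_gt0.
  exists (L' * B) => [|x]; first exact: mulr_ge0.
  apply: le_trans (hL' x) _; rewrite -mulrA ler_wpM2l // -/(phi x).
  have hx : phi x <= L * nu x + theta x * (nu 1 * nu 1).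
    have {1}-> : x = s x + 1 * pr x * 1 by rewrite /pr; nc_ring.
    by apply: le_trans (proj1 hphi _ _) _; apply: lerD; [apply: hL|apply: mu1].
  apply: le_trans hx _; rewrite [leRHS]mulrCA.
  apply: (@le_trans _ _ (B * (nu x + l * theta x))); last first.
    by rewrite ler_peMl ?lerDl // mulr_ge0 // addr_ge0 // mulr_ge0.
  have -> : B * (nu x + l * theta x) = L * nu x + theta x * (nu 1 * nu 1) +
      (L * (l * theta x) + nu 1 * nu 1 / l * nu x).
    by rewrite /B; field; rewrite gt_eqF.
  rewrite lerDl addr_ge0 // ?mulr_ge0 // ?invr_ge0 // ltW //.
Qed.

(** Each passage to the next level costs half of the allowed error. Closeness can be asked on a
    finite set only: on multiples of an element of A^(1) outside A^(i), nu1 vanishes and nu is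
    unbounded. *)
Lemma snorm_adapted nu1 i (F : seq A) (e : R) : snorm 1 nu1 -> (0 < i)%N -> 0 < e ->
  exists2 nu, snorm i nu & forall f, f \in F -> nu f <= nu1 f + e.
Proof.
move=> h1; case: i => // i _; elim: i e => [|i IH] e e0.
  by exists nu1 => // f _; rewrite lerDl ltW.
have [|nu hnu hF] := IH (e / 2); first by rewrite divr_gt0.
have [C [th [C0 th0 hl]]] := snorm_step (ltn0Sn i) hnu.
have nu0 x : 0 <= nu x by apply: seminorm_ge0; case: hnu.
pose B f := C * nu f + th f + C * th f.
have B0 f : 0 <= B f by rewrite !addr_ge0 // mulr_ge0.
pose S := \sum_(f <- F) B f; have S0 : 0 <= S by apply: sumr_ge0.
(* As l <= 1, the excess over nu f is at most l B f, hence at most e / 2. *)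
pose l := Num.min 1 (e / 2 / (1 + S)).
have S1 : 0 < 1 + S by rewrite ltr_wpDr.
have l0 : 0 < l by rewrite lt_min ltr01 divr_gt0 // divr_gt0.
have l1 : l <= 1 by rewrite ge_min lexx.
exists (fun x => (1 + l * C) * (nu x + l * th x)); first exact: hl.
move=> f fF; have BS : B f <= S by rewrite /S (big_rem _ fF) /= lerDl sumr_ge0.
have : l * B f <= e / 2.
  apply: (@le_trans _ _ (e / 2 / (1 + S) * (1 + S))).
    apply: ler_pM => //; [exact: ltW|by rewrite ge_min lexx orbT|].
    by apply: le_trans BS _; rewrite lerDr.
  by rewrite divfK // gt_eqF.
have := hF f fF; rewrite /B => h2 h3.
have g : l * (l * (C * th f)) <= l * (C * th f).
  by rewrite ler_piMl // !mulr_ge0 // ltW.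
have -> : (1 + l * C) * (nu f + l * th f) = nu f + l * (C * nu f + th f + C * th f)
  - (l * (C * th f) - l * (l * (C * th f))) by ring.
lra.
Qed.

End AdaptedNorms.

(** * Convergence in a convenient algebra *)

Section SmallSequences.
Variable R : realType.
Implicit Types f g : nat -> R.

(** One-sided on purpose: for values of a seminorm this is convergence to 0, and for a constant it
    says that the constant is at most 0. *)
Definition small_seq f : Prop :=
  forall e, 0 < e -> exists N0, forall N, (N0 <= N)%N -> f N <= e.

Lemma small_seq_le f g : (forall N, f N <= g N) -> small_seq g -> small_seq f.
Proof.
by move=> fg hg e /hg[N0 h]; exists N0 => N /h; apply: le_trans.
Qed.

Lemma small_seqD f g : small_seq f -> small_seq g -> small_seq (fun N => f N + g N).
Proof.
move=> hf hg e e0; have e2 : 0 < e / 2 by rewrite divr_gt0.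
have [N hN] := hf _ e2; have [M hM] := hg _ e2.
exists (maxn N M) => k; rewrite geq_max => /andP[/hN h1 /hM h2]; lra.
Qed.

Lemma small_seqZ f (K : R) : 0 <= K -> small_seq f -> small_seq (fun N => K * f N).
Proof.
move=> K0 hf e e0; have K1 : 0 < K + 1 by rewrite ltr_wpDl.
have [|N hN] := hf (e / (K + 1)); first by rewrite divr_gt0.
exists N => n /hN h; apply: le_trans (ler_wpM2l K0 h) _.
by rewrite mulrCA ler_piMr ?(ltW e0) // ler_pdivrMr // mul1r lerDl.
Qed.

Lemma small_seq_sum (I : finType) (F : I -> nat -> R) :
  (forall k, small_seq (F k)) -> small_seq (fun N => \sum_k F k N).
Proof.
move=> h; rewrite /index_enum; elim: (Finite.enum _) => [|k r IH] /=.
  by move=> e e0; exists 0%N => N _; rewrite big_nil ltW.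
apply: small_seq_le (small_seqD (h k) IH) => N; by rewrite big_cons.
Qed.

Lemma small_seq_geo (C z : R) : 0 <= z -> z < 1 -> small_seq (fun N => C * z ^+ N).
Proof.
move=> z0 z1 e e0; have : geometric C z n @[n --> \oo] --> 0.
  by apply: cvg_geometric; rewrite ger0_norm.
move=> /cvgr0Pnorm_le /(_ _ e0)[N _ hN]; exists N => n /hN.
by apply: le_trans; apply: ler_norm.
Qed.

Lemma small_seq_shift f k : small_seq f -> small_seq (fun N => f (N + k)%N).
Proof.
move=> h e /h[N hN]; exists N => n nN; apply: hN.
by rewrite (leq_trans nN) // leq_addr.
Qed.

Lemma small_seq_le0 (x : R) : small_seq (fun=> x) -> x <= 0.
Proof.
move=> h; apply/ler_addgt0Pr => e e0; rewrite add0r.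
by have [N hN] := h e e0; apply: (hN N).
Qed.

Lemma sum_geo4 N : \sum_(r < N) (4^-1 : R) ^+ r <= 2.
Proof.
suff : \sum_(r < N) (4^-1 : R) ^+ r <= 2 - 2 * (4^-1) ^+ N.
  by move=> h; apply: le_trans h _; rewrite gerBl mulr_ge0 // exprn_ge0 // invr_ge0.
elim: N => [|N IH]; first by rewrite big_ord0 expr0; lra.
have : 0 <= (4^-1 : R) ^+ N by rewrite exprn_ge0 // invr_ge0.
rewrite big_ord_recr /= exprS; lra.
Qed.

(** The reason for the ratio 1/4 in [geo]: the error of a Cauchy product contains N terms of size
    4^-N, and their sum still decays geometrically. *)
Lemma mul_geo4_le N : N%:R * (4^-1 : R) ^+ N <= (2^-1) ^+ N.
Proof.
have -> : (4^-1 : R) = 2^-1 * 2^-1 by lra.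
rewrite exprMn mulrA ler_piMl ?exprn_ge0 ?invr_ge0 //.
rewrite exprVn -natrX ler_pdivrMr ?ltr0n ?expn_gt0 //.
by rewrite mul1r ler_nat ltnW // ltn_expl.
Qed.

End SmallSequences.

Section Limits.
Variables (R : realType) (A : convAlgType R).
Implicit Types (u v : nat -> A) (l : A).

Definition tends u l : Prop :=
  forall i nu, snorm i nu -> small_seq (fun N => nu (u N - l)).

Lemma small_snorm i nu nu' u : snorm i nu -> snorm i nu' ->
  small_seq (fun N => nu (u N)) -> small_seq (fun N => nu' (u N)).
Proof.
move=> h [hs' _ hv' _] hs; have [K K0 hK] := snorm_dominates h hs' hv'.
exact: (small_seq_le (g := fun N => K * nu (u N))) (small_seqZ K0 hs).
Qed.

(** One seminorm per level suffices, since any two of the same level are equivalent. *)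
Lemma tends_ex u l : (forall i, exists2 nu, snorm i nu & small_seq (fun N => nu (u N - l))) ->
  tends u l.
Proof. by move=> h i nu' h'; have [nu hnu] := h i; apply: (small_snorm (u := fun N => u N - l) hnu h'). Qed.

Lemma tends_conv_to u l : tends u l -> conv_to u l.
Proof.
move=> h i d c hc; have [nu hnu] := @snorm_exists R A i.
have [|K K0 hK] := snorm_coord_le hnu (c := c); first by move=> x /(proj1 hc).
apply/cvgrPdist_le => e e0.
have [|N hN] := small_seqZ (ltW K0) (h i nu hnu) (e := e); first by [].
exists N => // n nN; rewrite distrC -linearB /= [leLHS]mx_normrE.
apply: bigmax_le => [|[a b] _]; first exact: ltW.
by rewrite (ord1 a); apply: le_trans (hK _ _) (hN n nN).
Qed.

Lemma snorm_null l i nu : snorm i nu -> small_seq (fun=> nu l) -> nu l = 0.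
Proof.
move=> h /small_seq_le0 hl; apply/eqP; rewrite eq_le hl /= seminorm_ge0 //.
by case: h.
Qed.

Lemma tends_uniq u l l' : tends u l -> tends u l' -> l = l'.
Proof.
move=> h h'; apply/eqP; rewrite -subr_eq0; apply/eqP/filt_eq0 => i.
have [nu hnu] := @snorm_exists R A i; apply: (snorm_eq0 hnu).
apply: (snorm_null hnu); have hs : seminorm nu by case: hnu.
apply: small_seq_le (small_seqD (h i nu hnu) (h' i nu hnu)) => N.
rewrite [leRHS]addrC -[nu (u N - l)](seminormN hs) opprB.
have -> : l - l' = (u N - l') + (l - u N) by nc_ring.
exact: (proj1 hs).
Qed.

Lemma tends_eventually u l N0 : (forall N, (N0 <= N)%N -> u N = l) -> tends u l.
Proof.
move=> h i nu hnu e e0; exists N0 => N /h ->; rewrite subrr (seminorm0 (p := nu)) ?ltW //.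
by case: hnu.
Qed.

Lemma tendsD u v l l' : tends u l -> tends v l' -> tends (fun N => u N + v N) (l + l').
Proof.
move=> h h' i nu hnu.
apply: small_seq_le (small_seqD (h i nu hnu) (h' i nu hnu)) => N.
have -> : u N + v N - (l + l') = (u N - l) + (v N - l') by nc_ring.
by case: hnu => -[].
Qed.

Lemma tendsMl x u l : tends u l -> tends (fun N => x * u N) (x * l).
Proof.
move=> h i nu hnu; have [hs hm _ _] := hnu.
apply: small_seq_le (small_seqZ (seminorm_ge0 hs x) (h i nu hnu)) => N.
by rewrite -mulrBr hm.
Qed.

Lemma tendsMr x u l : tends u l -> tends (fun N => u N * x) (l * x).
Proof.
move=> h i nu hnu; have [hs hm _ _] := hnu.
apply: small_seq_le (small_seqZ (seminorm_ge0 hs x) (h i nu hnu)) => N.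
by rewrite -mulrBl mulrC hm.
Qed.

Lemma tendsZ (a : R) u l : tends u l -> tends (fun N => a *: u N) (a *: l).
Proof.
move=> /(tendsMl a%:A) h; have e x : a *: x = a%:A * x by rewrite -scalerAl mul1r.
rewrite e; suff -> : (fun N => a *: u N) = (fun N => a%:A * u N) by [].
by apply/funext => N; apply: e.
Qed.

Lemma tends_snorm_le u l i nu b : snorm i nu -> tends u l -> (forall N, nu (u N) <= b) ->
  nu l <= b.
Proof.
move=> hnu h hb; have hs : seminorm nu by case: hnu.
rewrite -subr_le0; apply: small_seq_le0; apply: small_seq_le (h i nu hnu) => N.
have -> : nu (u N - l) = nu (l - u N) by rewrite -(seminormN hs) opprB.
rewrite lerBlDr; have {1}-> : l = (l - u N) + u N by rewrite subrK.
by apply: le_trans (proj1 hs _ _) _; rewrite lerD2l.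
Qed.

Definition geo (nu : A -> R) u := exists2 C, 0 <= C & forall r, nu (u r) <= C * (4^-1) ^+ r.

Lemma geo_snorm i nu nu' u : snorm i nu -> snorm i nu' -> geo nu u -> geo nu' u.
Proof.
move=> h [hs' _ hv' _] [C C0 hC]; have [K K0 hK] := snorm_dominates h hs' hv'.
exists (K * C); first exact: mulr_ge0.
by move=> r; apply: le_trans (hK _) _; rewrite -mulrA ler_wpM2l.
Qed.

Lemma geo_partial nu u C N k : seminorm nu -> 0 <= C -> (forall r, nu (u r) <= C * (4^-1) ^+ r) ->
  nu (\sum_(r < N + k) u r - \sum_(r < N) u r) <= C * 2 * (4^-1) ^+ N.
Proof.
move=> hs C0 hC.
rewrite big_split_ord /= addrAC subrr add0r; apply: le_trans (seminorm_sum hs _ _ _) _.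
apply: (@le_trans _ _ (\sum_(r < k) C * (4^-1) ^+ N * (4^-1) ^+ r)).
  by apply: ler_sum => r _; apply: le_trans (hC _) _; rewrite exprD mulrA.
rewrite -mulr_sumr; have -> : C * 2 * (4^-1) ^+ N = C * (4^-1) ^+ N * 2 by ring.
by apply: ler_wpM2l (sum_geo4 _ _); rewrite mulr_ge0 // exprn_ge0 // invr_ge0.
Qed.

(** Each coordinate converges absolutely; the limit is determined modulo A^(i) only. *)
Lemma level_complete i nu u : snorm i nu -> geo nu u ->
  exists l, small_seq (fun N => nu (\sum_(r < N) u r - l)).
Proof.
move=> hnu [C C0 hC]; have [hs _ hv _] := hnu.
have [d [c hc]] := @filt_fin_dim R A i.
have [|K K0 hK] := snorm_coord_le hnu (c := c); first by move=> x /(proj1 hc).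
have cv j : cvgn (series (fun r => c (u r) 0 j)).
  apply: normed_cvg.
  apply: (series_le_cvg (v_ := geometric (K * C) 4^-1)) => [r|r|r|] //=.
  - by rewrite mulr_ge0 // ?mulr_ge0 // ?exprn_ge0 ?invr_ge0 // ltW.
  - by apply: le_trans (hK _ _) _; rewrite -mulrA; apply: ler_wpM2l => //; apply: ltW.
  by apply: is_cvg_geometric_series; rewrite ger0_norm ?invr_ge0 // invf_lt1 // ltr1n.
have [l hl] := (proj2 hc) (\row_j limn (series (fun r => c (u r) 0 j))).
exists l; have [K' K'0 hK'] := seminorm_le_coord hc hs hv.
apply: small_seq_le (fun N => hK' _) _; apply: small_seqZ => //.
apply: small_seq_sum => j e e0.
have /cvgrPdist_le /(_ _ e0)[N _ hN] := cv j.
exists N => n /hN; rewrite distrC linearB /= hl !mxE linear_sum summxE.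
by rewrite /series /= big_mkord.
Qed.

Lemma geo_tail i nu u C l : snorm i nu -> 0 <= C -> (forall r, nu (u r) <= C * (4^-1) ^+ r) ->
  small_seq (fun N => nu (\sum_(r < N) u r - l)) ->
  forall N, nu (\sum_(r < N) u r - l) <= C * 2 * (4^-1) ^+ N.
Proof.
move=> hnu C0 hC hl N; have [hs _ _ _] := hnu.
rewrite -subr_le0; apply: small_seq_le0.
apply: small_seq_le (small_seq_shift N hl) => k.
rewrite lerBlDr.
have -> : \sum_(r < N) u r - l =
  (\sum_(r < k + N) u r - l) + - (\sum_(r < k + N) u r - \sum_(r < N) u r) by nc_ring.
apply: le_trans (proj1 hs _ _) _; rewrite lerD2l (seminormN hs) addnC.
exact: geo_partial hC.
Qed.

(** The limits found in the quotients A/A^(i) are compatible, because convergence at level j implies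
    convergence at every level i <= j; completeness for the filtration glues them. *)
Lemma series_complete u : (forall i, exists2 nu, snorm i nu & geo nu u) ->
  exists l, tends (fun N => \sum_(r < N) u r) l.
Proof.
move=> h; have hl i : exists l, forall nu, snorm i nu -> small_seq (fun N => nu (\sum_(r < N) u r - l)).
  have [nu hnu g] := h i; have [l hl] := level_complete hnu g.
  by exists l => nu' h'; apply: (small_snorm (u := fun N => \sum_(r < N) u r - l) hnu h' hl).
have [f hf] := choice hl.
have hd i j nu : (i <= j)%N -> snorm i nu -> nu (f j - f i) = 0.
  move=> ij hnu; have [hs _ hv hd] := hnu.
  have [nuj hj] := @snorm_exists R A j.
  have [x jx|K K0 hK] := snorm_dominates hj hs; first by apply/hv/(filt_le ij).
  apply: (snorm_null hnu).
  apply: small_seq_le (small_seqD (hf i nu hnu) (small_seqZ K0 (hf j nuj hj))) => N.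
  have -> : f j - f i = (\sum_(r < N) u r - f i) + - (\sum_(r < N) u r - f j) by nc_ring.
  by apply: le_trans (proj1 hs _ _) _; rewrite lerD2l (seminormN hs); apply: hK.
have [l hlim] : exists l, forall n, filt n (f n - l).
  apply: filt_cauchy_lim => n; have [nu hnu] := @snorm_exists R A n.
  by apply: (snorm_eq0 hnu); apply: hd.
exists l => i nu hnu; have [hs _ hv _] := hnu.
apply: small_seq_le (hf i nu hnu) => N.
rewrite le_eqVlt; apply/orP; left; apply/eqP/(seminorm_eqP hs).
have -> : \sum_(r < N) u r - l - (\sum_(r < N) u r - f i) = f i - l by nc_ring.
exact: hv.
Qed.

Definition cauchy_prod u v (r : nat) : A := \sum_(s < r.+1) u s * v (r - s)%N.

Lemma cauchy_prod_sum u v N : \sum_(r < N) cauchy_prod u v r =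
  \sum_(s < N) u s * \sum_(t < N - s) v t.
Proof.
elim: N => [|N IH]; first by rewrite !big_ord0.
rewrite big_ord_recr /= IH /cauchy_prod !big_ord_recr /= subnn addrA subSn // subnn.
rewrite big_ord_recl big_ord0 addr0; congr (_ + _).
rewrite -big_split /=; apply: eq_bigr => s _; rewrite -mulrDr subSn; last exact: ltnW.
by rewrite big_ord_recr.
Qed.

(** The partial sums run over a triangle. Completing each row by the tail of v leaves N errors, u_s
    times the tail from N - s on, each of order 4^-N. *)
Lemma tends_cauchy_prod u v l l' :
  (forall i, exists2 nu, snorm i nu & geo nu u) ->
  (forall i, exists2 nu, snorm i nu & geo nu v) ->
  tends (fun N => \sum_(r < N) u r) l -> tends (fun N => \sum_(r < N) v r) l' ->
  tends (fun N => \sum_(r < N) cauchy_prod u v r) (l * l').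
Proof.
move=> gu gv hu hv; apply: tends_ex => i; have [nu hnu [C C0 hC]] := gu i.
have [nu' hnu' /(geo_snorm hnu' hnu)[D D0 hD]] := gv i.
have [hs hm _ _] := hnu; exists nu => //.
have n0 x : 0 <= nu x by apply: seminorm_ge0.
have tv := geo_tail hnu D0 hD (hv i nu hnu).
apply: (@small_seq_le _ _ (fun N => C * (D * 2) * (2^-1) ^+ N + nu l' * nu (\sum_(r < N) u r - l))).
  move=> N; rewrite cauchy_prod_sum.
  have -> : \sum_(s < N) u s * \sum_(t < N - s) v t - l * l' =
     \sum_(s < N) u s * (\sum_(t < N - s) v t - l') + (\sum_(r < N) u r - l) * l'.
    rewrite mulrBl mulr_suml addrA -big_split /=; congr (_ - _).
    by apply: eq_bigr => s _; rewrite mulrBr subrK.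
  apply: le_trans (proj1 hs _ _) _; apply: lerD; last by rewrite mulrC hm.
  apply: le_trans (seminorm_sum hs _ _ _) _.
  apply: (@le_trans _ _ (\sum_(s < N) C * (D * 2) * (4^-1) ^+ N)).
    apply: ler_sum => s _; apply: le_trans (hm _ _) _.
    have -> : C * (D * 2) * (4^-1) ^+ N = C * (4^-1) ^+ s * (D * 2 * (4^-1) ^+ (N - s)).
      by rewrite -[in LHS](subnKC (ltnW (ltn_ord s))) exprD; ring.
    by apply: ler_pM.
  rewrite sumr_const card_ord -mulrnAr ler_wpM2l ?mulr_ge0 //.
  by rewrite -mulr_natl mul_geo4_le.
apply: small_seqD; last exact: (small_seqZ (n0 _) (hu i nu hnu)).
by apply: small_seq_geo; rewrite ?invr_ge0 // invf_lt1 // ltr1n.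
Qed.

End Limits.

(** * Existence of the polarization *)

Section InverseSquareRoot.
Variable R : realType.

(* The coefficients of the power series (1 - X)^(-1/2). *)
Definition isqrt_coef (k : nat) : R := \prod_(j < k) ((2 * j + 1)%:R / (2 * j + 2)%:R).

Lemma isqrt_coefS k : k.+1%:R * isqrt_coef k.+1 = (k%:R + 2^-1) * isqrt_coef k.
Proof.
rewrite /isqrt_coef big_ord_recr /= -[k.+1]addn1.
have -> : (2 * k + 2 = 2 * (k + 1))%N by rewrite mulnDr muln1.
have k0 : 0 <= k%:R :> R by [].
rewrite !natrD; field; lra.
Qed.

Lemma isqrt_coef_ge0 k : 0 <= isqrt_coef k.
Proof. by apply: prodr_ge0 => j _; rewrite divr_ge0. Qed.

Lemma isqrt_coef_le1 k : isqrt_coef k <= 1.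
Proof.
rewrite /isqrt_coef; apply: prodr_ile1 => j _; rewrite divr_ge0 //=.
by rewrite ler_pdivrMr ?ltr0n ?addn2 // mul1r ler_nat addn1.
Qed.

(** The equation 2 (1 - X) y' = y of y = (1 - X)^(-1/2), in coefficients. By the symmetry j <-> n -
    j, the sum weighted by j is n / 2 times the unweighted sum S_n, and [isqrt_coefS] then gives (n
    + 1) S_(n+1) = (n + 1) S_n. *)
Lemma isqrt_coef_conv n : \sum_(j < n.+1) isqrt_coef j * isqrt_coef (n - j) = 1.
Proof.
pose b := isqrt_coef; pose S n := \sum_(j < n.+1) b j * b (n - j)%N.
rewrite -/(S n); elim: n => [|n IH].
  by rewrite /S big_ord_recl big_ord0 /= /b /isqrt_coef big_ord0 mulr1 addr0.
have sym n' : \sum_(j < n'.+1) j%:R * (b j * b (n' - j)%N) = n'%:R / 2 * S n'.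
  have e : \sum_(j < n'.+1) j%:R * (b j * b (n' - j)%N) =
           \sum_(j < n'.+1) (n' - j)%:R * (b j * b (n' - j)%N).
    rewrite (reindex_inj rev_ord_inj) /=; apply: eq_bigr => j _.
    have jn : (j <= n')%N by rewrite -ltnS.
    by rewrite subSS subKn // [b j * _]mulrC.
  have : \sum_(j < n'.+1) j%:R * (b j * b (n' - j)%N) +
         \sum_(j < n'.+1) (n' - j)%:R * (b j * b (n' - j)%N) = n'%:R * S n'.
    rewrite -big_split /= mulr_sumr; apply: eq_bigr => j _.
    have jn : (j <= n')%N by rewrite -ltnS.
    by rewrite -mulrDl -natrD subnKC.
  by rewrite -e => h; lra.
have := sym n.+1; rewrite big_ord_recl mul0r add0r.
have -> : \sum_(i < n.+1) (lift ord0 i)%:R * (b (lift ord0 i) * b (n.+1 - lift ord0 i)%N) =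
    n%:R / 2 * S n + 2^-1 * S n.
  rewrite -sym mulr_sumr -big_split /=; apply: eq_bigr => j _.
  by rewrite /bump /= add1n subSS mulrA isqrt_coefS -/(b j); ring.
rewrite IH; have n1 : n%:R + 1 != 0 :> R by rewrite natr1 pnatr_eq0.
move=> h; apply: (mulfI n1); rewrite mulr1.
have -> : (n%:R + 1) * S n.+1 = 2 * (n.+1%:R / 2 * S n.+1) by rewrite -natr1; field.
by rewrite -h; field.
Qed.

Definition isqrt_poly (N : nat) : {poly R} := \poly_(k < N) isqrt_coef k.

(** The power series identity y^2 (1 - X) = 1 with a polynomial remainder, so that it can be
    evaluated at an element of an algebra or at another polynomial. *)
Lemma isqrt_polyE N : exists s : {poly R}, isqrt_poly N ^+ 2 * (1 - 'X) = 1 + 'X^N * s.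
Proof.
have hc n : (n < N)%N -> (isqrt_poly N ^+ 2)`_n = 1.
  move=> nN; rewrite expr2 coefM -(isqrt_coef_conv n); apply: eq_bigr => j _.
  have jn : (j <= n)%N by rewrite -ltnS.
  by rewrite !coef_poly !ifT // (leq_ltn_trans _ nN) // leq_subr.
pose q := isqrt_poly N ^+ 2 * (1 - 'X) - 1.
exists (drop_poly N q); rewrite ['X^N * _]mulrC.
have : take_poly N q = 0.
  apply/polyP => n; rewrite coef_take_poly coef0; case: ifP => // nN.
  rewrite /q coefB mulrBr mulr1 coefB coefMX coef1 (hc _ nN).
  by case: n nN => [|n] nN /=; rewrite ?subr0 ?subrr // hc ?subrr ?subr0 // ltnW.
move=> t0; have := poly_take_drop N q; rewrite t0 add0r => ->.
by rewrite /q subrKC.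
Qed.

End InverseSquareRoot.

(** * Real polynomials with prescribed values on a spectrum *)

Section Interpolation.
Local Open Scope complex_scope.
Variable R : realType.

Lemma interpolation (F : fieldType) (s : seq F) (phi : F -> F) :
  exists w : {poly F}, forall z, z \in s -> w.[z] = phi z.
Proof.
elim: s => [|a s [w hw]]; first by exists 0.
have [sa|sa] := boolP (a \in s).
  by exists w => z; rewrite inE => /predU1P[->|]; apply: hw.
pose P := \prod_(z <- s) ('X - z%:P).
have Pa : P.[a] != 0.
  by rewrite -rootE root_prod_XsubC.
exists (w + ((phi a - w.[a]) / P.[a]) *: P) => z; rewrite inE hornerD hornerZ.
have [->|za] := eqVneq z a => /= [_|sz]; first by rewrite divfK // subrKC.
have : root P z by rewrite root_prod_XsubC.
by move=> /rootP ->; rewrite mulr0 addr0 hw.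
Qed.

Local Notation real_poly_complex := (map_poly (real_complex R)).

(* Interpolation on a set stable under conjugation, by a function which commutes with
   conjugation: the real part of the interpolating polynomial still interpolates. *)
Lemma sign_interpolation (s : seq R[i]) : (forall z, z \in s -> complex.Im z != 0) ->
  exists p : {poly R}, forall z, z \in s ->
    (real_poly_complex p).[z] = if 0 < complex.Im z then 'i else - 'i.
Proof.
move=> hs; pose phi (z : R[i]) := if 0 < complex.Im z then 'i else - 'i : R[i].
have [w hw] := interpolation (s ++ map conjc s) phi.
exists (map_poly (@complex.Re R) w) => z zs.
have e : real_poly_complex (map_poly (@complex.Re R) w) = 2^-1 *: (w + map_poly conjc w).
  apply/polyP => k; rewrite coefZ coefD !coef_map_id0 ?conjc0 //.
  by rewrite ReJ_add mulrC.
rewrite e hornerZ hornerD hw ?mem_cat ?zs // -/(phi z).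
have -> : (map_poly conjc w).[z] = phi z.
  rewrite -{1}[z]conjcK horner_map /= hw ?mem_cat ?map_f ?orbT //.
  rewrite /phi; case: z zs => a b /hs /= b0; rewrite oppr_gt0.
  by case: (ltgtP b 0) b0 => //= _ _; apply/eqP; rewrite eq_complex /= ?oppr0 ?opprK !eqxx.
by rewrite -[phi z + _]mulr2n -[phi z *+ 2]mulr_natl mulKf ?pnatr_eq0.
Qed.

End Interpolation.

Section Polarization.
Variables (R : realType) (A : convAlgType R).
Implicit Types (H Q : A).

(* The algebraic characterization of [Q = pol H]. With Q as an imaginary unit, it says that
   the spectrum of H lies in the open upper half plane. *)
Definition polar H Q : Prop :=
  [/\ Q * Q = -1, Q * H = H * Q &
      forall x y : R, 0 <= y -> H + x%:A + y *: Q \is a GRing.unit].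

Lemma pol_dom_unit H x : pol_dom H -> H + x%:A \is a GRing.unit.
Proof.
(* At t = pi/2 - atan x, the element cos t + sin t H is a nonzero multiple of H + x. *)
move=> hH; pose a := atan x; have ca : cos a != 0 by rewrite cos_atan invr_eq0 gt_eqF // sqrtr_gt0 ltr_wpDr // sqr_ge0.
have := hH (pi / 2 - a); rewrite cosB sinB cos_pihalf sin_pihalf !mul0r !mul1r add0r subr0.
have -> : sin a = cos a * x by rewrite -[in RHS](atanK x) /tan mulrC divfK.
rewrite -scalerA -scalerDr scaler_unit ?unitfE //.
by rewrite addrC.
Qed.

Lemma pol_domP H : (forall x : R, H + x%:A \is a GRing.unit) -> pol_dom H.
Proof.
move=> h t; have [s0|s0] := eqVneq (sin t) 0.
  rewrite s0 scale0r addr0 scaler_unit ?unitr1 // unitfE.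
  apply/eqP => c0; have := cos2Dsin2 t; rewrite s0 c0 expr0n addr0 => /eqP.
  by rewrite eq_sym oner_eq0.
have -> : (cos t)%:A + sin t *: H = sin t *: (H + (cos t / sin t)%:A).
  by rewrite scalerDr scalerA mulrC divfK // addrC.
by rewrite scaler_unit ?unitfE.
Qed.

Lemma polar_pol_dom H Q : polar H Q -> pol_dom H.
Proof.
by case=> _ _ h; apply: pol_domP => x; have := h x 0 (lexx _); rewrite scale0r addr0.
Qed.

Lemma horner_algE H (p : {poly R}) : horner_alg H p = \sum_(k < size p) p`_k *: H ^+ k.
Proof.
rewrite -[in LHS](coefK p) poly_def linear_sum; apply: eq_bigr => k _.
by rewrite linearZ /= rmorphXn /= horner_algX mulr_algl.
Qed.

(** The d + 1 powers 1, H, ..., H^d are linearly dependent in the d-dimensional quotient. *)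
Lemma annihilating_poly i H : exists2 p : {poly R}, p != 0 & filt i (horner_alg H p).
Proof.
have [d [c hc]] := @filt_fin_dim R A i.
pose M := \matrix_(k < d.+1) c (H ^+ k).
have : kermx M != 0.
  by rewrite kermx_eq0 -row_leq_rank -ltnNge ltnS rank_leq_col.
case/rowV0Pn => v /sub_kermxP vM v0; exists (rVpoly v).
  by apply: contra v0 => /eqP p0; rewrite -[v]rVpolyK p0 linear0.
apply/(proj1 hc).
have -> : horner_alg H (rVpoly v) = \sum_(k < d.+1) v 0 k *: H ^+ k.
  rewrite [in LHS](row_sum_delta v) !linear_sum; apply: eq_bigr => k _.
  by rewrite !linearZ /= rVpoly_delta rmorphXn /= horner_algX mulr_algl.
rewrite (linear_sum c) -[RHS]vM mulmx_sum_row; apply: eq_bigr => k _.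
by rewrite linearZ rowK.
Qed.

(** A real root x can be divided out because H - x is invertible; the degree drops. *)
Lemma annihilating_poly_noroot H : pol_dom H ->
  exists m : {poly R}, [/\ m != 0, filt 1 (horner_alg H m) & forall x, ~~ root m x].
Proof.
move=> hH; have [p p0 hp] := annihilating_poly 1 H.
have [n] := ubnP (size p); elim: n p p0 hp => // n IH p p0 hp pn.
have [[x px]|nr] := pselect (exists x, root p x); last first.
  by exists p; split=> // x; apply/negP => px; apply: nr; exists x.
have [q pq] := factor_theorem p x px.
have q0 : q != 0 by apply: contraNneq p0 => q0; rewrite pq q0 mul0r.
apply: (IH q q0); last first.
  move: pn; rewrite pq size_mul ?polyXsubC_eq0 // size_XsubC addn2 /=.
  by rewrite ltnS.
have /mulrK e := pol_dom_unit (- x) hH.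
rewrite -[horner_alg H q]e; apply: filtMl.
have -> : horner_alg H q * (H + (- x)%:A) = horner_alg H p by
  rewrite pq rmorphM /= rmorphB /= horner_algX horner_algC scaleNr.
by [].
Qed.

Lemma poly_comm H (p q : {poly R}) : horner_alg H p * horner_alg H q = horner_alg H q * horner_alg H p.
Proof. by rewrite -!rmorphM mulrC. Qed.

Lemma comm_horner_alg H x (p : {poly R}) : x * H = H * x -> x * horner_alg H p = horner_alg H p * x.
Proof.
move=> h; rewrite horner_algE; apply: commr_sum => k _.
have : GRing.comm x (H ^+ k) by apply: commrX.
by rewrite /GRing.comm -scalerAr -scalerAl => ->.
Qed.

End Polarization.

Section PolarExistence.
Local Open Scope complex_scope.
Variables (R : realType) (A : convAlgType R).
Implicit Types (H Q : A).
Local Notation toC := (map_poly (real_complex R)).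

Lemma unitD_filt1 x y : x \is a GRing.unit -> filt 1 (y : A) -> x + y \is a GRing.unit.
Proof.
move=> ux fy; have -> : x + y = x * (1 - - (x^-1 * y)).
  by rewrite opprK mulrDr mulr1 mulrA divrr // mul1r.
by rewrite unitrMl //; apply/unit_1sub_filt1/filtN/filtMr.
Qed.

(** The power makes up for repeated entries of s: each linear factor divides its own copy of g. *)
Lemma dvdp_prod_XsubC_exp (F : fieldType) (s : seq F) (g : {poly F}) :
  (forall z, z \in s -> root g z) -> \prod_(z <- s) ('X - z%:P) %| g ^+ size s.
Proof.
elim: s => [|z s IH] h; first by rewrite big_nil dvd1p.
rewrite big_cons exprS dvdp_mul //; first by rewrite dvdp_XsubCl h ?mem_head.
by apply: IH => w ws; apply: h; rewrite inE ws orbT.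
Qed.

Lemma filt_lim_comm x l (u : nat -> A) : (forall n, filt n (u n - l)) ->
  (forall n, x * u n = u n * x) -> x * l = l * x.
Proof.
move=> hu hx; apply/eqP; rewrite -subr_eq0; apply/eqP/filt_eq0 => n.
have -> : x * l - l * x = (u n - l) * x - x * (u n - l) + (x * u n - u n * x) by nc_ring.
by rewrite hx subrr addr0; apply: filtB; [apply: filtMl|apply: filtMr].
Qed.

(** Z is (1 - Y)^(-1/2), summed in the filtration; its partial sums are polynomials in Y, whence the
    commutation. *)
Lemma isqrt_lift (Y : A) : filt 1 Y -> exists Z : A,
  [/\ Z * Z * (1 - Y) = 1, filt 1 (Z - 1) & forall x, x * Y = Y * x -> x * Z = Z * x].
Proof.
move=> Y1; pose u n := horner_alg Y (isqrt_poly R n).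
have hY n : filt n (Y ^+ n) by have := filtX n Y1; rewrite muln1.
have uE n : u n = \sum_(k < n) isqrt_coef R k *: Y ^+ k.
  rewrite /u /isqrt_poly poly_def linear_sum; apply: eq_bigr => k _.
  by rewrite linearZ /= rmorphXn /= horner_algX mulr_algl.
have [Z hZ] := filt_series (fun n => filtZ (isqrt_coef R n) (hY n)).
have {}hZ n : filt n (u n - Z) by rewrite uE.
exists Z; split; last by move=> x xY; apply: filt_lim_comm hZ _ => n; apply: comm_horner_alg.
  apply/eqP; rewrite -subr_eq0; apply/eqP/filt_eq0 => n.
  have [s hs] := isqrt_polyE R n.
  have : u n * u n * (1 - Y) = 1 + Y ^+ n * horner_alg Y s.
    have := congr1 (horner_alg Y) hs; rewrite expr2.
    by rewrite !(rmorphM, rmorphB, rmorphD, rmorph1, rmorphXn) /= !horner_algX.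
  move=> e; have -> : Z * Z * (1 - Y) - 1 = Y ^+ n * horner_alg Y s
     - (u n - Z) * u n * (1 - Y) - Z * (u n - Z) * (1 - Y) + 
       (u n * u n * (1 - Y) - (1 + Y ^+ n * horner_alg Y s)) by nc_ring.
  rewrite e subrr addr0; apply: filtB; first apply: filtB.
  - exact: filtMl.
  - by do 2 apply: filtMl.
  by apply/filtMl/filtMr.
have := hZ 1; rewrite uE big_ord_recl big_ord0 /isqrt_coef big_ord0 scale1r expr0 addr0.
by move/filtN; rewrite opprB.
Qed.

Lemma polar_exists H : pol_dom H -> exists Q, polar H Q.
Proof.
move=> hH; have [m [m0 hm nr]] := annihilating_poly_noroot hH.
have [r hr] := closed_field_poly_normal (toC m).
have lc0 : lead_coef (toC m) != 0 by rewrite lead_coef_eq0 map_poly_eq0.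
have rootm z : root (toC m) z = (z \in r) by rewrite hr rootZ // root_prod_XsubC.
have Imr z : z \in r -> complex.Im z != 0.
  rewrite -rootm; case: z => a b /= hz; apply: contraTneq hz => ->.
  by rewrite complexr0 fmorph_root.
have [p hp] := sign_interpolation Imr.
(* p interpolates at the roots of m without multiplicity, so m divides only a power of g. Since p^2
   = -(1 - g), the truncated series of (1 - g)^(-1/2) turns p into p2, which has the same values at
   the roots and satisfies m | p2^2 + 1. The remainder is a multiple of g^N, so N = deg m terms are
   enough. *)
pose N := size r; pose g := 1 + p ^+ 2; pose p2 := p * (isqrt_poly R N \Po g).
have gr z : z \in r -> root (toC g) z.
  move=> zr; rewrite /root rmorphD rmorph1 rmorphXn /= hornerD hornerC horner_exp hp //.
  by case: ifP => _; rewrite ?sqrrN sqr_i subrr.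
have mg : m %| g ^+ N.
  rewrite -(dvdp_map (real_complex R)) hr dvdpZl // rmorphXn /=.
  exact: dvdp_prod_XsubC_exp.
have [s hs] := isqrt_polyE R N.
have p2E : p2 ^+ 2 + 1 = - g ^+ N * (s \Po g).
  have := congr1 (fun q => q \Po g) hs.
  rewrite /= !(rmorphM, rmorphB, rmorphD, rmorph1, rmorphXn) /= !comp_polyX => e.
  have -> : p2 ^+ 2 + 1 = 1 - (isqrt_poly R N \Po g) ^+ 2 * (1 - g) by rewrite /p2 /g; ring.
  by rewrite e; ring.
have p2z z : z \in r -> (toC p2).[z] = (toC p).[z].
  move=> zr; rewrite rmorphM /= hornerM map_comp_poly horner_comp.
  have := gr z zr; rewrite /root => /eqP ->.
  rewrite horner_coef0 coef_map /isqrt_poly coef_poly.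
  have -> : (0 < N)%N by rewrite /N; case: (r) zr.
  by rewrite /= /isqrt_coef big_ord0 mulr1.
pose Q0 := horner_alg H p2.
have Q01 : filt 1 (1 + Q0 * Q0).
  have -> : 1 + Q0 * Q0 = horner_alg H (p2 ^+ 2 + 1).
    by rewrite rmorphD rmorph1 rmorphXn /= expr2 addrC.
  have : m %| p2 ^+ 2 + 1 by rewrite p2E mulNr dvdpNr dvdp_mulr.
  by move=> /dvdpP[q ->]; rewrite rmorphM; apply: filtMr.
(* At a root z of m, G takes the value z + x + y i or z + x - y i according to the sign of Im z; its
   imaginary part does not vanish. So G is prime to m, and a Bezout relation inverts G(H) modulo
   A^(1). *)
have unitG (x y : R) : 0 <= y -> H + x%:A + y *: Q0 \is a GRing.unit.
  move=> y0; pose G := 'X + x%:P + y *: p2.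
  have GE : horner_alg H G = H + x%:A + y *: Q0.
    by rewrite /G !rmorphD /= horner_algX horner_algC linearZ /= mulr_algl.
  have : coprimep m G.
    rewrite -(coprimep_map (real_complex R)).
    apply/Pdiv.ClosedField.coprimepP => z; rewrite rootm => zr.
    have -> : (toC G).[z] = z + x%:C + y%:C * (toC p2).[z].
      rewrite /G !rmorphD /= map_polyX map_polyC /= linearZ /=.
      by rewrite !hornerD hornerX hornerC hornerZ.
    rewrite p2z // hp //; move: (Imr z zr); case: z {zr} => a b /= b0.
    rewrite eq_complex negb_and; apply/orP; right.
    case: ifP => b1.
      have -> : complex.Im (a +i* b + x%:C + y%:C * 'i%C) = b + y by simpc.
      by rewrite gt_eqF // ltr_wpDr.
    have -> : complex.Im (a +i* b + x%:C + y%:C * - 'i%C) = b - y by simpc.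
    rewrite lt_eqF //; have : b < 0 by rewrite lt_neqAle b0 leNgt b1.
    by rewrite /=; lra.
  case/Bezout_coprimepP => -[u v] /=; rewrite -size_poly_eq1 => /size_poly1P[k k0 e].
  pose U := horner_alg H (k^-1 *: v).
  have hU : filt 1 (U * horner_alg H G - 1).
    have /(congr1 (horner_alg H)) : (k^-1 *: v) * G - 1 = - (k^-1 *: u * m).
      have -> : 1 = k^-1 *: (u * m + v * G) by rewrite e -mul_polyC -polyCM mulVf.
      by rewrite scalerDr !scalerAl; ring.
    rewrite !(rmorphB, rmorphM, rmorphN, rmorph1) => ->.
    by apply/filtN/filtMr.
  rewrite -GE; apply: (unit_mod_filt1 (y := U)) => //.
  by rewrite /U poly_comm.
(* Q0^2 = -1 holds modulo A^(1) only. With Z = (-Q0^2)^(-1/2), the product Q0 Z has square -1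
   exactly, and it differs from Q0 by an element of A^(1), which does not affect units. *)
have [Z [ZE Z1 Zc]] := isqrt_lift Q01.
have HQ0 : Q0 * H = H * Q0 by rewrite (@comm_horner_alg _ _ H H).
have ZQ0 : Q0 * Z = Z * Q0 by apply: Zc; nc_ring.
have ZH : H * Z = Z * H.
  by apply: Zc; rewrite mulrDl mulrDr mul1r mulr1 mulrA -HQ0 -mulrA -HQ0 mulrA.
exists (Q0 * Z); split.
- have -> : Q0 * Z * (Q0 * Z) = Z * Z * (Q0 * Q0).
    rewrite {1}ZQ0; transitivity (Z * (Q0 * Q0) * Z); first by nc_ring.
    have h : Q0 * Q0 * Z = Z * (Q0 * Q0) by rewrite -mulrA ZQ0 mulrA ZQ0 -mulrA.
    by rewrite -[LHS]mulrA h mulrA.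
  have -> : Z * Z * (Q0 * Q0) = - (Z * Z * (1 - (1 + Q0 * Q0))) by nc_ring.
  by rewrite ZE.
- by rewrite -mulrA -ZH mulrA HQ0 mulrA.
move=> x y y0.
have -> : H + x%:A + y *: (Q0 * Z) = H + x%:A + y *: Q0 + y *: (Q0 * (Z - 1)).
  by rewrite mulrBr mulr1 scalerBr -[RHS]addrA subrKC.
apply: unitD_filt1; first exact: unitG.
by apply/filtZ/filtMr.
Qed.

End PolarExistence.

(** * The integral formula *)

Section TrigonometricMean.
Variable R : realType.
Notation mu := (@lebesgue_measure R).

Lemma is_derive_sinM (b w t : R) :
  is_derive t 1 (fun s => b * sin (w * s)) (b * (w * cos (w * t))).
Proof.
have h1 : is_derive t 1 (fun s : R => w * s) w.
  by apply: is_derive_eq; rewrite /GRing.scale /= mulr1.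
have h2 := @is_derive1_comp R sin (fun s : R => w * s) t _ _ (is_derive_sin (w * t)) h1.
apply: (@is_derive_eq _ _ _ _ _ _ _ _ (is_deriveZ b h2)).
by rewrite /GRing.scale /= mulrC [cos _ * w]mulrC mulrC.
Qed.

Lemma trig_poly_mean (N : nat) (a0 : R) (a : nat -> R)
    (g := fun t : R => a0 + \sum_(k < N) 2 * cos (2 * k.+1%:R * t) * a k) :
  continuous g /\ \int[mu]_(t in `[0, 2 * pi]) g t = 2 * pi * a0.
Proof.
have cg : continuous g.
  rewrite /g; elim: N {g} => [|N IH].
    under eq_fun do rewrite big_ord0 addr0.
    by move=> x; apply: cvg_cst.
  under eq_fun do rewrite big_ord_recr /= addrA.
  move=> x; apply: cvgD; first exact: IH.
  apply: cvgM; last exact: cvg_cst.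
  apply: cvgM; first exact: cvg_cst.
  apply: continuous_comp; last exact: continuous_cos.
  by apply: cvgM; [exact: cvg_cst|exact: cvg_id].
split=> //.
pose G : R -> R := fun t : R => a0 * t + \sum_(k < N) a k / k.+1%:R * sin (2 * k.+1%:R * t).
have dG (t : R) : is_derive t 1 G (g t).
  rewrite /G /g; elim: N {g cg G} => [|N IH].
    rewrite big_ord0 addr0; under eq_fun do rewrite big_ord0 addr0.
    by apply: is_derive_eq; rewrite /GRing.scale /= mulr1.
  under eq_fun do rewrite big_ord_recr /= addrA.
  rewrite big_ord_recr addrA /=.
  have -> : 2 * cos (2 * N.+1%:R * t) * a N = a N / N.+1%:R * (2 * N.+1%:R * cos (2 * N.+1%:R * t)).
    have : N.+1%:R != 0 :> R by rewrite pnatr_eq0.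
    by move: (N.+1%:R : R) => z z0; field.
  by apply: is_deriveD; exact: is_derive_sinM.
have pi2 : 0 < 2 * pi :> R by rewrite mulr_gt0 // pi_gt0.
have dG' x : derivable G x 1 by case: (dG x).
have cG : continuous G.
  by move=> x; apply/differentiable_continuous/derivable1_diffP.
rewrite /Rintegral (@continuous_FTC2 _ g G) //=.
- have -> : G 0 = 0 by rewrite /G mulr0 add0r big1 // => k _; rewrite mulr0 sin0 mulr0.
  rewrite subr0 /G big1 ?addr0 1?[a0 * _]mulrC // => k _.
  have -> : 2 * k.+1%:R * (2 * pi) = 0 + (pi *+ 2) *+ (2 * k.+1) :> R.
    by rewrite add0r -[pi *+ 2]mulr_natl -[RHS]mulr_natl natrM; ring.
  by rewrite periodicn ?sin0 ?mulr0 //; apply: sinD2pi.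
- exact: continuous_subspaceT.
- split=> [x _||] //; first exact/cvg_at_right_filter/cG.
  exact/cvg_at_left_filter/cG.
by move=> x _; rewrite derive1E; apply: derive_val.
Qed.

(** A uniform limit of continuous functions is continuous, hence integrable here, and all the
    approximations have mean a0. *)
Lemma uniform_trig_mean (f : R -> R) (a0 : R) (a : nat -> R) :
  (forall e, 0 < e -> exists N, forall t,
     `|f t - (a0 + \sum_(k < N) 2 * cos (2 * k.+1%:R * t) * a k)| <= e) ->
  mu.-integrable `[0, 2 * pi] (EFin \o f) /\
  a0 = (2 * pi)^-1 * \int[mu]_(t in `[0, 2 * pi]) f t.
Proof.
move=> hf; have pi2 : 0 < 2 * pi :> R by rewrite mulr_gt0 // pi_gt0.
have mD : measurable (`[0, 2 * pi] : set (measurableTypeR R)) by [].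
have ci (h : R -> R) : continuous h -> mu.-integrable `[0, 2 * pi] (EFin \o h).
  move=> ch; apply: continuous_compact_integrable; first exact: segment_compact.
  exact: continuous_subspaceT.
have cf : continuous f.
  move=> x; apply/cvgrPdist_le => e e0.
  have e3 : 0 < e / 3 by rewrite divr_gt0.
  have [N hN] := hf _ e3; have [cg _] := trig_poly_mean N a0 a.
  set g := (fun t : R => _) in cg.
  have /cvgrPdist_le /(_ _ e3) hg := cg x.
  near=> y.
  have h1 := hN x; have h2 := hN y.
  have h3 : `|g x - g y| <= e / 3 by near: y.
  have -> : f x - f y = (f x - g x) + (g x - g y) - (f y - g y) by ring.
  apply: le_trans (ler_normB _ _) _; have := ler_normD (f x - g x) (g x - g y).
  move: h1 h2 h3; rewrite -/(g x) -/(g y); lra.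
split; first exact: ci.
suff /eqP : \int[mu]_(t in `[0, 2 * pi]) f t - 2 * pi * a0 = 0.
  by rewrite subr_eq0 => /eqP ->; rewrite mulKf // gt_eqF.
apply/eqP; rewrite -normr_le0; apply/ler_addgt0Pr => e e0; rewrite add0r.
have [|N hN] := hf (e / (2 * pi)); first by rewrite divr_gt0.
have [cg <-] := trig_poly_mean N a0 a.
set g := (fun t : R => _) in cg *.
rewrite -RintegralB ?ci //.
have cd : continuous (fun t => f t - g t) by move=> x; apply: cvgB; [exact: cf|exact: cg].
apply: le_trans (le_normr_Rintegral _ _) _ => //; first exact: ci.
apply: (@le_trans _ _ (\int[mu]_(t in `[0, 2 * pi]) (e / (2 * pi)))).
  apply: le_Rintegral => //.
  - by apply: ci => x; apply: cvg_norm; apply: cd.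
  - by apply: ci; apply: cst_continuous.
rewrite Rintegral_cst //= lebesgue_measure_itv /= lte_fin pi2 -EFinB /= subr0.
by rewrite divfK // gt_eqF.
Unshelve. all: by end_near.
Qed.

End TrigonometricMean.

(** * Complex scalars in A and the spectral radius *)

Section ImaginaryUnit.
Variables (R : realType) (A : convAlgType R) (Q : A).
Hypothesis QQ : Q * Q = -1.
Local Open Scope complex_scope.

Definition cplx (z : R[i]) : A := (complex.Re z)%:A + complex.Im z *: Q.

Lemma cplxD z w : cplx (z + w) = cplx z + cplx w.
Proof. by case: z w => a b [c d]; rewrite /cplx /= !scalerDl addrACA. Qed.

Lemma cplxN z : cplx (- z) = - cplx z.
Proof. by case: z => a b; rewrite /cplx /= !scaleNr opprD. Qed.

Lemma cplx1 : cplx 1 = 1.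
Proof. by rewrite /cplx /= scale1r scale0r addr0. Qed.

Lemma cplxM z w : cplx (z * w) = cplx z * cplx w.
Proof.
case: z w => a b [c d]; rewrite /cplx /=; simpc => /=.
rewrite mulrDl !mulrDr -!scalerAl !mul1r -!scalerAr !mulr1 QQ !scalerA scalerN.
rewrite scalerDl scaleNr scalerDl; set u := (a * c)%:A; set v := (b * d)%:A.
by set x := (a * d) *: Q; set y := (b * c) *: Q; nc_ring.
Qed.

Lemma cplx_rmorphism : exists f : {rmorphism R[i] -> A}, f =1 cplx.
Proof.
have fz : zmod_morphism cplx by move=> z w; rewrite cplxD cplxN.
have fm : monoid_morphism cplx by split=> [|z w]; rewrite ?cplx1 ?cplxM.
pose fzL := GRing.isZmodMorphism.Build _ _ cplx fz.
pose fmL := GRing.isMonoidMorphism.Build _ _ cplx fm.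
pose F : {rmorphism R[i] -> A} := HB.pack cplx fzL fmL.
by exists F.
Qed.

Lemma cplx_real (x : R) : cplx x%:C = x%:A.
Proof. by rewrite /cplx /= scale0r addr0. Qed.

Lemma cplx_comm x z : x * Q = Q * x -> x * cplx z = cplx z * x.
Proof. by move=> h; rewrite /cplx mulrDl mulrDr -!scalerAl -!scalerAr h mul1r mulr1. Qed.

Lemma cplx_unit z : z != 0 -> cplx z \is a GRing.unit.
Proof.
by move=> z0; apply/unitrP; exists (cplx z^-1); rewrite -!cplxM mulVf ?mulfV // cplx1.
Qed.

End ImaginaryUnit.

Section Spectral.
Variables (R : realType) (A : convAlgType R).
Implicit Types (Q K H : A).
Local Open Scope complex_scope.
Notation normc := Normc.normc.

(** Left multiplication by Q makes A a complex vector space, and the maps x -> c x - i c (Q x) are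
    complex linear. They give a norm which is exactly homogeneous for complex scalars; homogeneity
    up to a constant would be too weak for the recurrence in [spectral_radius]. *)
Lemma complex_seminorm i nu Q : Q * Q = -1 -> snorm i nu -> exists g : A -> R,
  [/\ forall x y, g (x + y) <= g x + g y, forall z x, g (cplx Q z * x) = normc z * g x,
      exists2 K, 0 <= K & forall x, g x <= K * nu x &
      exists2 K, 0 <= K & forall x, nu x <= K * g x].
Proof.
move=> QQ hnu; have [hs _ hv _] := hnu; have [d [c hc]] := @filt_fin_dim R A i.
pose l x j : R[i] := (c x 0 j) +i* (- c (Q * x) 0 j).
have lD x y j : l (x + y) j = l x j + l y j.
  by rewrite /l mulrDr !linearD !mxE opprD; simpc.
have lZ z x j : l (cplx Q z * x) j = z * l x j.
  have cE y : c (cplx Q z * y) 0 j = complex.Re z * c y 0 j + complex.Im z * c (Q * y) 0 j.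
    by rewrite /cplx mulrDl -!scalerAl mul1r linearD !linearZ !mxE.
  rewrite /l [Q * _]mulrA (@cplx_comm _ _ _ _ _ (erefl _)) -mulrA !cE mulrA QQ mulN1r linearN mxE.
  by case: z {cE} => a b /=; simpc; congr (_ +i* _); ring.
pose g x := \sum_j normc (l x j).
have gD x y : g (x + y) <= g x + g y.
  by rewrite /g -big_split; apply: ler_sum => j _; rewrite lD; apply: le_normcD.
have gZ z x : g (cplx Q z * x) = normc z * g x.
  by rewrite /g mulr_sumr; apply: eq_bigr => j _; rewrite lZ Normc.normcM.
have g0 x : filt i x -> g x = 0.
  move=> ix; apply: big1 => j _; rewrite /l.
  have -> : c x = 0 by apply/(proj1 hc).
  have -> : c (Q * x) = 0 by apply/(proj1 hc)/filtMr.
  by rewrite !mxE oppr0; apply: Normc.normc0.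
have gs : seminorm g.
  split=> // a x; have := gZ a%:C x; rewrite cplx_real mulr_algl => ->.
  by rewrite /Normc.normc /= expr0n addr0 sqrtr_sqr.
have [K K0 hK] := snorm_dominates hnu gs g0.
have [L L0 hL] := seminorm_le_coord hc hs hv.
exists g; split=> //; first by exists K.
exists L => // x; apply: le_trans (hL x) _; apply: ler_wpM2l => //.
rewrite /coord_norm /g; apply: ler_sum => j _; rewrite /l /Normc.normc.
by rewrite -sqrtr_sqr ler_sqrt ?addr_ge0 ?sqr_ge0 // lerDl sqr_ge0.
Qed.

Lemma geometric_recurrence (u e : nat -> R) (a C r : R) : 0 <= a -> a < 1 -> 0 <= C ->
  0 <= r -> r < 1 -> (forall n, u n.+1 <= a * u n + e n) -> (forall n, e n <= C * r ^+ n) ->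
  exists C' r', [/\ 0 <= C', 0 <= r', r' < 1 & forall n, u n <= C' * r' ^+ n].
Proof.
move=> a0 a1 C0 r0 r1 hu he.
(* s is at least r and strictly between a and 1; the choice of D ensures D (s - a) >= C, which
   closes the induction. *)
pose s := Num.max r ((a + 1) / 2); have rs : r <= s by rewrite le_max lexx.
have as_ : a < s by rewrite lt_max; apply/orP; right; lra.
have s1 : s < 1 by rewrite gt_max r1 /=; lra.
pose D := `|u 0%N| + C / (s - a).
have sa : 0 < s - a by rewrite subr_gt0.
have D0 : 0 <= D by rewrite addr_ge0 // divr_ge0 // ltW.
have s0 : 0 <= s by apply: le_trans rs.
exists D, s; split=> //; elim=> [|n IH].
  by rewrite mulr1; apply: le_trans (ler_norm _) _; rewrite lerDl divr_ge0 // ltW.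
have h1 : C <= D * (s - a).
  by rewrite /D mulrDl divfK ?gt_eqF // lerDr mulr_ge0 // ltW.
have h2 : C * r ^+ n <= D * (s - a) * s ^+ n.
  by apply: ler_pM; rewrite ?exprn_ge0 // lerXn2r.
have h3 := ler_wpM2l a0 IH.
apply: le_trans (hu n) _; apply: le_trans (lerD h3 (le_trans (he n) h2)) _.
have -> : a * (D * s ^+ n) + D * (s - a) * s ^+ n = D * s ^+ n.+1 by rewrite exprS; ring.
by [].
Qed.

End Spectral.

Section SpectralRadius.
Variables (R : realType) (A : convAlgType R).
Implicit Types (Q K H : A).
Local Open Scope complex_scope.
Notation normc := Normc.normc.

Lemma normc_ge0 (z : R[i]) : 0 <= normc z.
Proof. by case: z => a b; rewrite /Normc.normc sqrtr_ge0. Qed.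

(** Modulo A^(i), K is annihilated by a product of complex linear factors, which are removed one at
    a time. A factor K - z with |z| >= 1 is inverted; one with |z| < 1 turns decay of K^n (K - z) w
    into decay of K^n w by [geometric_recurrence]. *)
Lemma spectral_radius i nu Q K : Q * Q = -1 -> Q * K = K * Q ->
  (forall z, 1 <= normc z -> K - cplx Q z \is a GRing.unit) ->
  snorm i nu -> exists C r, [/\ 0 <= C, 0 <= r, r < 1 & forall n, nu (K ^+ n) <= C * r ^+ n].
Proof.
move=> QQ QK hK hnu; have [hs hm _ _] := hnu.
have [g [gD gZ [L1 L10 hL1] [L2 L20 hL2]]] := complex_seminorm QQ hnu.
have KQ z : K * cplx Q z = cplx Q z * K by rewrite cplx_comm.
have main (s : seq R[i]) w : filt i (\prod_(z <- s) (K - cplx Q z) * w) ->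
    exists C r, [/\ 0 <= C, 0 <= r, r < 1 & forall n, g (K ^+ n * w) <= C * r ^+ n].
  elim: s w => [|z s IH] w.
    rewrite big_nil mul1r => iw; exists 0, 0; split=> // n.
    apply: le_trans (hL1 _) _; rewrite mul0r.
    by case: hnu => _ _ hv _; rewrite hv ?mulr0 //; apply: filtMr.
  set P := \prod_(j <- s) (K - cplx Q j).
  have cP : (K - cplx Q z) * P = P * (K - cplx Q z).
    apply: (@commr_prod A) => j _; apply/eqP; rewrite -subr_eq0; apply/eqP.
    set a := cplx Q z; set b := cplx Q j.
    have -> : (K - a) * (K - b) - (K - b) * (K - a) = (b * K - K * b) + (K * a - a * K) + (a * b - b * a).
      by nc_ring.
    by rewrite !KQ -!cplxM // [z * j]mulrC !subrr !addr0.
  rewrite big_cons -/P cP -mulrA => /IH[C [r [C0 r0 r1 hr]]].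
  have e n : K ^+ n * ((K - cplx Q z) * w) = K ^+ n.+1 * w - cplx Q z * (K ^+ n * w).
    rewrite mulrBl mulrBr mulrA -exprSr mulrA; congr (_ - _); rewrite mulrA.
    have : GRing.comm (cplx Q z) (K ^+ n) by apply: commrX; rewrite /GRing.comm KQ.
    by rewrite /GRing.comm => ->.
  have [z1|z1] := leP 1 (normc z).
    have uz := hK z z1; set u := (K - cplx Q z)^-1.
    exists (L1 * (nu u * (L2 * C))), r; split=> // [|n].
      by rewrite !mulr_ge0 //; apply: seminorm_ge0.
    have -> : K ^+ n * w = u * (K ^+ n * ((K - cplx Q z) * w)).
      have : GRing.comm (K - cplx Q z) (K ^+ n).
        by apply: commrX; rewrite /GRing.comm mulrBl mulrBr KQ.
      by rewrite /GRing.comm => cK; rewrite [X in u * X]mulrA -cK -[_ * _ * w]mulrA mulKr.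
    apply: le_trans (hL1 _) _; rewrite -!mulrA; apply: ler_wpM2l => //.
    apply: le_trans (hm _ _) _; apply: ler_wpM2l; first exact: seminorm_ge0.
    by apply: le_trans (hL2 _) _; apply: ler_wpM2l.
  apply: (@geometric_recurrence _ _ (fun n => g (K ^+ n * ((K - cplx Q z) * w))) (normc z) C r) => //.
    exact: normc_ge0.
  move=> n; have -> : K ^+ n.+1 * w = cplx Q z * (K ^+ n * w) + K ^+ n * ((K - cplx Q z) * w).
    by rewrite e subrKC.
  by apply: le_trans (gD _ _) _; rewrite gZ.
have [p p0 hp] := annihilating_poly i K.
have [s hs'] := closed_field_poly_normal (map_poly (real_complex R) p).
have [f hf] := cplx_rmorphism QQ.
have cf : commr_rmorph f K by move=> z; rewrite /GRing.comm !hf KQ.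
have fp : horner_morph cf (map_poly (real_complex R) p) = horner_alg K p.
  rewrite /horner_morph -map_poly_comp /horner_alg /horner_morph.
  congr (_.[_]); apply: eq_map_poly => x /=; rewrite hf cplx_real //.
have fprod : horner_morph cf (\prod_(z <- s) ('X - z%:P)) = \prod_(z <- s) (K - cplx Q z).
  by rewrite rmorph_prod; apply: eq_bigr => z _; rewrite rmorphB /= horner_morphX horner_morphC /= hf.
have [|C [r [C0 r0 r1 hr]]] := main s 1.
  rewrite mulr1 -fprod; set lc := lead_coef (map_poly (real_complex R) p) in hs'.
  have lc0 : lc != 0 by rewrite lead_coef_eq0 map_poly_eq0.
  have -> : \prod_(z <- s) ('X - z%:P) = (lc^-1)%:P * map_poly (real_complex R) p.
    by rewrite hs' mul_polyC scalerA mulVf // scale1r.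
  by rewrite rmorphM /= fp; apply: filtMr.
exists (L2 * C), r; split=> // [|n]; first exact: mulr_ge0.
have := hL2 (K ^+ n); rewrite -mulrA => h; apply: le_trans h _.
by apply: ler_wpM2l => //; rewrite -[K ^+ n]mulr1.
Qed.

End SpectralRadius.

Section PolarMean.
Variables (R : realType) (A : convAlgType R).
Implicit Types (Q K H : A).
Local Open Scope complex_scope.
Notation normc := Normc.normc.

(* With [H = Q S] and the Cayley transform [r = (S - 1) / (S + 1)], the integrand
   [H / (cos^2 t - sin^2 t H^2)] is Q times the Poisson kernel
   [(1 - r^2) / (1 - 2 r cos (2 t) + r^2) = 1 + 2 sum_k cos (2 k t) r^k]. *)

Lemma polar_unit H Q : polar H Q -> H \is a GRing.unit.
Proof. by case=> _ _ /(_ 0 0 (lexx _)); rewrite !scale0r !addr0. Qed.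

Lemma Q_unit Q : Q * Q = -1 -> Q \is a GRing.unit /\ Q^-1 = - Q.
Proof.
move=> QQ; have uQ : Q \is a GRing.unit.
  by apply/unitrP; exists (- Q); rewrite mulNr mulrN QQ opprK.
by split=> //; apply: (mulrI uQ); rewrite divrr // mulrN QQ opprK.
Qed.

(** With Q as the imaginary unit, S = -Q H has its spectrum in the open right half plane, and the
    Cayley transform carries it into the open unit disc. *)
Lemma cayley H Q : polar H Q -> exists r : A,
  [/\ Q * r = r * Q, r * H = H * r,
      forall z, 1 <= normc z -> r - cplx Q z \is a GRing.unit,
      1 - r \is a GRing.unit &
      H * (1 - r) = Q * (1 + r)].
Proof.
move=> hp; have [QQ QH hu] := hp; have [uQ Qi] := Q_unit QQ.
pose S := - (Q * H).
have QS : Q * S = S * Q by rewrite /S mulrN mulNr -mulrA QH mulrA.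
have uS z : complex.Re z <= 0 -> S - cplx Q z \is a GRing.unit.
  case: z => a b /= a0; have -> : S - cplx Q (a +i* b) = - Q * (H + b%:A + (- a) *: Q).
    rewrite !mulrDr -!scalerAr mulr1 !mulNr QQ opprK scalerN scaleNr /S /cplx /=.
    by rewrite opprD [- a%:A - _]addrC addrA.
  by rewrite unitrMl ?unitrN //; apply: hu; rewrite oppr_ge0.
have u1 : 1 + S \is a GRing.unit.
  by have := uS (-1) _; rewrite cplxN cplx1 opprK addrC; apply; rewrite /= lerN10.
have SH : S * H = H * S by rewrite /S mulNr mulrN mulrA -QH.
pose r := (S - 1) / (1 + S).
have r1 : 1 - r = 2 *: (1 + S)^-1.
  rewrite /r -{1}(divrr u1) -mulrBl.
  have -> : 1 + S - (S - 1) = 2 *: 1 by rewrite scalerDl scale1r; nc_ring.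
  by rewrite -scalerAl mul1r.
have r2 : 1 + r = 2 *: (S / (1 + S)).
  rewrite /r -{1}(divrr u1) -mulrDl.
  have -> : 1 + S + (S - 1) = 2 *: S by rewrite scalerDl scale1r; nc_ring.
  by rewrite -scalerAl.
have comm_r x : x * S = S * x -> x * r = r * x.
  move=> xS; apply: commrM; first by apply: commrD; [|exact: commrN1].
  by apply: commrV; apply: commrD; [exact: commr1|].
exists r; split.
- exact: comm_r.
- by rewrite comm_r.
- move=> z z1; have [->|z0] := eqVneq z 1.
    rewrite cplx1 -opprB unitrN r1 scaler_unit ?unitrV //.
    by rewrite unitfE pnatr_eq0.
  have z2 : 1 - z != 0 by rewrite subr_eq0 eq_sym.
  (* m is the preimage of z under S -> (S - 1) / (S + 1), and |z| >= 1 forces Re m <= 0. The point z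
     = 1, whose preimage is infinite, was treated apart. *)
  pose m := (1 + z) / (1 - z).
  have -> : r - cplx Q z = cplx Q (1 - z) * (S - cplx Q m) / (1 + S).
    rewrite mulrBr -cplxM // /m [(1 - z) * _]mulrC divfK // /r -{1}(mulrK u1 (cplx Q z)) -mulrBl.
    by congr (_ / _); rewrite !cplxD cplxN cplx1; set y := cplx Q z; nc_ring.
  rewrite unitrMl ?unitrV // unitrMr; last exact: cplx_unit.
  apply: uS; rewrite {}/m; case: z z1 {z0} z2 => a b z1 z2; simpc => /=.
  have n0 : 0 < (1 - a) ^+ 2 + b ^+ 2.
    rewrite lt_def addr_ge0 ?sqr_ge0 // andbT; apply: contraNneq z2 => /eqP.
    rewrite paddr_eq0 ?sqr_ge0 // !sqrf_eq0 => /andP[/eqP e1 /eqP e2].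
    by rewrite eq_complex /= e1 e2 subrr !eqxx.
  have n1 : 1 <= a ^+ 2 + b ^+ 2.
    have : 1 ^+ 2 <= (Num.sqrt (a ^+ 2 + b ^+ 2)) ^+ 2 by rewrite lerXn2r // ?nnegrE ?sqrtr_ge0.
    by rewrite expr1n sqr_sqrtr // addr_ge0 ?sqr_ge0.
  rewrite sqrrN; set n := (1 - a) ^+ 2 + b ^+ 2 in n0 *.
  have -> : (1 + a) * ((1 - a) / n) - b * (b / n) = (1 - a ^+ 2 - b ^+ 2) / n by ring.
  by rewrite pmulr_lle0 ?invr_gt0 //; lra.
- by rewrite r1 scaler_unit ?unitrV // unitfE pnatr_eq0.
rewrite r1 r2 -!scalerAr; congr (_ *: _); rewrite mulrA; congr (_ * _).
by rewrite /S mulrN mulrA QQ mulN1r opprK.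
Qed.

Definition pol_denom H (t : R) : A := (cos t ^+ 2)%:A - sin t ^+ 2 *: H ^+ 2.

Lemma pol_denomE H t (u := (cos t)%:A + sin t *: H) (v := (cos t)%:A - sin t *: H) :
  pol_denom H t = u * v /\ GRing.comm u v.
Proof.
rewrite {}/u {}/v; set u := sin t *: H; set c : A := (cos t)%:A.
have cu : c * u = u * c by rewrite /c /u -!scalerAl -!scalerAr mul1r mulr1 !scalerA mulrC.
have cc : c * c = (cos t ^+ 2)%:A by rewrite /c -scalerAl mul1r scalerA.
have uu : u * u = sin t ^+ 2 *: H ^+ 2 by rewrite /u -scalerAl -scalerAr scalerA.
rewrite /pol_denom /GRing.comm -cc -uu; split.
  have -> : (c + u) * (c - u) = c * c - u * u + (u * c - c * u) by nc_ring.
  by rewrite cu subrr addr0.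
have -> : (c + u) * (c - u) = (c - u) * (c + u) + (u * c - c * u) + (u * c - c * u) by nc_ring.
by rewrite cu subrr !addr0.
Qed.

Section Cayley.
Variables (H Q r : A).
Hypothesis hQ : polar H Q.
Hypothesis Qr : Q * r = r * Q.
Hypothesis r1 : 1 - r \is a GRing.unit.
Hypothesis Hr : H * (1 - r) = Q * (1 + r).
Hypothesis rH : r * H = H * r.

Definition poisson_denom (t : R) : A := 1 + r * r - (2 * cos (2 * t)) *: r.

Lemma pol_denom_unit t : pol_denom H t \is a GRing.unit.
Proof.
have hp := polar_pol_dom hQ; have [-> _] := pol_denomE H t.
by rewrite unitrMl ?hp //; have := hp (- t); rewrite cosN sinN scaleNr.
Qed.

(** Substituting H (1 - r) = Q (1 + r) turns the left side into cos^2 t (1 - r)^2 + sin^2 t (1 +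
    r)^2. *)
Lemma poisson_denomE t : (1 - r) * (1 - r) * pol_denom H t = poisson_denom t.
Proof.
have [QQ QH _] := hQ.
have HH : (1 - r) * (1 - r) * (H * H) = - ((1 + r) * (1 + r)).
  have c1 : H * (1 - r) = (1 - r) * H by rewrite mulrBr mulrBl mulr1 mul1r rH.
  have c2 : Q * (1 + r) = (1 + r) * Q by rewrite mulrDr mulrDl mulr1 mul1r Qr.
  have -> : (1 - r) * (1 - r) * (H * H) = H * (1 - r) * (H * (1 - r)).
    by move: (1 - r) c1 => a c1; apply/esym; rewrite c1 -[LHS]mulrA [H * (a * H)]mulrA c1 !mulrA.
  by rewrite Hr {1}c2 -[LHS]mulrA [Q * (Q * _)]mulrA QQ mulN1r mulrN.
rewrite /pol_denom mulrBr -scalerAr mulr1 -scalerAr expr2 HH scalerN opprK.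
have -> : (1 - r) * (1 - r) = 1 + r * r - 2 *: r by rewrite scaler_nat mulr2n; nc_ring.
have -> : (1 + r) * (1 + r) = 1 + r * r + 2 *: r by rewrite scaler_nat mulr2n; nc_ring.
rewrite /poisson_denom; set p := 1 + r * r.
rewrite scalerBr [sin t ^+ 2 *: _]scalerDr addrACA -scalerDl cos2Dsin2 scale1r; congr (_ + _).
have e : - (cos t ^+ 2 * 2) + sin t ^+ 2 * 2 = - (2 * cos (2 * t)).
  by rewrite [2 * t]mulr_natl cos_mulr2n sin2cos2; ring.
by rewrite !scalerA -(scaleNr _ r) -[X in _ = X](scaleNr _ r) -scalerDl e.
Qed.

End Cayley.

End PolarMean.

Section PoissonExpansion.
Variables (R : realType) (A : convAlgType R).
Implicit Types (H Q r : A).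
Local Open Scope complex_scope.
Notation normc := Normc.normc.

(** The cosines enter through their three-term recurrence alone, under which the product with the
    Poisson denominator telescopes. *)
Lemma chebyshev_telescope r (c : nat -> R) N : c 0%N = 1 ->
  (forall k, 2 * c 1%N * c k.+1 = c k.+2 + c k) ->
  (1 + r * r - (2 * c 1%N) *: r) * (1 + \sum_(k < N) (2 * c k.+1) *: r ^+ k.+1) =
  1 - r * r - ((2 * c N.+1) *: r ^+ N.+1 - (2 * c N) *: r ^+ N.+2).
Proof.
move=> c0 cS; elim: N => [|N IH].
  have h2 : 2 *: (r * r) = r * r + r * r by rewrite scaler_nat mulr2n.
  rewrite big_ord0 addr0 mulr1 c0 mulr1 expr1 expr2 h2.
  by set u := _ *: r; nc_ring.
rewrite big_ord_recr /= addrA mulrDr IH.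
have -> : (1 + r * r - (2 * c 1%N) *: r) * ((2 * c N.+1) *: r ^+ N.+1) =
    (2 * c N.+1) *: r ^+ N.+1 + (2 * c N.+1) *: r ^+ N.+3
    - ((2 * c N.+2) *: r ^+ N.+2 + (2 * c N) *: r ^+ N.+2).
  rewrite -scalerDl -mulrDr -cS [r ^+ N.+3]exprS [r ^+ N.+2]exprS; set p := r ^+ N.+1.
  rewrite mulrBl mulrDl mul1r -!scalerAr -!scalerAl scalerA mulrA; congr (_ - _ *: _).
  exact: mulrC.
set u1 := _ *: r ^+ N.+1; set u3 := (2 * c N.+1) *: r ^+ N.+3.
set u2 := (2 * c N.+2) *: _; set v2 := (2 * c N) *: _.
by nc_ring.
Qed.

Definition poisson_rest r N t : A :=
  (2 * cos (2 * N.+1%:R * t)) *: r ^+ N.+1 - (2 * cos (2 * N%:R * t)) *: r ^+ N.+2.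

Lemma poisson_expansion r N t :
  poisson_denom r t * (1 + \sum_(k < N) (2 * cos (2 * k.+1%:R * t)) *: r ^+ k.+1) =
  1 - r * r - poisson_rest r N t.
Proof.
have := @chebyshev_telescope r (fun k => cos (2 * k%:R * t)) N.
rewrite !(mulr0, mulr1, mul0r) => -> //; first exact: cos0.
move=> k; have -> : 2 * k.+2%:R * t = 2 * k.+1%:R * t + 2 * t by rewrite -[k.+2%:R]natr1; ring.
have -> : 2 * k%:R * t = 2 * k.+1%:R * t - 2 * t by rewrite -[k.+1%:R]natr1; ring.
by rewrite cosB cosD; ring.
Qed.

Lemma poisson_rest_le i nu r N t : snorm i nu ->
  nu (poisson_rest r N t) <= 2 * nu (r ^+ N.+1) + 2 * nu (r ^+ N.+2).
Proof.
move=> [hs _ _ _]; apply: le_trans (seminormB hs _ _) _; rewrite !(proj2 hs).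
have h (x : R) : `|2 * cos x| <= 2.
  by rewrite normrM ger0_norm // ler_piMr // ler_norml cos_geN1 cos_le1.
by apply: lerD; apply: ler_wpM2r => //; apply: seminorm_ge0.
Qed.

Section Mean.
Variables (H Q r : A).
Hypothesis hQ : polar H Q.
Hypothesis Qr : Q * r = r * Q.
Hypothesis r1 : 1 - r \is a GRing.unit.
Hypothesis Hr : H * (1 - r) = Q * (1 + r).
Hypothesis rH : r * H = H * r.
Hypothesis hr : forall z, 1 <= normc z -> r - cplx Q z \is a GRing.unit.

Lemma poisson_denom_unit t : poisson_denom r t \is a GRing.unit.
Proof. by rewrite -(poisson_denomE hQ Qr Hr rH) unitrMl ?unitrMl // (pol_denom_unit hQ). Qed.

Lemma small_pow i nu : snorm i nu -> small_seq (fun N => nu (r ^+ N)).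
Proof.
move=> hnu; have [QQ _ _] := hQ.
have [C [s [C0 s0 s1 hs]]] := spectral_radius QQ Qr hr hnu.
by apply: small_seq_le hs _; apply: small_seq_geo.
Qed.

Lemma small_poisson_rest i nu : snorm i nu ->
  small_seq (fun N => 2 * nu (r ^+ N.+1) + 2 * nu (r ^+ N.+2)).
Proof.
move=> hnu; apply: small_seqD; apply: small_seqZ => //.
  by apply: small_seq_le (small_seq_shift 1 (small_pow hnu)) => N; rewrite addn1.
by apply: small_seq_le (small_seq_shift 2 (small_pow hnu)) => N; rewrite addn2.
Qed.

Lemma unit_1subrr : 1 - r * r \is a GRing.unit.
Proof.
have [QQ _ _] := hQ; have [uQ _] := Q_unit QQ.
have -> : 1 - r * r = (1 - r) * (1 + r) by nc_ring.
by rewrite unitrMl // -(unitrMr _ uQ) -Hr unitrMr ?polar_unit // (polar_unit hQ).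
Qed.

Lemma poisson_inv N t : (poisson_denom r t)^-1 * (1 - r * r) =
  1 + \sum_(k < N) (2 * cos (2 * k.+1%:R * t)) *: r ^+ k.+1 +
  (poisson_denom r t)^-1 * poisson_rest r N t.
Proof.
have <- := subrK (poisson_rest r N t) (1 - r * r); rewrite -poisson_expansion mulrDr.
by rewrite mulKr // poisson_denom_unit.
Qed.

(** A bound uniform in t without compactness. If D inverts the denominator and e inverts 1 - r^2,
    then D = P e + D T e, with P a partial sum and T the remainder. For one large N, nu T * nu e <=
    1/2 for all t, and the last term is absorbed on the left. *)
Lemma poisson_denom_inv_bound i nu : snorm i nu ->
  exists2 B, 0 <= B & forall t, nu (poisson_denom r t)^-1 <= B.
Proof.
move=> hnu; have [hs hm _ _] := hnu; have n0 x : 0 <= nu x by apply: seminorm_ge0.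
set e := (1 - r * r)^-1; have e1 : 0 < nu e + 1 by rewrite ltr_wpDl.
have [|N hN] := small_poisson_rest hnu (e := (2 * (nu e + 1))^-1).
  by rewrite invr_gt0 mulr_gt0.
pose B := nu 1 + \sum_(k < N) 2 * nu (r ^+ k.+1).
have B0 : 0 <= B by rewrite addr_ge0 // sumr_ge0 // => k _; rewrite mulr_ge0.
exists (2 * (B * nu e)) => [|t]; first by rewrite !mulr_ge0.
set D := (poisson_denom r t)^-1; set T := poisson_rest r N t.
have hT : nu T * nu e <= 2^-1.
  apply: (@le_trans _ _ ((2 * (nu e + 1))^-1 * (nu e + 1))).
    apply: ler_pM => //; last by rewrite lerDl.
    by apply: le_trans (poisson_rest_le r N t hnu) (hN N (leqnn _)).
  by rewrite invfM mulfVK ?gt_eqF.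
have hP : nu (1 + \sum_(k < N) (2 * cos (2 * k.+1%:R * t)) *: r ^+ k.+1) <= B.
  apply: le_trans (proj1 hs _ _) _; rewrite lerD2l.
  apply: le_trans (seminorm_sum hs _ _ _) _; apply: ler_sum => k _.
  rewrite (proj2 hs); apply: ler_wpM2r => //.
  by rewrite normrM ger0_norm // ler_piMr // ler_norml cos_geN1 cos_le1.
have h : nu D <= B * nu e + nu D * (nu T * nu e).
  have {1}-> : D = (1 + \sum_(k < N) (2 * cos (2 * k.+1%:R * t)) *: r ^+ k.+1) * e + D * (T * e).
    by rewrite mulrA -mulrDl -poisson_inv mulrK // unit_1subrr.
  apply: le_trans (proj1 hs _ _) _; apply: lerD.
    by apply: le_trans (hm _ _) _; apply: ler_wpM2r.
  by apply: le_trans (hm _ _) _; apply: ler_wpM2l.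
have := ler_wpM2l (n0 D) hT; lra.
Qed.

Lemma pol_integrandE N t : H / pol_denom H t =
  Q * (1 + \sum_(k < N) (2 * cos (2 * k.+1%:R * t)) *: r ^+ k.+1) +
  Q * ((poisson_denom r t)^-1 * poisson_rest r N t).
Proof.
rewrite -mulrDr -poisson_inv.
have uD := poisson_denom_unit t; have uV := pol_denom_unit hQ t.
set D := poisson_denom r t in uD *.
have cD x : x * r = r * x -> x * D^-1 = D^-1 * x.
  move=> xr; apply: commrV; rewrite /GRing.comm /D /poisson_denom mulrBr mulrBl mulrDr [(1 + _) * x]mulrDl.
  have -> : x * (r * r) = r * r * x by rewrite mulrA xr -mulrA xr mulrA.
  by rewrite -scalerAr -scalerAl xr mulr1 mul1r.
have -> : (pol_denom H t)^-1 = D^-1 * ((1 - r) * (1 - r)).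
  rewrite /D -(poisson_denomE hQ Qr Hr rH) invrM ?unitrMl // -mulrA mulVr ?mulr1 //.
  by rewrite unitrMl.
rewrite mulrA cD ?rH // -mulrA [H * _]mulrA Hr [Q * (D^-1 * _)]mulrA (cD _ Qr) -[RHS]mulrA.
by congr (_ * _); nc_ring.
Qed.

Lemma polar_mean : is_mean (fun t => H / pol_denom H t) Q.
Proof.
move=> i d c hc j; have [nu hnu] := @snorm_exists R A i.
have [hs hm _ _] := hnu; have n0 x : 0 <= nu x by apply: seminorm_ge0.
have [|K K0 hK] := snorm_coord_le hnu (c := c); first by move=> x /(proj1 hc).
have [B B0 hB] := poisson_denom_inv_bound hnu.
apply: (uniform_trig_mean (a := fun k => c (Q * r ^+ k.+1) 0 j)) => e e0.
have M0 : 0 <= K * (nu Q * B) by rewrite !mulr_ge0 // ltW.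
have [N hN] := small_seqZ M0 (small_poisson_rest hnu) e0; exists N => t.
have -> : c (H / pol_denom H t) 0 j - (c Q 0 j + \sum_(k < N) 2 * cos (2 * k.+1%:R * t) *
     c (Q * r ^+ k.+1) 0 j) = c (Q * ((poisson_denom r t)^-1 * poisson_rest r N t)) 0 j.
  have cD x y : c (x + y) 0 j = c x 0 j + c y 0 j by rewrite linearD mxE.
  rewrite (pol_integrandE N t) mulrDr mulr1 !cD.
  have -> : c (Q * \sum_(k < N) (2 * cos (2 * k.+1%:R * t)) *: r ^+ k.+1) 0 j =
      \sum_(k < N) 2 * cos (2 * k.+1%:R * t) * c (Q * r ^+ k.+1) 0 j.
    rewrite mulr_sumr linear_sum summxE; apply: eq_bigr => k _.
    by rewrite -scalerAr linearZ mxE.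
  by ring.
apply: le_trans (hK _ _) _; apply: le_trans (hN N (leqnn _)).
rewrite -!mulrA; apply: ler_wpM2l; first exact: ltW.
apply: le_trans (hm _ _) _; apply: ler_wpM2l => //.
apply: le_trans (hm _ _) _; apply: ler_pM => //.
exact: poisson_rest_le hnu.
Qed.

End Mean.

Lemma polar_is_mean H Q : polar H Q -> is_mean (fun t => H / pol_denom H t) Q.
Proof. by move=> h; have [r [Qr rH hr r1 Hr]] := cayley h; apply: (polar_mean h Qr r1). Qed.

Lemma pol_denom_inv_bound H Q i nu : polar H Q -> snorm i nu ->
  exists2 B, 0 <= B & forall t, nu (pol_denom H t)^-1 <= B.
Proof.
move=> h hnu; have [r [Qr rH hr r1 Hr]] := cayley h.
have [B B0 hB] := poisson_denom_inv_bound h Qr r1 Hr rH hr hnu.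
have [hs hm _ _] := hnu; have n0 x : 0 <= nu x by apply: seminorm_ge0.
exists (B * nu ((1 - r) * (1 - r))) => [|t]; first by rewrite mulr_ge0.
have -> : (pol_denom H t)^-1 = (poisson_denom r t)^-1 * ((1 - r) * (1 - r)).
  rewrite -(poisson_denomE h Qr Hr rH) invrM ?unitrMl ?(pol_denom_unit h) //.
  by rewrite -mulrA mulVr ?mulr1 // unitrMl.
by apply: le_trans (hm _ _) _; apply: ler_wpM2r.
Qed.

Lemma is_mean_uniq (f : R -> A) P P' : is_mean f P -> is_mean f P' -> P = P'.
Proof.
move=> h h'; apply/eqP; rewrite -subr_eq0; apply/eqP/filt_eq0 => i.
have [d [c hc]] := @filt_fin_dim R A i; apply/(proj1 hc)/rowP => j.
have [_ e] := h i d c hc j; have [_ e'] := h' i d c hc j.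
by rewrite linearB !mxE e e' subrr.
Qed.

Lemma pol_polar H Q : polar H Q -> pol H = Q.
Proof.
move=> /polar_is_mean h; apply: (is_mean_uniq _ h).
by apply: (xgetPex 0 (P := [set P | is_mean (fun t => H / pol_denom H t) P])); exists Q.
Qed.

Lemma pol_dom_polar H : pol_dom H -> polar H (pol H).
Proof. by move=> /polar_exists[Q hQ]; rewrite (pol_polar hQ). Qed.

Lemma polar_uniq H Q Q' : polar H Q -> polar H Q' -> Q = Q'.
Proof. by move=> /pol_polar <- /pol_polar. Qed.

End PoissonExpansion.

(** * Continuity *)

Section Perturbation.
Variables (R : realType) (A : convAlgType R).
Implicit Types (H Q u v x y : A).

(** The Neumann series is summed modulo A^(1) only, which suffices by [unit_mod_filt1]. *)
Lemma unit_1sub_small nu y : snorm 1 nu -> nu y <= 4^-1 -> 1 - y \is a GRing.unit.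
Proof.
move=> hnu hy; have [hs hm _ _] := hnu; have n0 x : 0 <= nu x by apply: seminorm_ge0.
have hX k : nu (y ^+ k) <= nu 1 * (4^-1) ^+ k.
  elim: k => [|k IH]; first by rewrite !expr0 mulr1.
  rewrite exprSr; apply: le_trans (hm _ _) _; rewrite exprSr mulrA.
  by apply: ler_pM.
have [|l hl] := level_complete (u := fun k => y ^+ k) hnu; first by exists (nu 1).
have sX : small_seq (fun N => nu (y ^+ N)).
  by apply: small_seq_le hX _; apply: small_seq_geo; rewrite ?invr_ge0 // invf_lt1 // ltr1n.
have hS N : (1 - y) * \sum_(k < N) y ^+ k = 1 - y ^+ N.
  by rewrite -[1 - y ^+ N]opprB subrX1 -mulNr opprB.
have hS' N : (\sum_(k < N) y ^+ k) * (1 - y) = 1 - y ^+ N.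
  rewrite -hS; apply/esym/commr_sum => k _.
  by apply/commrX/commr_sym/commrD; [apply: commr1|apply/commrN].
have sl : small_seq (fun N => nu (1 - y) * nu (\sum_(k < N) y ^+ k - l) + nu (y ^+ N)).
  by apply: small_seqD => //; apply: small_seqZ.
apply: (unit_mod_filt1 (y := l)); apply: (snorm_eq0 hnu); apply: (snorm_null hnu);
  apply: small_seq_le sl => N.
  have -> : (1 - y) * l - 1 = - ((1 - y) * (\sum_(k < N) y ^+ k - l)) - y ^+ N.
    by rewrite mulrBr hS; nc_ring.
  by apply: le_trans (seminormB hs _ _) _; rewrite (seminormN hs) lerD2r hm.
have -> : l * (1 - y) - 1 = - ((\sum_(k < N) y ^+ k - l) * (1 - y)) - y ^+ N.
  by rewrite mulrBl hS'; nc_ring.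
by apply: le_trans (seminormB hs _ _) _; rewrite (seminormN hs) lerD2r mulrC hm.
Qed.

(** The identity v^-1 - u^-1 = - v^-1 (v - u) u^-1 bounds nu v^-1 in terms of itself; the threshold
    1/4 lets this term be absorbed. *)
Lemma inv_perturb nu u v B : snorm 1 nu -> 0 <= B -> u \is a GRing.unit -> nu u^-1 <= B ->
  B * nu (v - u) <= 4^-1 ->
  [/\ v \is a GRing.unit, nu v^-1 <= 2 * B & nu (v^-1 - u^-1) <= 2 * B * B * nu (v - u)].
Proof.
move=> hnu B0 uu hB hv; have [hs hm _ _] := hnu; have n0 x : 0 <= nu x by apply: seminorm_ge0.
have uv : v \is a GRing.unit.
  have -> : v = u * (1 - - (u^-1 * (v - u))).
    by rewrite opprK mulrDr mulr1 mulrA divrr // mul1r subrKC.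
  rewrite unitrMl //; apply: (unit_1sub_small hnu); rewrite (seminormN hs).
  by apply: le_trans (hm _ _) _; apply: le_trans hv; apply: ler_wpM2r.
have e : v^-1 - u^-1 = - (v^-1 * (v - u) * u^-1).
  by rewrite mulrBr mulVr // mulrBl mul1r -mulrA divrr // mulr1 opprB.
have h1 : nu (v^-1 - u^-1) <= nu v^-1 * (nu (v - u) * B).
  rewrite e (seminormN hs) -mulrA; apply: le_trans (hm _ _) _; apply: ler_wpM2l => //.
  by apply: le_trans (hm _ _) _; apply: ler_wpM2l.
have h2 : nu v^-1 <= 2 * B.
  have : nu v^-1 <= B + nu v^-1 * (nu (v - u) * B).
    have {1}-> : v^-1 = u^-1 + (v^-1 - u^-1) by rewrite subrKC.
    by apply: le_trans (proj1 hs _ _) _; apply: lerD.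
  have := ler_wpM2l (n0 v^-1) hv; rewrite [nu (v - u) * B]mulrC.
  have := n0 v^-1; lra.
split=> //; apply: le_trans h1 _.
have -> : 2 * B * B * nu (v - u) = 2 * B * (nu (v - u) * B) by ring.
by apply: ler_wpM2r => //; rewrite mulr_ge0.
Qed.

Lemma mean_le i nu : snorm i nu -> exists2 C, 0 <= C & forall (f f' : R -> A) P P' b,
  is_mean f P -> is_mean f' P' -> (forall t, nu (f t - f' t) <= b) -> nu (P - P') <= C * b.
Proof.
move=> hnu; have [hs _ hv _] := hnu; have [d [c hc]] := @filt_fin_dim R A i.
have [L L0 hL] := seminorm_le_coord hc hs hv.
have [|K K0 hK] := snorm_coord_le hnu (c := c); first by move=> x /(proj1 hc).
exists (L * (d%:R * K)); first by rewrite !mulr_ge0 // ltW.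
move=> f f' P P' b hP hP' hb; apply: le_trans (hL _) _.
rewrite -!mulrA; apply: ler_wpM2l => //.
apply: (@le_trans _ _ (\sum_(j < d) (K * b))); last by rewrite sumr_const card_ord mulr_natl.
apply: ler_sum => j _; have [i1 e1] := hP i d c hc j; have [i2 e2] := hP' i d c hc j.
rewrite linearB !mxE e1 e2 -mulrBr -RintegralB //.
have pi2 : 0 < 2 * pi :> R by rewrite mulr_gt0 // pi_gt0.
rewrite normrM ger0_norm ?invr_ge0 ?(ltW pi2) // ler_pdivrMl //.
have mD : measurable (`[0, 2 * pi] : set (measurableTypeR R)) by [].
have i3 : (@lebesgue_measure R).-integrable `[0, 2 * pi]
    (EFin \o (fun t => c (f t) 0 j - c (f' t) 0 j)).
  by apply: eq_integrable (integrableB mD i1 i2).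
apply: le_trans (le_normr_Rintegral _ i3) _ => //.
have i4 : (@lebesgue_measure R).-integrable `[0, 2 * pi] (EFin \o (fun=> K * b)).
  apply: continuous_compact_integrable; first exact: segment_compact.
  by apply: continuous_subspaceT => x; apply: cvg_cst.
apply: (@le_trans _ _ (\int[@lebesgue_measure R]_(t in `[0, 2 * pi]) (K * b))).
  apply: le_Rintegral => //.
    have := integrable_abse i3; congr (_.-integrable _ _); by apply/funext.
  move=> t _; have := hK (f t - f' t) j; rewrite linearB !mxE => h.
  by apply: le_trans h _; rewrite ler_pM2l.
rewrite Rintegral_cst //= lebesgue_measure_itv /= lte_fin pi2 -EFinB /= subr0.
by rewrite mulrC.
Qed.

(** By the integral formula it is enough to control the integrand uniformly in t. *)
Lemma pol_continuous nu H e : snorm 1 nu -> pol_dom H -> 0 < e ->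
  exists2 d, 0 < d & forall H', nu (H' - H) <= d -> pol_dom H' /\ nu (pol H' - pol H) <= e.
Proof.
move=> hnu hH e0; have [hs hm _ _] := hnu; have n0 x : 0 <= nu x by apply: seminorm_ge0.
have hQ := pol_dom_polar hH; have [B B0 hB] := pol_denom_inv_bound hQ hnu.
have [C C0 hC] := mean_le hnu.
pose a := 2 * nu H + 1; have a0 : 0 <= a by rewrite addr_ge0 // mulr_ge0.
pose M := 2 * B + nu H * (2 * B * B * a); have M0 : 0 <= M by rewrite addr_ge0 ?mulr_ge0.
have p1 : 0 < 4 * (B * a + 1) by rewrite mulr_gt0 // ltr_wpDl // mulr_ge0.
have p2 : 0 < C * M + 1 by rewrite ltr_wpDl // mulr_ge0.
(* In this order: nu H' stays bounded, all denominators stay invertible, and the final error is at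
   most e. *)
pose d := Num.min 1 (Num.min (4 * (B * a + 1))^-1 (e / (C * M + 1))).
have d0 : 0 < d by rewrite !lt_min ltr01 invr_gt0 p1 divr_gt0.
exists d => // H' hd.
have [d1 d2 d3] : [/\ d <= 1, d <= (4 * (B * a + 1))^-1 & d <= e / (C * M + 1)].
  by rewrite /d; split; rewrite !ge_min lexx ?orbT.
set w := nu (H' - H) in hd; have w0 : 0 <= w by apply: n0.
have hH' : nu H' <= nu H + 1.
  have -> : H' = H + (H' - H) by rewrite subrKC.
  by apply: le_trans (proj1 hs _ _) _; rewrite lerD2l (le_trans hd).
have hden t : nu (pol_denom H' t - pol_denom H t) <= w * a.
  have -> : pol_denom H' t - pol_denom H t = - (sin t ^+ 2 *: (H' * H' - H * H)).
    by rewrite /pol_denom scalerBr !expr2; set u := _ *: 1; set v := _ *: _; set z := _ *: (H * H); nc_ring.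
  rewrite (seminormN hs) (proj2 hs).
  have s1 : `|sin t ^+ 2| <= 1.
    by rewrite ger0_norm ?sqr_ge0 // -(cos2Dsin2 t) lerDr sqr_ge0.
  apply: le_trans (ler_wpM2r (n0 _) s1) _; rewrite mul1r.
  have -> : H' * H' - H * H = (H' - H) * H' + H * (H' - H) by nc_ring.
  apply: le_trans (proj1 hs _ _) _.
  have -> : w * a = w * (nu H + 1) + nu H * w by rewrite /a; ring.
  apply: lerD; last exact: hm.
  by apply: le_trans (hm _ _) _; apply: ler_wpM2l.
have inv t : [/\ pol_denom H' t \is a GRing.unit, nu (pol_denom H' t)^-1 <= 2 * B
    & nu ((pol_denom H' t)^-1 - (pol_denom H t)^-1) <= 2 * B * B * (w * a)].
  have h0 : B * nu (pol_denom H' t - pol_denom H t) <= 4^-1.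
    apply: (@le_trans _ _ (B * (w * a))); first exact: ler_wpM2l.
    apply: (@le_trans _ _ ((4 * (B * a + 1))^-1 * (B * a + 1))).
      rewrite mulrCA; apply: ler_pM => //; rewrite ?mulr_ge0 ?lerDl //.
      exact: le_trans hd d2.
    by rewrite invfM mulfVK // gt_eqF // ltr_wpDl // mulr_ge0.
  have [h1 h2 h3] := inv_perturb hnu B0 (pol_denom_unit hQ t) (hB t) h0.
  by split=> //; apply: le_trans h3 _; rewrite ler_wpM2l // !mulr_ge0.
(* The denominator is a product of two commuting factors, one of which is cos t + sin t H'. *)
have pH' : pol_dom H'.
  move=> t; have [h _ _] := inv t; have [e1 e2] := pol_denomE H' t.
  by move: h; rewrite e1 unitrM_comm // => /andP[].
split=> //.
have bnd t : nu (H' / pol_denom H' t - H / pol_denom H t) <= w * M.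
  have [_ h2 h3] := inv t.
  have -> : H' / pol_denom H' t - H / pol_denom H t =
    (H' - H) / pol_denom H' t + H * ((pol_denom H' t)^-1 - (pol_denom H t)^-1) by nc_ring.
  apply: le_trans (proj1 hs _ _) _.
  have -> : w * M = w * (2 * B) + nu H * (2 * B * B * (w * a)) by rewrite /M; ring.
  apply: lerD; apply: le_trans (hm _ _) _; first exact: ler_wpM2l.
  exact: ler_wpM2l.
have := hC _ _ _ _ _ (polar_is_mean (pol_dom_polar pH')) (polar_is_mean hQ) bnd.
move=> h; apply: le_trans h _; rewrite mulrCA.
apply: (@le_trans _ _ (e / (C * M + 1) * (C * M + 1))).
  apply: ler_pM => //; rewrite ?mulr_ge0 ?lerDl //.
  exact: le_trans hd d3.
by rewrite divfK // gt_eqF.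
Qed.

(** The hypothesis makes U stable under A^(1), where nu vanishes, so U is the full preimage of its
    image in the quotient. *)
Lemma zero_open_local nu n (U : set ('I_n -> A)) : snorm 1 nu ->
  (forall a, U a -> exists2 d, 0 < d & forall a', (forall k, nu (a' k - a k) <= d) -> U a') ->
  zero_open U.
Proof.
move=> hnu hU d c hc; have [hs _ hv _] := hnu.
have [K K0 hK] := seminorm_le_coord hc hs hv.
pose mat (a : 'I_n -> A) : 'M[R]_(n, d) := \matrix_(k, j) c (a k) 0 j.
have near (a a' : 'I_n -> A) (r : R) : 0 < r ->
   (forall k j, `|c (a' k) 0 j - c (a k) 0 j| <= r / (K * d%:R + 1)) ->
   forall k, nu (a' k - a k) <= r.
  move=> r0 h k; apply: le_trans (hK _) _.
  have p : 0 < K * d%:R + 1 by rewrite ltr_wpDl // mulr_ge0.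
  apply: (@le_trans _ _ (K * (\sum_(j < d) r / (K * d%:R + 1)))).
    apply: ler_wpM2l => //; apply: ler_sum => j _; rewrite linearB !mxE; exact: h.
  rewrite sumr_const card_ord -[X in K * X]mulr_natl.
  have -> : K * (d%:R * (r / (K * d%:R + 1))) = r * (K * d%:R) / (K * d%:R + 1) by ring.
  by rewrite ler_pdivrMr //; apply: ler_wpM2l; [exact: ltW|rewrite lerDl].
exists [set M | exists2 a, U a & M = mat a].
  rewrite openE => M [a Ua ->]; have [r r0 hr] := hU a Ua.
  have p : 0 < K * d%:R + 1 by rewrite ltr_wpDl // mulr_ge0.
  apply/nbhs_ballP; exists (r / (K * d%:R + 1)) => /=; first by rewrite divr_gt0.
  move=> M' hM'; have [a' ha'] := fin_all_exists (fun k => proj2 hc (row k M')).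
  exists a'; last by apply/matrixP => k j; rewrite !mxE ha' mxE.
  apply: hr; apply: near => // k j.
  have [_ /(_ k j)] := hM'; rewrite !mxE /ball /= ha' !mxE distrC => /ltW //.
apply/seteqP; split=> a /=; first by exists a.
move=> [b Ub e]; have [r r0 hr] := hU b Ub; apply: hr; apply: near => // k j.
by move/matrixP: e => /(_ k j); rewrite !mxE => ->; rewrite subrr normr0 divr_ge0 // ltW // ltr_wpDl // mulr_ge0.
Qed.

End Perturbation.

(** * Compatibilities of the polarization *)

Section PolarProperties.
Variable R : realType.

(** A predicate rather than a bundled morphism, to be applied to conjugations and projections as
    well as to given morphisms. *)
Definition alg_hom (A B : convAlgType R) (f : A -> B) : Prop :=
  [/\ f 1 = 1, forall x y, f (x + y) = f x + f y, forall (a : R) x, f (a *: x) = a *: f x &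
      forall x y, f (x * y) = f x * f y].

Lemma alg_hom_unit (A B : convAlgType R) (f : A -> B) x : alg_hom f ->
  x \is a GRing.unit -> f x \is a GRing.unit.
Proof.
move=> [f1 _ _ fM] ux; apply/unitrP; exists (f x^-1).
by rewrite -!fM mulVr // divrr // f1.
Qed.

Lemma alg_homN (A B : convAlgType R) (f : A -> B) x : alg_hom f -> f (- x) = - f x.
Proof. by move=> [_ _ fZ _]; rewrite -scaleN1r fZ scaleN1r. Qed.

Lemma alg_homV (A B : convAlgType R) (f : A -> B) x : alg_hom f ->
  x \is a GRing.unit -> f x^-1 = (f x)^-1.
Proof.
move=> hf ux; have [f1 _ _ fM] := hf; apply: (mulrI (alg_hom_unit hf ux)).
by rewrite -fM !divrr ?(alg_hom_unit hf).
Qed.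

Lemma polar_hom (A B : convAlgType R) (f : A -> B) H Q : alg_hom f ->
  polar H Q -> polar (f H) (f Q).
Proof.
move=> hf [QQ QH hu]; have [f1 fD fZ fM] := hf; split.
- by rewrite -fM QQ (alg_homN _ hf) f1.
- by rewrite -!fM QH.
by move=> x y /hu - /(_ x) /(alg_hom_unit hf); rewrite !fD !fZ f1.
Qed.

Variable A : convAlgType R.
Implicit Types (H Q g x y : A).

Lemma conj_alg_hom g : g \is a GRing.unit -> alg_hom (fun x => g * x / g).
Proof.
move=> ug; split.
- by rewrite mulr1 divrr.
- by move=> x y; rewrite mulrDr mulrDl.
- by move=> a x; rewrite -scalerAr -scalerAl.
by move=> x y; rewrite !mulrA mulrVK.
Qed.

Lemma polar_opp H Q : polar H Q -> polar (- H) (- Q).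
Proof.
move=> [QQ QH hu]; split; rewrite ?mulrNN // => x y y0.
rewrite -unitrN !opprD !opprK scalerN opprK -scaleNr; exact: hu.
Qed.

Lemma polar_scale H Q (t : R) : 0 < t -> polar H Q -> polar (t *: H) Q.
Proof.
move=> t0 [QQ QH hu]; split=> //; first by rewrite -scalerAl -scalerAr QH.
move=> x y y0; have -> : t *: H + x%:A + y *: Q = t *: (H + (t^-1 * x)%:A + (t^-1 * y) *: Q).
  by rewrite !scalerDr !scalerA !mulVKf // gt_eqF.
by rewrite scaler_unit ?unitfE ?gt_eqF //; apply: hu; rewrite mulr_ge0 // invr_ge0 ltW.
Qed.

Lemma polar_addr H Q (s : R) : polar H Q -> polar (H + s%:A) Q.
Proof.
move=> [QQ QH hu]; split=> //.
  by rewrite mulrDl mulrDr QH -scalerAl -scalerAr mul1r mulr1.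
move=> x y y0; have -> : H + s%:A + x%:A = H + (s + x)%:A by rewrite scalerDl addrA.
exact: hu.
Qed.

Lemma polar_self Q : Q * Q = -1 -> polar Q Q.
Proof.
move=> QQ; split=> // x y y0; pose z := (x +i* (1 + y))%C.
have -> : Q + x%:A + y *: Q = cplx Q z.
  by rewrite /cplx /= scalerDl scale1r addrAC [_ + x%:A]addrC.
by apply: cplx_unit => //; rewrite eq_complex /= negb_and [1 + y == 0]gt_eqF ?orbT // ltr_wpDr.
Qed.

(** For t > 0 the summand (1 - t) Q merely increases the coefficient y >= 0 of Q. *)
Lemma polar_mix H Q (t : R) : 0 <= t <= 1 -> polar H Q -> polar (t *: H + (1 - t) *: Q) Q.
Proof.
move=> /andP[t0 t1] hp; have [QQ QH hu] := hp.
move: t0; rewrite le_eqVlt => /predU1P[<-|t0].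
  by rewrite scale0r add0r subr0 scale1r; apply: polar_self.
have [_ QtH htu] := polar_scale t0 hp; split=> //.
  by rewrite mulrDl mulrDr QtH; congr (_ + _); rewrite -scalerAl -scalerAr.
move=> x y y0; have -> : t *: H + (1 - t) *: Q + x%:A + y *: Q = t *: H + x%:A + (1 - t + y) *: Q.
  by rewrite [(1 - t + y) *: Q]scalerDl addrA [_ + x%:A]addrAC.
by apply: htu; rewrite addr_ge0 // subr_ge0.
Qed.

Definition anticomm x y : Prop := x * y = - (y * x).

(** Conjugation by g sends H to -H, hence Q to the polarization of -H, which is -Q by uniqueness. *)
Lemma polar_anticomm H Q g : polar H Q -> g * g = -1 -> anticomm g H -> anticomm g Q.
Proof.
move=> hp gg gH; have [ug gi] := Q_unit gg.
have := polar_hom (conj_alg_hom ug) hp.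
have -> : g * H / g = - H by rewrite gH mulNr mulrK.
move=> /polar_uniq /(_ (polar_opp hp)) e.
by rewrite /anticomm -[g * Q](mulrVK ug) e mulNr.
Qed.

Lemma odd_partE Q x : Q * Q = -1 -> odd_part Q x = 2^-1 *: (x + Q * x * Q).
Proof. by move=> /Q_unit[_ e]; rewrite /odd_part e !mulNr opprK. Qed.

Lemma odd_partD Q x y : odd_part Q (x + y) = odd_part Q x + odd_part Q y.
Proof. by rewrite /odd_part -scalerDr; congr (_ *: _); nc_ring. Qed.

Lemma odd_partZ Q (a : R) x : odd_part Q (a *: x) = a *: odd_part Q x.
Proof. by rewrite /odd_part -!scalerAr -!scalerAl -scalerBr !scalerA mulrC. Qed.

Lemma odd_part_anticomm Q x : Q * Q = -1 -> anticomm Q (odd_part Q x).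
Proof.
move=> QQ; rewrite /anticomm odd_partE // -scalerAr -scalerAl -scalerN; congr (_ *: _).
by rewrite mulrDr mulrDl !mulrA QQ -[Q * x * Q * Q]mulrA QQ; nc_ring.
Qed.

Lemma odd_part_id Q x : Q * Q = -1 -> anticomm Q x -> odd_part Q x = x.
Proof.
move=> QQ Qx; rewrite odd_partE // Qx mulNr -mulrA QQ mulrN1 opprK -mulr2n -[x *+ 2]scaler_nat.
by rewrite scalerA mulVf ?scale1r // pnatr_eq0.
Qed.

Lemma odd_part_comm0 Q x : Q * Q = -1 -> Q * x = x * Q -> odd_part Q x = 0.
Proof. by move=> QQ Qx; rewrite odd_partE // Qx -mulrA QQ mulrN1 subrr scaler0. Qed.

End PolarProperties.

(** * The procedures *)

Section GramSchmidt.
Variable R : realType.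

Definition gs_fold (A : convAlgType R) n (q : 'I_n -> A) (s : seq 'I_n) (x : A) : A :=
  foldl (fun r j => odd_part (q j) r) x s.

Definition below n (k : 'I_n) : seq 'I_n := [seq j : 'I_n <- enum 'I_n | (j < k)%N].

Lemma GS_argE (A : convAlgType R) n (a q : 'I_n -> A) k :
  GS_arg a q k = gs_fold q (below k) (a k).
Proof. by []. Qed.

Lemma mem_below n (k j : 'I_n) : (j \in below k) = (j < k)%N.
Proof. by rewrite mem_filter mem_enum andbT. Qed.

Lemma below_take n (k : 'I_n) : below k = take k (enum 'I_n).
Proof.
apply: (inj_map val_inj); rewrite map_take val_enum_ord take_iota.
rewrite /below -(filter_map val (fun j => (j < k)%N)) val_enum_ord.
have -> : iota 0 n = iota 0 k ++ iota k (n - k) by rewrite -iotaD subnKC // ltnW.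
rewrite filter_cat (minn_idPl (ltnW (ltn_ord k))).
have -> : [seq x <- iota 0 k | (x < k)%N] = iota 0 k.
  by apply/all_filterP/allP => x; rewrite mem_iota.
have -> : [seq x <- iota k (n - k) | (x < k)%N] = [::]; last by rewrite cats0.
by apply/eqP; rewrite -[_ == _]negbK -has_filter; apply/hasPn => x; rewrite mem_iota -leqNgt => /andP[].
Qed.

Lemma below_split n (j k : 'I_n) : (j < k)%N -> exists s, below k = below j ++ j :: s.
Proof.
move=> jk; exists (drop j.+1 (take k (enum 'I_n))).
rewrite !below_take -{1}[take k _](cat_take_drop j) take_takel; last exact: ltnW.
congr (_ ++ _); rewrite (drop_nth j) ?size_take ?size_enum_ord ?ltn_ord //.
by rewrite nth_take // nth_ord_enum.
Qed.

Section Fold.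
Variables (A : convAlgType R) (n : nat).
Implicit Types (q : 'I_n -> A) (s : seq 'I_n) (x y : A).

Lemma gs_foldD q s x y : gs_fold q s (x + y) = gs_fold q s x + gs_fold q s y.
Proof. by elim: s x y => //= j s IH x y; rewrite odd_partD IH. Qed.

Lemma gs_foldZ q s (a : R) x : gs_fold q s (a *: x) = a *: gs_fold q s x.
Proof. by elim: s x => //= j s IH x; rewrite odd_partZ IH. Qed.

Lemma gs_fold0 q s : gs_fold q s 0 = 0.
Proof. by rewrite -(scale0r (0 : A)) gs_foldZ !scale0r. Qed.

Lemma gs_fold_sum q s m (F : 'I_m -> A) :
  gs_fold q s (\sum_j F j) = \sum_j gs_fold q s (F j).
Proof. exact: (big_morph _ (gs_foldD q s) (gs_fold0 q s)). Qed.

Lemma eq_gs_fold q q' s x : (forall j, j \in s -> q j = q' j) -> gs_fold q s x = gs_fold q' s x.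
Proof.
elim: s x => //= j s IH x h; rewrite h ?mem_head // IH // => l ls.
by rewrite h // inE ls orbT.
Qed.

(** If Q_j anticommutes with Q_l and y, it also anticommutes with Q_l y Q_l; so the odd part for a
    later Q_l preserves what the earlier ones achieved. *)
Lemma gs_fold_anticomm q s x : uniq s -> (forall j, j \in s -> q j * q j = -1) ->
  (forall i j, i \in s -> j \in s -> i != j -> anticomm (q i) (q j)) ->
  forall j, j \in s -> anticomm (q j) (gs_fold q s x).
Proof.
elim/last_ind: s => [//|s l IH]; rewrite rcons_uniq => /andP[ls us] h1 h2 j.
have sub i : i \in s -> i \in rcons s l by rewrite mem_rcons inE => ->; rewrite orbT.
have hl : l \in rcons s l by rewrite mem_rcons mem_head.
rewrite mem_rcons inE /gs_fold foldl_rcons -/(gs_fold q s x) => /predU1P[->|js].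
  exact/odd_part_anticomm/h1.
have jl : j != l by apply: contraNneq ls => <-.
have hj : anticomm (q j) (gs_fold q s x).
  by apply: IH => // [i /sub|i i' /sub + /sub]; [exact: h1|exact: h2].
have hjl := h2 _ _ (sub _ js) hl jl.
rewrite /anticomm odd_partE ?h1 // -scalerAr -scalerAl -scalerN; congr (_ *: _).
move: hj hjl; rewrite /anticomm; set u := q j; set v := q l; set y := gs_fold q s x => uy uv.
have -> : u * (y + v * y * v) = u * y + u * v * y * v by nc_ring.
(* An identity of the free algebra, in which the brackets u v + v u and u y + y u vanish; what
   remains is - v y v u. *)
have -> : u * v * y * v = v * y * v * u + (u * v + v * u) * y * v - v * (u * y + y * u) * v
   + v * y * (u * v + v * u) - v * y * v * u *+ 2.
  by rewrite mulr2n; nc_ring.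
rewrite uy uv !addNr mul0r mul0r mulr0 mul0r mulr0 subr0 !addr0 mulr2n.
by nc_ring.
Qed.

Lemma gs_fold_id q s x : (forall j, j \in s -> q j * q j = -1) ->
  (forall j, j \in s -> anticomm (q j) x) -> gs_fold q s x = x.
Proof.
elim: s => //= j s IH h1 h2; rewrite (odd_part_id (h1 j (mem_head _ _)) (h2 j (mem_head _ _))).
apply: IH => l ls; first by apply: h1; rewrite inE ls orbT.
by apply: h2; rewrite inE ls orbT.
Qed.

End Fold.

Lemma gs_fold_hom (A B : convAlgType R) n (f : A -> B) (q : 'I_n -> A) s x : alg_hom f ->
  (forall j, j \in s -> q j * q j = -1) -> f (gs_fold q s x) = gs_fold (f \o q) s (f x).
Proof.
move=> hf; have [f1 fD fZ fM] := hf; elim: s x => //= j s IH x h.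
rewrite IH; last by move=> l ls; apply: h; rewrite inE ls orbT.
have hj : q j * q j = -1 by apply: h; rewrite mem_head.
have fj : f (q j) * f (q j) = -1 by rewrite -fM hj (alg_homN _ hf) f1.
by rewrite !odd_partE // fZ fD !fM.
Qed.

Lemma OGS_polarP (A : convAlgType R) n (a q : 'I_n -> A) :
  OGS a q <-> forall k, polar (GS_arg a q k) (q k).
Proof.
split=> h k; first by have [h1 ->] := h k; apply: pol_dom_polar.
by split; [exact: polar_pol_dom (h k)|rewrite (pol_polar (h k))].
Qed.

Section Properties.
Variables (A : convAlgType R) (n : nat).
Implicit Types (a b q : 'I_n -> A).

Lemma clifford_systemP q : clifford_system q <->
  (forall k, q k * q k = -1) /\ (forall i j, i != j -> anticomm (q i) (q j)).
Proof.
split=> [h|[h1 h2] i j].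
  split=> [k|i j ij]; have := h.
    move=> /(_ k k); rewrite eqxx mulr1 -mulr2n -[_ *+ 2]scaler_nat scaleNr -scalerN.
    by move=> /(can_inj (scalerK _)) -> //; rewrite pnatr_eq0.
  by move=> /(_ i j); rewrite (negbTE ij) mulr0 scale0r => /eqP; rewrite addr_eq0 => /eqP.
have [<-|ij] := eqVneq i j.
  by rewrite h1 mulr1 scaleNr scaler_nat mulr2n opprD.
by rewrite mulr0 scale0r h2 // addNr.
Qed.

(** Induction on the larger index k: once the earlier Q_j anticommute with each other, the argument
    of the kth polarization anticommutes with them, and [polar_anticomm] passes this on to Q_k. *)
Lemma OGS_clifford a q : OGS a q -> clifford_system q.
Proof.
move=> /OGS_polarP h; have h1 k : q k * q k = -1 by case: (h k).
apply/clifford_systemP; split=> // i j ij.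
suff hk k : forall j : 'I_n, (j < k)%N -> (k < n)%N -> forall k' : 'I_n, k' = k :> nat -> anticomm (q j) (q k').
  case: (ltngtP i j) => [ij'|ji|/val_inj e]; last by rewrite e eqxx in ij.
    exact: (hk j).
  have : anticomm (q j) (q i) by apply: (hk i).
  by rewrite /anticomm => ->; rewrite opprK.
have [m] := ubnP k; elim: m k {i j ij} => // m IH k km j jk kn k' k'k.
apply: polar_anticomm (h k') (h1 j) _; rewrite GS_argE.
apply: gs_fold_anticomm => //; rewrite ?mem_below ?k'k //; first by rewrite filter_uniq ?enum_uniq.
move=> u v; rewrite !mem_below k'k => uk vk uv.
case: (ltngtP u v) => [uv'|vu|/val_inj e]; last by rewrite e eqxx in uv.
  by apply: (IH v) => //; apply: leq_trans vk km.
have : anticomm (q v) (q u) by apply: (IH u) => //; apply: leq_trans uk km.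
by rewrite /anticomm => ->; rewrite opprK.
Qed.

Lemma OGS_uniq a q q' : OGS a q -> OGS a q' -> q = q'.
Proof.
move=> h h'; apply/funext => k; have [m] := ubnP k; elim: m k => // m IH k km.
have [_ ->] := h k; have [_ ->] := h' k; rewrite !GS_argE; congr pol.
apply: eq_gs_fold => j; rewrite mem_below => jk; apply: IH; exact: leq_trans jk km.
Qed.

Lemma GS_arg_clifford q k : clifford_system q -> GS_arg q q k = q k.
Proof.
move=> /clifford_systemP[h1 h2]; rewrite GS_argE gs_fold_id // => j; rewrite mem_below => jk.
by apply: h2; rewrite neq_ltn jk.
Qed.

Lemma OGS_fixed q : clifford_system q -> OGS q q.
Proof.
move=> hq; apply/OGS_polarP => k; rewrite GS_arg_clifford //.
by apply: polar_self; case/clifford_systemP: hq.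
Qed.

Lemma OGS_sign a b (iota : 'I_n -> bool) : OGS a b ->
  OGS (fun k => (-1) ^+ iota k * a k) (fun k => (-1) ^+ iota k * b k).
Proof.
move=> h; have /clifford_systemP[h1 _] := OGS_clifford h.
have hs : forall s x, gs_fold (fun k => (-1) ^+ iota k * b k) s x = gs_fold b s x.
  elim=> //= j s IH x; rewrite IH; congr (gs_fold _ _ _).
  case: (iota j); rewrite ?expr1 ?expr0 ?mulN1r ?mul1r //.
  by rewrite !odd_partE ?mulrNN // !mulNr mulrN opprK.
move/OGS_polarP: h => h; apply/OGS_polarP => k; rewrite GS_argE hs.
case: (iota k); rewrite ?expr1 ?expr0 ?mulN1r ?mul1r //; last exact: h.
rewrite -scaleN1r gs_foldZ scaleN1r; exact/polar_opp/h.
Qed.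

Lemma OGS_scale a b (t : R) : 0 < t -> OGS a b -> OGS (fun k => t *: a k) b.
Proof.
move=> t0 /OGS_polarP h; apply/OGS_polarP => k; rewrite GS_argE gs_foldZ.
exact/polar_scale/h.
Qed.

(** What is left of a_j when Q_j is reached is the element whose polarization is Q_j. It commutes
    with Q_j, so its odd part is 0. *)
Lemma GS_arg_below a b (j k : 'I_n) : OGS a b -> (j < k)%N -> gs_fold b (below k) (a j) = 0.
Proof.
move=> h jk; have /clifford_systemP[h1 _] := OGS_clifford h.
have [s ->] := below_split jk; rewrite /gs_fold foldl_cat /= -/(gs_fold b (below j) (a j)).
rewrite -/(gs_fold b s _) odd_part_comm0 ?gs_fold0 //.
by move/OGS_polarP: h => /(_ j)[].
Qed.

(* The real summands allow for [1 = A_1 A_1^-1] in the floating case. *)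
Lemma OGS_trig a b (U : 'I_n -> 'I_n -> R) (w : 'I_n -> R) :
  (forall i j : 'I_n, (i < j)%N -> U i j = 0) -> (forall i, 0 < U i i) -> OGS a b ->
  OGS (fun i => (w i)%:A + \sum_j U i j *: a j) b.
Proof.
move=> U0 Up h; have /clifford_systemP[h1 _] := OGS_clifford h.
have hp := h; move/OGS_polarP: hp => hp; apply/OGS_polarP => k.
have -> : GS_arg (fun i => (w i)%:A + \sum_j U i j *: a j) b k =
    U k k *: GS_arg a b k + gs_fold b (below k) (w k)%:A.
  rewrite GS_argE gs_foldD gs_fold_sum addrC; congr (_ + _).
  rewrite (bigD1 k) //= gs_foldZ big1 ?addr0 // => j jk; rewrite gs_foldZ.
  have [jk'|kj] := ltnP j k; first by rewrite GS_arg_below // scaler0.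
  by rewrite U0 ?scale0r // ltn_neqAle kj andbT eq_sym.
(* A scalar is killed by the first odd part; it survives only in the first component, where
   [polar_addr] applies. *)
have [s0|s0] := pselect (below k = [::]).
  by rewrite s0 /=; apply: polar_addr; apply: polar_scale.
have -> : gs_fold b (below k) (w k)%:A = 0.
  case: (below k) s0 => //= j s _; rewrite odd_part_comm0 ?gs_fold0 //.
  by rewrite -scalerAl -scalerAr mul1r mulr1.
by rewrite addr0; apply: polar_scale.
Qed.

Lemma OGS_segment a b (t : R) : 0 <= t <= 1 -> OGS a b ->
  OGS (fun k => t *: a k + (1 - t) *: b k) b.
Proof.
move=> t01 h; have hc := OGS_clifford h; move/OGS_polarP: h => h; apply/OGS_polarP => k.
by rewrite GS_argE gs_foldD !gs_foldZ -!GS_argE (GS_arg_clifford _ hc); apply: polar_mix.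
Qed.

End Properties.

Lemma OGS_hom (A B : convAlgType R) n (f : A -> B) (a b : 'I_n -> A) : alg_hom f ->
  OGS a b -> OGS (f \o a) (f \o b).
Proof.
move=> hf h; have /clifford_systemP[h1 _] := OGS_clifford h.
move/OGS_polarP: h => h; apply/OGS_polarP => k.
rewrite GS_argE -[(f \o a) k]/(f (a k)) -gs_fold_hom //; exact: polar_hom (h k).
Qed.

Lemma pair_unit (A B : convAlgType R) (x : A) (y : B) : x \is a GRing.unit ->
  y \is a GRing.unit -> ((x, y) : (A * B)%type) \is a GRing.unit.
Proof.
move=> ux uy; apply/unitrP; exists (x^-1, y^-1); split; apply/pair_equal_spec; split=> /=;
  by rewrite ?mulVr ?divrr.
Qed.

Lemma fst_alg_hom (A B : convAlgType R) : alg_hom (fst : (A * B)%type -> A).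
Proof. by split. Qed.

Lemma snd_alg_hom (A B : convAlgType R) : alg_hom (snd : (A * B)%type -> B).
Proof. by split. Qed.

Lemma polar_pair (A B : convAlgType R) (H Q : (A * B)%type) :
  polar H.1 Q.1 -> polar H.2 Q.2 -> polar H Q.
Proof.
move: H Q => [H H'] [Q Q'] /= [QQ QH hu] [QQ' QH' hu']; split.
- by apply/pair_equal_spec; split.
- by apply/pair_equal_spec; split.
by move=> x y y0; apply: pair_unit; [exact: hu|exact: hu'].
Qed.

Lemma OGS_pair (A B : convAlgType R) n (a q : 'I_n -> A) (b p : 'I_n -> B) :
  OGS a q -> OGS b p -> OGS (fun k => (a k, b k) : (A * B)%type) (fun k => (q k, p k)).
Proof.
move=> h h'; have /clifford_systemP[h1 _] := OGS_clifford h.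
have /clifford_systemP[h1' _] := OGS_clifford h'.
have hh j : ((q j, p j) : (A * B)%type) * (q j, p j) = -1.
  by apply/pair_equal_spec; split; [exact: h1|exact: h1'].
move/OGS_polarP: h => h; move/OGS_polarP: h' => h'; apply/OGS_polarP => k.
apply: polar_pair; rewrite GS_argE.
  by rewrite (gs_fold_hom _ (@fst_alg_hom A B)) //; exact: h k.
by rewrite (gs_fold_hom _ (@snd_alg_hom A B)) //; exact: h' k.
Qed.

End GramSchmidt.

(** * Continuity of the procedures and openness of their domains *)

Section Domains.
Variables (R : realType) (A : convAlgType R) (nu : A -> R).
Hypothesis hnu : snorm 1 nu.

Let hs : seminorm nu. Proof. by case: hnu. Qed.
Let hm : forall x y, nu (x * y) <= nu x * nu y. Proof. by case: hnu. Qed.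
Let n0 x : 0 <= nu x. Proof. exact: seminorm_ge0. Qed.

Lemma snorm_mul_close (x y x' y' : A) (d : R) : d <= 1 -> nu (x' - x) <= d -> nu (y' - y) <= d ->
  nu (x' * y' - x * y) <= d * (nu x + nu y + 1).
Proof.
move=> d1 hx hy; have -> : x' * y' - x * y = (x' - x) * (y' - y) + (x' - x) * y + x * (y' - y).
  by nc_ring.
apply: le_trans (proj1 hs _ _) _; apply: le_trans (lerD (proj1 hs _ _) (lexx _)) _.
have h1 : nu ((x' - x) * (y' - y)) <= d * 1.
  by apply: le_trans (hm _ _) _; apply: ler_pM => //; apply: le_trans hy d1.
have h2 : nu ((x' - x) * y) <= d * nu y by apply: le_trans (hm _ _) _; apply: ler_wpM2r.
have h3 : nu (x * (y' - y)) <= nu x * d by apply: le_trans (hm _ _) _; apply: ler_wpM2l.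
by lra.
Qed.

(** The inverse of an element of square -1 is its opposite, so only products have to be
    estimated. *)
Lemma odd_part_continuous (Q x : A) e : Q * Q = -1 -> 0 < e ->
  exists2 d, 0 < d & forall Q' x', Q' * Q' = -1 -> nu (Q' - Q) <= d -> nu (x' - x) <= d ->
    nu (odd_part Q' x' - odd_part Q x) <= e.
Proof.
move=> QQ e0; pose a := nu Q + nu x + 1; pose b := nu (Q * x) + nu Q + 1.
have a0 : 0 < a by rewrite ltr_wpDl // addr_ge0.
have b0 : 0 < b by rewrite ltr_wpDl // addr_ge0.
have a1 : 1 <= a by rewrite lerDr addr_ge0.
have b1 : 1 <= b by rewrite lerDr addr_ge0.
pose d := Num.min (a^-1) (e / (a * b)).
have d0 : 0 < d by rewrite lt_min invr_gt0 a0 divr_gt0 // mulr_gt0.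
exists d => // Q' x' QQ' hQ hx.
have [da de] : d <= a^-1 /\ d <= e / (a * b) by rewrite /d; split; rewrite ge_min lexx ?orbT.
have d1 : d <= 1 by apply: le_trans da _; rewrite invf_le1.
have h1 : nu (Q' * x' - Q * x) <= d * a by apply: snorm_mul_close.
have da1 : d * a <= 1 by rewrite -ler_pdivlMr // div1r.
have dda : d <= d * a by rewrite ler_peMr // ltW.
have h2 : nu (Q' * x' * Q' - Q * x * Q) <= d * a * b.
  by apply: snorm_mul_close => //; apply: le_trans dda.
have h3 : d * a * b <= e by rewrite -mulrA -ler_pdivlMr ?mulr_gt0.
rewrite !odd_partE // -scalerBr (proj2 hs) ger0_norm ?invr_ge0 //.
have -> : x' + Q' * x' * Q' - (x + Q * x * Q) = (x' - x) + (Q' * x' * Q' - Q * x * Q) by nc_ring.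
have h4 : d <= d * a * b by apply: le_trans dda _; rewrite ler_peMr // mulr_ge0 // ltW.
have := proj1 hs (x' - x) (Q' * x' * Q' - Q * x * Q).
move=> h5; rewrite ler_pdivrMl //; lra.
Qed.

Lemma gs_fold_continuous n (q : 'I_n -> A) (s : seq 'I_n) (x : A) e :
  (forall j, j \in s -> q j * q j = -1) -> 0 < e ->
  exists2 d, 0 < d & forall q' x', nu (x' - x) <= d ->
    (forall j, j \in s -> q' j * q' j = -1 /\ nu (q' j - q j) <= d) ->
    nu (gs_fold q' s x' - gs_fold q s x) <= e.
Proof.
elim: s x e => [|j s IH] x e hq e0; first by exists e.
have [l ls|d1 d10 h1] := IH (odd_part (q j) x) e _ e0; first by apply: hq; rewrite inE ls orbT.
have [d2 d20 h2] := odd_part_continuous x (hq j (mem_head _ _)) d10.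
exists (Num.min d1 d2); first by rewrite lt_min d10.
move=> q' x'; rewrite le_min => /andP[_ hx] h.
apply: h1 => [|l ls]; last first.
  by have [|qq] := h l; [rewrite inE ls orbT|rewrite le_min => /andP[]].
have [|qq] := h j; first exact: mem_head.
by rewrite le_min => /andP[_ hj]; apply: h2.
Qed.

Lemma OGS_continuous n (a q : 'I_n -> A) e : OGS a q -> 0 < e ->
  exists2 d, 0 < d & forall a', (forall k, nu (a' k - a k) <= d) ->
    exists2 q', OGS a' q' & forall k, nu (q' k - q k) <= e.
Proof.
move=> hq; have /clifford_systemP[qq _] := OGS_clifford hq; move/OGS_polarP: hq => hq.
(* Only the first m components of q' are constrained; the next one is the polarization of an
   argument which depends on these alone. *)
suff h m e' : (m <= n)%N -> 0 < e' -> exists2 d, 0 < d & forall a', (forall k, nu (a' k - a k) <= d) ->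
    exists q' : 'I_n -> A, forall k : 'I_n, (k < m)%N -> polar (GS_arg a' q' k) (q' k) /\ nu (q' k - q k) <= e'.
  move=> e0; have [d d0 hd] := h n e (leqnn n) e0; exists d => // a' /hd[q' hq'].
  by exists q' => [|k]; [apply/OGS_polarP => k|]; case: (hq' k).
elim: m e' => [|m IH] e' mn e0; first by exists 1 => // a' _; exists q.
pose k0 := Ordinal mn.
have [d1 d10 h1] := pol_continuous hnu (polar_pol_dom (hq k0)) e0.
have [d2 d20 h2] := gs_fold_continuous (a k0) (fun j (_ : j \in below k0) => qq j) d10.
have [|d3 d30 h3] := IH (Num.min d2 e') (ltnW mn); first by rewrite lt_min d20.
exists (Num.min d2 d3); first by rewrite lt_min d20.
move=> a' ha'; have [|q' hq'] := h3 a'.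
  by move=> k; have := ha' k; rewrite le_min => /andP[].
have [|p1 p2] := h1 (GS_arg a' q' k0).
  apply: h2; first by have := ha' k0; rewrite le_min => /andP[].
  by move=> j; rewrite mem_below => jk; have [[q'q' _ _]] := hq' j jk; rewrite le_min => /andP[].
exists (fun k => if k == k0 then pol (GS_arg a' q' k0) else q' k) => k km.
have -> : GS_arg a' (fun k => if k == k0 then pol (GS_arg a' q' k0) else q' k) k = GS_arg a' q' k.
  apply: eq_gs_fold => j; rewrite mem_below => jk; rewrite ifF //; apply/eqP => ejk.
  by move: jk km; rewrite ejk /= ltnS => /leq_trans h /h; rewrite ltnn.
case: eqP => [->|kk0].
  split; first exact: pol_dom_polar.
  by move: p2; rewrite (pol_polar (hq k0)).
have km' : (k < m)%N.
  by move: km; rewrite ltnS leq_eqVlt => /predU1P[ekm|//]; case: kk0; apply: val_inj.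
have [h4] := hq' k km'; rewrite le_min => /andP[_ h5]; by split.
Qed.

Lemma OGS_zero_open n : zero_open (domain (@OGS R n) (A := A)).
Proof.
apply: (zero_open_local hnu) => a [q hq]; have [d d0 hd] := OGS_continuous hq ltr01.
by exists d => // a' /hd[q' hq' _]; exists q'.
Qed.

Lemma OfGS_zero_open n : zero_open (domain (@OfGS R n) (A := A)).
Proof.
apply: (zero_open_local hnu) => a [b [ua [q hq _]]].
have [d d0 hd] := OGS_continuous hq ltr01.
set u := a ord0 in ua hq *; pose B := nu u^-1.
pose S := \sum_i nu (a i); have aS k : nu (a k) <= S.
  by rewrite /S (bigD1 k) //= lerDl sumr_ge0.
have S0 : 0 <= S by apply: sumr_ge0.
pose M := 2 * B * B + 1; have M1 : 1 <= M by rewrite lerDr !mulr_ge0 ?n0.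
pose N := S + B + 1; have N0 : 0 < N by rewrite ltr_wpDl // addr_ge0 // n0.
have M0 : 0 < M by apply: lt_le_trans M1.
have B1 : 0 < 4 * (B + 1) by rewrite mulr_gt0 // ltr_wpDl // n0.
(* The first bound keeps A_1 invertible; the other two bring the errors of all A_k A_1^-1 below
   d. *)
pose r := Num.min (4 * (B + 1))^-1 (Num.min M^-1 (d / (M * N))).
have r0 : 0 < r by rewrite !lt_min !invr_gt0 B1 M0 divr_gt0 // mulr_gt0.
exists r => // a' ha'.
have [r1 r2 r3] : [/\ r <= (4 * (B + 1))^-1, r <= M^-1 & r <= d / (M * N)].
  by rewrite /r; split; rewrite !ge_min lexx ?orbT.
have rM1 : M * r <= 1 by rewrite mulrC -ler_pdivlMr // div1r.
have hv : B * nu (a' ord0 - u) <= 4^-1.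
  apply: (@le_trans _ _ ((B + 1) * (4 * (B + 1))^-1)).
    apply: ler_pM => //; rewrite ?n0 ?lerDl //; exact: le_trans (ha' _) r1.
  by rewrite invfM mulrCA mulfV ?mulr1 // gt_eqF // ltr_wpDl // n0.
have [uv _ hi] := inv_perturb hnu (n0 u^-1) ua (lexx _) hv.
have [q' hq' _] : exists2 q', OGS (fun i => a' (lift ord0 i) / a' ord0) q' &
    forall k, nu (q' k - q k) <= 1.
  apply: hd => k.
  have hi' : nu ((a' ord0)^-1 - u^-1) <= M * r.
    apply: le_trans hi _; apply: (@le_trans _ _ (2 * B * B * r)); last first.
      by rewrite ler_pM2r // lerDl.
    by apply: ler_wpM2l (ha' _); rewrite !mulr_ge0 // n0.
  have hr : nu (a' (lift ord0 k) - a (lift ord0 k)) <= M * r.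
    by apply: le_trans (ha' _) _; rewrite ler_peMl // ltW.
  apply: le_trans (snorm_mul_close rM1 hr hi') _.
  apply: (@le_trans _ _ (M * r * N)).
    by apply: ler_wpM2l; [rewrite mulr_ge0 // ltW|rewrite /N !lerD2r].
  have -> : M * r * N = r * (M * N) by ring.
  by rewrite -ler_pdivlMr // mulr_gt0.
exists (fun i => if unlift ord0 i is Some j then q' j * a' ord0 else a' ord0).
split=> //; exists q' => //; split; first by rewrite unlift_none.
by move=> i; rewrite liftK.
Qed.

End Domains.

(** * The floating procedure *)

Section FloatingProperties.
Variable R : realType.

Lemma ord_lift0 n (P : 'I_n.+1 -> Prop) : P ord0 -> (forall i, P (lift ord0 i)) -> forall k, P k.
Proof. by move=> h0 hS k; case: (unliftP ord0 k) => [j ->|->]. Qed.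

Section One.
Variables (A : convAlgType R) (n : nat).
Implicit Types (a b : 'I_n.+1 -> A).

Lemma OfGS_uniq a b b' : OfGS a b -> OfGS a b' -> b = b'.
Proof.
move=> [_ [q hq [b0 bS]]] [_ [q' hq' [b0' bS']]]; have e := OGS_uniq hq hq'.
by apply/funext; apply: ord_lift0 => [|i]; rewrite ?b0 ?b0' // bS bS' e.
Qed.

(** The right factor cancels in A_k A_1^-1, and the left factor acts on it by conjugation. *)
Lemma OfGS_biv a b (t1 t2 : A) : t1 \is a GRing.unit -> t2 \is a GRing.unit -> OfGS a b ->
  OfGS (fun k => t1 * a k * t2) (fun k => t1 * b k * t2).
Proof.
move=> u1 u2 [u0 [q hq [b0 bS]]]; have ut x : x \is a GRing.unit -> t1 * x * t2 \is a GRing.unit.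
  by move=> ux; rewrite unitrMr // unitrMl.
split; first exact: ut.
exists (fun i => t1 * q i / t1); last first.
  split; rewrite ?b0 // => i; rewrite bS !mulrA mulrVK //.
have := OGS_hom (conj_alg_hom u1) hq; congr OGS; apply/funext => i /=.
rewrite invrM ?unitrMl // invrM // !mulrA; congr (_ / _); congr (_ / _).
by rewrite mulrK.
Qed.

Lemma OfGS_clifford a b : OfGS a b -> floating_clifford_system b.
Proof.
move=> [u0 [q /OGS_clifford hq [b0 bS]]]; split; first by rewrite b0.
suff -> : (fun i => b (lift ord0 i) / b ord0) = q by [].
by apply/funext => i; rewrite b0 bS mulrK.
Qed.

Lemma OfGS_fixed b : floating_clifford_system b -> OfGS b b.
Proof.
move=> [u0 /OGS_fixed hq]; split=> //; exists (fun i => b (lift ord0 i) / b ord0) => //.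
by split=> // i; rewrite mulrVK.
Qed.

Lemma OfGS_sign a b (iota : 'I_n.+1 -> bool) : OfGS a b ->
  OfGS (fun k => (-1) ^+ iota k * a k) (fun k => (-1) ^+ iota k * b k).
Proof.
move=> [u0 [q hq [b0 bS]]].
have us : (-1) ^+ iota ord0 * a ord0 \is a GRing.unit.
  by case: (iota ord0); rewrite ?expr1 ?expr0 ?mulN1r ?mul1r ?unitrN.
split=> //; exists (fun i => (-1) ^+ (iota (lift ord0 i) (+) iota ord0) * q i); last first.
  split; rewrite ?b0 // => i; rewrite bS.
  by case: (iota _) => //=; case: (iota _) => /=; rewrite ?expr1 ?expr0 ?mulN1r ?mul1r ?mulrN ?mulNr ?opprK.
have := OGS_sign (fun i => iota (lift ord0 i) (+) iota ord0) hq; congr OGS; apply/funext => i.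
by case: (iota _) => //=; case: (iota _) => /=;
  rewrite ?expr1 ?expr0 ?mulN1r ?mul1r ?invrN ?mulrN ?mulNr ?opprK.
Qed.

Lemma OfGS_par a b (U : 'M[R]_n.+1) : is_trig_mx U -> (forall i, 0 < U i i) ->
  U ord0 ord0 = 1 -> OfGS a b -> OfGS (fun i => \sum_j U i j *: a j) b.
Proof.
move=> /is_trig_mxP U0 Up U1 [u0 [q hq [b0 bS]]].
have e0 : \sum_j U ord0 j *: a j = a ord0.
  by rewrite big_ord_recl U1 scale1r big1 ?addr0 // => i _; rewrite U0 ?scale0r.
split; rewrite e0 //; exists q => //.
(* The first column of U contributes real scalars to the ratios, as A_1 A_1^-1 = 1. *)
have := OGS_trig (U := fun i j => U (lift ord0 i) (lift ord0 j)) (fun i => U (lift ord0 i) ord0) _ _ hq.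
move=> h; have -> : (fun i => (\sum_j U (lift ord0 i) j *: a j) / a ord0) =
    fun i => (U (lift ord0 i) ord0)%:A + \sum_j U (lift ord0 i) (lift ord0 j) *: (a (lift ord0 j) / a ord0).
  apply/funext => i; rewrite big_ord_recl mulrDl -scalerAl divrr //; congr (_ + _).
  by rewrite mulr_suml; apply: eq_bigr => j _; rewrite -scalerAl.
by apply: h => // i j ij; apply: U0.
Qed.

Lemma OfGS_segment a b (t : R) : 0 <= t <= 1 -> OfGS a b ->
  OfGS (fun k => t *: a k + (1 - t) *: b k) b.
Proof.
move=> t01 [u0 [q hq [b0 bS]]]; have e0 : t *: a ord0 + (1 - t) *: b ord0 = a ord0.
  by rewrite b0 -scalerDl subrKC scale1r.
split; rewrite e0 //; exists q => //.
have := OGS_segment t01 hq; congr OGS; apply/funext => i.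
by rewrite bS mulrDl -!scalerAl mulrK.
Qed.

End One.

Lemma OfGS_hom (A B : convAlgType R) n (f : A -> B) (a b : 'I_n.+1 -> A) : alg_hom f ->
  OfGS a b -> OfGS (f \o a) (f \o b).
Proof.
move=> hf [u0 [q hq [b0 bS]]]; have [_ _ _ fM] := hf.
split; first exact: alg_hom_unit.
exists (f \o q); last by split=> [|i] /=; rewrite ?b0 // bS fM.
have := OGS_hom hf hq; congr OGS; apply/funext => i /=.
by rewrite fM (alg_homV hf u0).
Qed.

Lemma OfGS_pair (A B : convAlgType R) n (a q : 'I_n.+1 -> A) (b p : 'I_n.+1 -> B) :
  OfGS a q -> OfGS b p -> OfGS (fun k => (a k, b k) : (A * B)%type) (fun k => (q k, p k)).
Proof.
move=> [u0 [x hx [q0 qS]]] [v0 [y hy [p0 pS]]]; have uv := pair_unit u0 v0; split=> //.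
exists (fun k => (x k, y k)); last first.
  by split=> [|i]; rewrite ?q0 ?p0 // qS pS.
have := OGS_pair hx hy; congr OGS; apply/funext => i; apply/esym.
have -> : ((a ord0, b ord0) : (A * B)%type)^-1 = ((a ord0)^-1, (b ord0)^-1).
  apply: (mulrI uv); rewrite divrr //; apply/esym/pair_equal_spec.
  by split=> /=; rewrite divrr.
by [].
Qed.

End FloatingProperties.

(** * Analytic expansions *)

Section FormalSeries.
Variables (R : realType) (A : convAlgType R).
Implicit Types (u v : nat -> A) (p : {poly A}).

Definition series_one (r : nat) : A := (r == 0%N)%:R.

(** Congruence modulo X^N: identities between formal series are reduced to polynomial identities for
    their truncations. *)
Definition agree N p p' := forall r, (r < N)%N -> p`_r = p'`_r.

Lemma agreeM N p p' s s' : agree N p p' -> agree N s s' -> agree N (p * s) (p' * s').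
Proof.
move=> h h' r rN; rewrite !coefM; apply: eq_bigr => j _.
by rewrite h ?h' // (leq_ltn_trans _ rN) ?leq_subr // -ltnS.
Qed.

Lemma agreeX N p p' k : agree N p p' -> agree N (p ^+ k) (p' ^+ k).
Proof. by move=> h; elim: k => [|k IH]; rewrite ?expr0 // !exprS; apply: agreeM. Qed.

Lemma agree_trans N p p' p2 : agree N p p' -> agree N p' p2 -> agree N p p2.
Proof. by move=> h h' r rN; rewrite h ?h'. Qed.

Lemma agree_sym N p p' : agree N p p' -> agree N p' p.
Proof. by move=> h r rN; rewrite h. Qed.

Definition trunc N u : {poly A} := \poly_(s < N) u s.

Lemma trunc_cauchy_prod N u v : agree N (trunc N (cauchy_prod u v)) (trunc N u * trunc N v).
Proof.
move=> r rN; rewrite coef_poly rN coefM /cauchy_prod; apply: eq_bigr => j _.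
have jr : (j <= r)%N by rewrite -ltnS.
by rewrite !coef_poly !ifT // (leq_ltn_trans _ rN) // leq_subr.
Qed.

Lemma trunc_one N : agree N (trunc N series_one) 1.
Proof. by move=> r rN; rewrite coef_poly rN coef1. Qed.

Lemma trunc_addN N u v : trunc N (fun r => u r - v r) = trunc N u - trunc N v.
Proof. by apply/polyP => r; rewrite coefB !coef_poly; case: ifP => // _; rewrite subrr. Qed.

Lemma coefX_lt p k r : p`_0 = 0 -> (r < k)%N -> (p ^+ k)`_r = 0.
Proof.
move=> p0; elim: k r => // k IH r rk; rewrite exprS coefM big1 // => -[[|s] sr] _ /=.
  by rewrite p0 mul0r.
by rewrite IH ?mulr0 //; move: sr rk; rewrite !ltnS; case: r => // r; rewrite subSS => _ /(leq_ltn_trans (leq_subr s r)).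
Qed.

(* Meant for [u 0 = 0]: the truncation of [k] at [r] is then harmless. *)
Definition series_comp (al : nat -> R) u (r : nat) : A :=
  \sum_(k < r.+1) al k *: (trunc r.+1 u ^+ k)`_r.

Lemma series_compE al u N r : u 0%N = 0 -> (r < N)%N ->
  series_comp al u r = \sum_(k < N) al k *: (trunc N u ^+ k)`_r.
Proof.
move=> u0 rN; have t0 M : (trunc M u)`_0 = 0 by rewrite coef_poly u0; case: ifP.
rewrite -(subnKC rN) big_split_ord /= [X in _ = _ + X]big1 ?addr0 => [|k _].
  apply: eq_bigr => k _; congr (_ *: _).
  apply: (agreeX (N := r.+1)) => // s sr; rewrite !coef_poly sr ifT //.
  by rewrite (leq_trans sr) // leq_addr.
by rewrite (coefX_lt (t0 _)) ?scaler0 // ltn_addr.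
Qed.

Section Morphism.
Variable p : {poly A}.

Lemma scalar_comm (a : R) : (a%:A)%:P * p = p * (a%:A)%:P.
Proof.
by apply/polyP => r; rewrite coefCM coefMC mulr_algl mulr_algr.
Qed.

Lemma commr_scalar_poly : commr_rmorph (polyC \o in_alg A) p.
Proof. by move=> a; rewrite /GRing.comm /= scalar_comm. Qed.

(** Substitution of p in real polynomials. Although A is not commutative, real scalars are central,
    so this is a ring morphism. *)
Definition poly_subst : {poly R} -> {poly A} := horner_morph commr_scalar_poly.

Lemma poly_substE (b : {poly R}) N : (size b <= N)%N ->
  poly_subst b = \sum_(k < N) (b`_k)%:A *: p ^+ k.
Proof.
move=> bN; rewrite /poly_subst /horner_morph (@horner_coef_wide _ N); last first.
  by apply: leq_trans (size_poly _ _) _.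
apply: eq_bigr => k _; rewrite coef_map /= mul_polyC //.
Qed.

Lemma poly_substX : poly_subst 'X = p.
Proof. exact: horner_morphX. Qed.

Lemma poly_substM b b' : poly_subst (b * b') = poly_subst b * poly_subst b'.
Proof. exact: rmorphM. Qed.

Lemma poly_substD b b' : poly_subst (b + b') = poly_subst b + poly_subst b'.
Proof. exact: rmorphD. Qed.

Lemma poly_substB b b' : poly_subst (b - b') = poly_subst b - poly_subst b'.
Proof. exact: rmorphB. Qed.

Lemma poly_subst1 : poly_subst 1 = 1.
Proof. exact: rmorph1. Qed.

Lemma poly_substXn b k : poly_subst (b ^+ k) = poly_subst b ^+ k.
Proof. exact: rmorphXn. Qed.

Lemma poly_subst_comm s b : s * p = p * s -> (forall a : R, s * (a%:A)%:P = (a%:A)%:P * s) ->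
  s * poly_subst b = poly_subst b * s.
Proof.
move=> sp sa; rewrite (poly_substE (leqnn _)); apply: commr_sum => k _.
by rewrite -mul_polyC; apply: commrM; [exact: sa|apply: commrX].
Qed.

End Morphism.

Lemma agree_subst N p p' (b : {poly R}) : agree N p p' -> agree N (poly_subst p b) (poly_subst p' b).
Proof.
move=> h r rN; rewrite !(poly_substE _ (leqnn _)) !coef_sum; apply: eq_bigr => k _.
by rewrite !coefZ (agreeX k h).
Qed.

Lemma trunc_comp al u N : u 0%N = 0 ->
  agree N (trunc N (series_comp al u)) (poly_subst (trunc N u) (\poly_(k < N) al k)).
Proof.
move=> u0 r rN; rewrite coef_poly rN (series_compE _ u0 rN) (poly_substE _ (size_poly _ _)) coef_sum.
apply: eq_bigr => k _; rewrite coefZ coef_poly ltn_ord.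
by rewrite -scalerAl mul1r.
Qed.

Lemma agree_eq u v : (forall N, agree N (trunc N u) (trunc N v)) -> u = v.
Proof. by move=> h; apply/funext => r; have := h r.+1 r (ltnSn r); rewrite !coef_poly ltnSn. Qed.

Definition series_sub u v r : A := u r - v r.

Lemma isqrt_series u (z := series_comp (isqrt_coef R) u) : u 0%N = 0 ->
  cauchy_prod (cauchy_prod z z) (series_sub series_one u) = series_one.
Proof.
move=> u0; apply: agree_eq => N.
apply: agree_trans (trunc_cauchy_prod _ _) _.
set y := trunc N u; set b := isqrt_poly R N; have hz := trunc_comp (isqrt_coef R) (N := N) u0.
have [s hs] := isqrt_polyE R N.
apply: (agree_trans (p' := poly_subst y b * poly_subst y b * (1 - y))).
  apply: agreeM.
    by apply: agree_trans (trunc_cauchy_prod _ _) _; apply: agreeM.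
  by rewrite trunc_addN => r rN; rewrite !coefB (trunc_one rN).
have -> : poly_subst y b * poly_subst y b * (1 - y) = 1 + y ^+ N * poly_subst y s.
  have := congr1 (poly_subst y) hs; rewrite expr2.
  by rewrite poly_substM poly_substM poly_substB poly_substD poly_substM poly_substXn poly_subst1 poly_substX.
apply: agree_trans (agree_sym (@trunc_one N)) => r rN.
rewrite coefD coefM big1 ?addr0 // => j _; rewrite coefX_lt ?mul0r //.
  by rewrite coef_poly u0; case: ifP.
by apply: leq_trans rN; rewrite ltnS -ltnS.
Qed.

Lemma geometric_series u (z := series_comp (fun=> 1) u) : u 0%N = 0 ->
  cauchy_prod z (series_sub series_one u) = series_one /\
  cauchy_prod (series_sub series_one u) z = series_one.
Proof.
move=> u0; pose b N : {poly R} := \poly_(k < N) 1.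
have hb N : (1 - 'X) * b N = 1 - 'X^N.
  have -> : b N = \sum_(k < N) 'X^k by rewrite /b poly_def; apply: eq_bigr => k _; rewrite scale1r.
  by rewrite -[1 - 'X^N]opprB subrX1 -mulNr opprB.
have hN N : agree N (trunc N (series_sub series_one u)) (poly_subst (trunc N u) (1 - 'X)).
  rewrite poly_substB poly_subst1 poly_substX trunc_addN => r rN.
  by rewrite !coefB (trunc_one rN).
have hX N : agree N (poly_subst (trunc N u) ((1 - 'X) * b N)) (trunc N series_one).
  rewrite hb poly_substB poly_subst1 poly_substXn poly_substX => r rN.
  by rewrite coefB coefX_lt ?subr0 ?(trunc_one rN) // coef_poly u0; case: ifP.
split; apply: agree_eq => N; apply: agree_trans (trunc_cauchy_prod _ _) _.
  apply: agree_trans (agreeM (trunc_comp _ u0) (hN N)) _.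
  by rewrite -poly_substM mulrC; apply: hX.
apply: agree_trans (agreeM (hN N) (trunc_comp _ u0)) _.
by rewrite -poly_substM; apply: hX.
Qed.

(** The composite is a series in 1 + h^2, so it commutes with h. *)
Lemma comp_square_comm al u h : u 0%N = 0 ->
  (forall r, u r = series_one r + cauchy_prod h h r) ->
  cauchy_prod h (series_comp al u) = cauchy_prod (series_comp al u) h.
Proof.
move=> u0 uE; apply: agree_eq => N; set p := trunc N h; set b : {poly R} := \poly_(k < N) al k.
pose y := 1 + p * p.
have hy : agree N (trunc N u) y.
  move=> r rN; rewrite coef_poly rN uE coefD -(trunc_one rN) -(trunc_cauchy_prod _ _ rN).
  by rewrite !coef_poly rN.
have hz : agree N (trunc N (series_comp al u)) (poly_subst y b).
  by apply: agree_trans (trunc_comp _ u0) _; apply: agree_subst.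
apply: agree_trans (trunc_cauchy_prod _ _) _.
apply: agree_trans (agreeM (fun r _ => erefl _) hz) _; rewrite -/p.
rewrite poly_subst_comm; last 2 first.
- by rewrite /y; nc_ring.
- by move=> a; rewrite scalar_comm.
apply: agree_sym; apply: agree_trans (trunc_cauchy_prod _ _) _.
exact: agreeM.
Qed.

Lemma series_comp0 al u : al 0%N = 1 -> series_comp al u 0%N = 1.
Proof. by move=> a0; rewrite /series_comp big_ord1 a0 scale1r expr0 coef1. Qed.

Lemma cauchy_prod0 u v : cauchy_prod u v 0%N = u 0%N * v 0%N.
Proof. by rewrite /cauchy_prod big_ord1. Qed.

End FormalSeries.

(** * Germs of noncommutative power series, uniform in the algebra *)

Section Germs.
Variables (R : realType) (m n : nat).

Definition letter : Type := ('I_m + 'I_n)%type.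

Definition eval_word (A : convAlgType R) (q : 'I_m -> A) (x : 'I_n -> A) (w : seq letter) : A :=
  \prod_(l <- w) match l with inl i => q i | inr j => x j end.

Definition is_var (l : letter) : bool := if l is inr _ then true else false.

Definition allowed (Pq : pred 'I_m) (Px : pred 'I_n) (l : letter) : bool :=
  match l with inl i => Pq i | inr j => Px j end.

(** Defined on all algebras at once, because the coefficients sought must not depend on the algebra
    or on the Clifford system. *)
Definition natural_fun : Type := forall A : convAlgType R, ('I_m -> A) -> ('I_n -> A) -> A.
Implicit Types (F G : nat -> natural_fun) (f g : natural_fun) (Pq : pred 'I_m) (Px : pred 'I_n).

(** A noncommutative polynomial, homogeneous of degree r in the x_j, with one list of words for all
    algebras. [Pq] and [Px] restrict the letters, in order to keep track of (Fil). *)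
Definition word_sum Pq Px (r : nat) f : Prop :=
  exists L : seq (R * seq letter),
    all (fun p => (count is_var p.2 == r) && all (allowed Pq Px) p.2) L /\
    forall (A : convAlgType R) q x, f A q x = \sum_(p <- L) p.1 *: eval_word q x p.2.

Section WordSums.
Variables (Pq : pred 'I_m) (Px : pred 'I_n).

Lemma word_sum0 r : word_sum Pq Px r (fun A _ _ => 0).
Proof. by exists [::]; split=> // A q x; rewrite big_nil. Qed.

Lemma word_sumD r f g : word_sum Pq Px r f -> word_sum Pq Px r g ->
  word_sum Pq Px r (fun A q x => f A q x + g A q x).
Proof.
move=> [L [hL fL]] [M [hM gM]]; exists (L ++ M); rewrite all_cat hL hM; split=> // A q x.
by rewrite big_cat fL gM.
Qed.

Lemma word_sumZ r (a : R) f : word_sum Pq Px r f -> word_sum Pq Px r (fun A q x => a *: f A q x).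
Proof.
move=> [L [hL fL]]; exists [seq (a * p.1, p.2) | p <- L]; split; first by rewrite all_map.
by move=> A q x; rewrite fL big_map scaler_sumr; apply: eq_bigr => p _; rewrite scalerA.
Qed.

Lemma word_sumM r s f g : word_sum Pq Px r f -> word_sum Pq Px s g ->
  word_sum Pq Px (r + s) (fun A q x => f A q x * g A q x).
Proof.
move=> [L [hL fL]] [M [hM gM]].
exists (flatten [seq [seq (p.1 * p'.1, p.2 ++ p'.2) | p' <- M] | p <- L]); split.
  apply/allP => _ /flattenP[_ /mapP[p pL ->] /mapP[p' p'M ->]] /=.
  have /andP[/eqP h1 h2] := allP hL _ pL; have /andP[/eqP h3 h4] := allP hM _ p'M.
  by rewrite count_cat h1 h3 eqxx all_cat h2 h4.
move=> A q x; rewrite big_flatten big_map fL gM mulr_suml; apply: eq_bigr => p _.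
rewrite big_map mulr_sumr; apply: eq_bigr => p' _.
by rewrite /eval_word big_cat -scalerAl -scalerAr scalerA.
Qed.

Lemma word_sum_ext r f g : (forall A q x, f A q x = g A q x) -> word_sum Pq Px r f ->
  word_sum Pq Px r g.
Proof. by move=> e [L [hL fL]]; exists L; split=> // A q x; rewrite -e. Qed.

Lemma word_sum_sum r k (f : 'I_k -> natural_fun) : (forall i, word_sum Pq Px r (f i)) ->
  word_sum Pq Px r (fun A q x => \sum_i f i A q x).
Proof.
elim: k f => [|k IH] f h.
  by apply: word_sum_ext (word_sum0 r) => A q x; rewrite big_ord0.
apply: word_sum_ext (word_sumD (h ord0) (IH (fun i => f (lift ord0 i)) _)) => // A q x.
by rewrite big_ord_recl.
Qed.

Lemma word_sum1 : word_sum Pq Px 0 (fun A _ _ => 1).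
Proof.
exists [:: (1, [::])]; split=> // A q x.
by rewrite big_seq1 /eval_word big_nil scale1r.
Qed.

Lemma word_sum_gen i : Pq i -> word_sum Pq Px 0 (fun A q _ => q i).
Proof.
move=> Pi; exists [:: (1, [:: inl i])]; split; first by rewrite /= Pi.
by move=> A q x; rewrite big_seq1 /eval_word big_seq1 scale1r.
Qed.

Lemma word_sum_var j : Px j -> word_sum Pq Px 1 (fun A _ x => x j).
Proof.
move=> Pj; exists [:: (1, [:: inr j])]; split; first by rewrite /= Pj.
by move=> A q x; rewrite big_seq1 /eval_word big_seq1 scale1r.
Qed.

Lemma word_sum_prod F G r : (forall r, word_sum Pq Px r (F r)) -> (forall r, word_sum Pq Px r (G r)) ->
  word_sum Pq Px r (fun A q x => cauchy_prod (fun s => F s A q x) (fun s => G s A q x) r).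
Proof.
move=> hF hG; apply: word_sum_sum => s.
have sr : (s <= r)%N by rewrite -ltnS.
by have := word_sumM (hF s) (hG (r - s)%N); rewrite subnKC.
Qed.

Lemma word_sum_pow F k N r : (forall r, word_sum Pq Px r (F r)) -> (r < N)%N ->
  word_sum Pq Px r (fun A q x => (trunc N (fun s => F s A q x) ^+ k)`_r).
Proof.
move=> hF; elim: k r => [|k IH] r rN.
  case: r rN => [|r] rN; last by apply: word_sum_ext (word_sum0 _) => A q x; rewrite expr0 coef1.
  by apply: word_sum_ext word_sum1 => A q x; rewrite expr0 coef1.
have h (s : 'I_r.+1) : word_sum Pq Px r (fun A q x => F s A q x * (trunc N (fun s => F s A q x) ^+ k)`_(r - s)).
  have sr : (s <= r)%N by rewrite -ltnS.
  by have := word_sumM (hF s) (IH (r - s)%N (leq_ltn_trans (leq_subr _ _) rN)); rewrite subnKC.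
apply: word_sum_ext (word_sum_sum h) => A q x; rewrite exprS coefM; apply: eq_bigr => s _.
by rewrite coef_poly (leq_trans (ltn_ord s) rN).
Qed.

Lemma word_sum_comp al F r : (forall r, word_sum Pq Px r (F r)) ->
  word_sum Pq Px r (fun A q x => series_comp al (fun s => F s A q x) r).
Proof. by move=> hF; apply: word_sum_sum => k; apply/word_sumZ/word_sum_pow. Qed.

End WordSums.

(** [kappa] also bounds nu 1, since the seminorms are not normalized. *)
Definition tame (A : convAlgType R) (nu : A -> R) (kappa e : R) (q : 'I_m -> A) (x : 'I_n -> A) :=
  [/\ seminorm nu, forall x y, nu (x * y) <= nu x * nu y, nu 1 <= kappa,
      forall i, nu (q i) <= kappa & forall j, nu (x j) <= e].

(** C and D are chosen before the algebra and the norm, so that one radius of convergence serves all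
    quotients A/A^(i). *)
Definition bounded F : Prop := forall kappa : R, 0 <= kappa -> exists C D, [/\ 0 <= C, 0 <= D &
  forall (A : convAlgType R) (nu : A -> R) e q x, 0 <= e -> tame nu kappa e q x ->
    forall r, nu (F r A q x) <= C * (D * e) ^+ r].

Lemma bounded_prod F G : bounded F -> bounded G ->
  bounded (fun r A q x => cauchy_prod (fun s => F s A q x) (fun s => G s A q x) r).
Proof.
move=> hF hG k k0; have [C [D [C0 D0 h]]] := hF k k0; have [C' [D' [C0' D0' h']]] := hG k k0.
(* The factor 2 pays for the r + 1 <= 2^r terms of the Cauchy product. *)
exists (C * C'), (2 * (D + D')); split; rewrite ?mulr_ge0 ?addr_ge0 // => A nu e q x e0 ht r.
have [hs hm _ _ _] := ht; have n0 y : 0 <= nu y by apply: seminorm_ge0.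
apply: le_trans (seminorm_sum hs _ _ _) _.
apply: (@le_trans _ _ (\sum_(s < r.+1) C * C' * ((D + D') * e) ^+ r)).
  apply: ler_sum => s _; apply: le_trans (hm _ _) _.
  have sr : (s <= r)%N by rewrite -ltnS.
  apply: (@le_trans _ _ (C * ((D + D') * e) ^+ s * (C' * ((D + D') * e) ^+ (r - s)))); last first.
    by rewrite -[in leRHS](subnKC sr) exprD mulrACA.
  have De : D * e <= (D + D') * e by rewrite ler_wpM2r ?lerDl.
  have De' : D' * e <= (D + D') * e by rewrite ler_wpM2r ?lerDr.
  apply: ler_pM => //.
    by apply: le_trans (h A nu e q x e0 ht s) _; rewrite ler_wpM2l // lerXn2r // nnegrE ?mulr_ge0 ?addr_ge0.
  by apply: le_trans (h' A nu e q x e0 ht _) _; rewrite ler_wpM2l // lerXn2r // nnegrE ?mulr_ge0 ?addr_ge0.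
rewrite sumr_const card_ord -mulrnAr ler_wpM2l ?mulr_ge0 // -[2 * _ * e]mulrA [leRHS]exprMn.
rewrite -[_ *+ r.+1]mulr_natl ler_wpM2r ?exprn_ge0 ?mulr_ge0 ?addr_ge0 //.
by rewrite -natrX ler_nat ltn_expl.
Qed.

Lemma bounded_add F G : bounded F -> bounded G -> bounded (fun r A q x => F r A q x + G r A q x).
Proof.
move=> hF hG k k0; have [C [D [C0 D0 h]]] := hF k k0; have [C' [D' [C0' D0' h']]] := hG k k0.
exists (C + C'), (D + D'); split; rewrite ?addr_ge0 // => A nu e q x e0 ht r.
have [hs _ _ _ _] := ht; apply: le_trans (proj1 hs _ _) _; rewrite mulrDl.
have De : D * e <= (D + D') * e by rewrite ler_wpM2r ?lerDl.
have De' : D' * e <= (D + D') * e by rewrite ler_wpM2r ?lerDr.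
apply: lerD.
  by apply: le_trans (h A nu e q x e0 ht r) _; rewrite ler_wpM2l // lerXn2r // nnegrE ?mulr_ge0 ?addr_ge0.
by apply: le_trans (h' A nu e q x e0 ht r) _; rewrite ler_wpM2l // lerXn2r // nnegrE ?mulr_ge0 ?addr_ge0.
Qed.

Lemma bounded_scale (a : R) F : bounded F -> bounded (fun r A q x => a *: F r A q x).
Proof.
move=> hF k k0; have [C [D [C0 D0 h]]] := hF k k0.
exists (`|a| * C), D; split; rewrite ?mulr_ge0 // => A nu e q x e0 ht r.
have [[_ hZ] _ _ _ _] := ht; rewrite hZ -mulrA ler_wpM2l //; exact: h.
Qed.

(** Convolution with the majorant C a^s, s >= 1, does not increase the geometric sequence of ratio
    (1 + C) a. Thus the coefficients of the powers of a series get a bound independent of the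
    exponent. *)
Lemma majorant_sum (C a : R) r : 0 <= C -> 0 <= a ->
  \sum_(s < r) C * a ^+ s.+1 * ((1 + C) * a) ^+ (r - s.+1) <= ((1 + C) * a) ^+ r.
Proof.
move=> C0 a0; elim: r => [|r IH]; first by rewrite big_ord0 expr0.
rewrite big_ord_recl /= subSS subn0 expr1.
have -> : \sum_(i < r) C * a ^+ (bump 0 i).+1 * ((1 + C) * a) ^+ (r.+1 - (bump 0 i).+1) =
    a * \sum_(s < r) C * a ^+ s.+1 * ((1 + C) * a) ^+ (r - s.+1).
  rewrite mulr_sumr; apply: eq_bigr => s _; rewrite /bump /= add1n subSS.
  by rewrite [a ^+ s.+2]exprS; ring.
have := ler_wpM2l a0 IH; rewrite [((1 + C) * a) ^+ r.+1]exprS; lra.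
Qed.

Lemma bounded_comp (al : nat -> R) F : (forall k, 0 <= al k <= 1) ->
  (forall A q x, F 0%N A q x = 0) -> bounded F ->
  bounded (fun r A q x => series_comp al (fun s => F s A q x) r).
Proof.
move=> hal F0 hF k k0; have [C [D [C0 D0 h]]] := hF k k0.
exists k, (2 * ((1 + C) * D)); split; rewrite ?mulr_ge0 ?addr_ge0 // => A nu e q x e0 ht.
have [hs hm n1 _ _] := ht; have n0 y : 0 <= nu y by apply: seminorm_ge0.
set u := fun s => F s A q x; pose b := (1 + C) * (D * e).
have De : 0 <= D * e by rewrite mulr_ge0.
have b0 : 0 <= b by rewrite mulr_ge0 // addr_ge0.
have hpow N l r : (r < N)%N -> nu (trunc N u ^+ l)`_r <= k * b ^+ r.
  elim: l r => [|l IH] r rN.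
    rewrite expr0 coef1; case: r rN => [|r] _; first by rewrite expr0 mulr1.
    by rewrite (seminorm0 hs) mulr_ge0 // exprn_ge0.
  rewrite exprS coefM big_ord_recl coef_poly /= {1}/u F0 if_same mul0r add0r.
  apply: le_trans (seminorm_sum hs _ _ _) _.
  apply: (@le_trans _ _ (k * \sum_(s < r) C * (D * e) ^+ s.+1 * b ^+ (r - s.+1))); last first.
    by apply: ler_wpM2l => //; apply: majorant_sum.
  rewrite mulr_sumr; apply: ler_sum => s _; rewrite /bump /= add1n.
  apply: le_trans (hm _ _) _; rewrite mulrCA; apply: ler_pM => //.
    by rewrite coef_poly ifT ?h // (leq_trans _ rN) // ltnS.
  by apply: IH; apply: leq_ltn_trans rN; apply: leq_subr.
move=> r; apply: le_trans (seminorm_sum hs _ _ _) _.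
apply: (@le_trans _ _ (\sum_(l < r.+1) k * b ^+ r)).
  apply: ler_sum => l _; rewrite (proj2 hs); have /andP[a0 a1] := hal l.
  rewrite ger0_norm //; apply: le_trans (ler_wpM2r (n0 _) a1) _.
  by rewrite mul1r; apply: hpow.
rewrite sumr_const card_ord -mulrnAr ler_wpM2l //.
have -> : 2 * ((1 + C) * D) * e = 2 * b by rewrite /b; ring.
by rewrite [leRHS]exprMn -[_ *+ r.+1]mulr_natl ler_wpM2r ?exprn_ge0 // -natrX ler_nat ltn_expl.
Qed.

Definition near (kappa e : R) (A : convAlgType R) (q : 'I_m -> A) (x : 'I_n -> A) : Prop :=
  clifford_system q /\ forall i, exists2 nu, snorm i nu & tame nu kappa e q x.

Definition locally (P : forall A : convAlgType R, ('I_m -> A) -> ('I_n -> A) -> Prop) : Prop :=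
  forall kappa, 0 <= kappa -> exists2 e, 0 < e & forall (A : convAlgType R) q x, near kappa e q x -> P A q x.

Lemma tame_le (A : convAlgType R) (nu : A -> R) k e e' q x : e <= e' -> tame nu k e q x -> tame nu k e' q x.
Proof. by move=> ee [h1 h2 h3 h4 h5]; split=> // j; apply: le_trans ee. Qed.

Lemma near_le (A : convAlgType R) k e e' (q : 'I_m -> A) x : e <= e' -> near k e q x -> near k e' q x.
Proof.
move=> ee [hq h]; split=> // i; have [nu h1 h2] := h i.
by exists nu => //; apply: tame_le h2.
Qed.

Lemma locally_and P P' : locally P -> locally P' -> locally (fun A q x => P A q x /\ P' A q x).
Proof.
move=> h h' k k0; have [e e0 he] := h k k0; have [e' e0' he'] := h' k k0.
exists (Num.min e e'); first by rewrite lt_min e0.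
move=> A q x hn; split; [apply: he|apply: he']; apply: near_le hn; by rewrite ge_min lexx ?orbT.
Qed.

Lemma locally_imp (P P' : forall A : convAlgType R, ('I_m -> A) -> ('I_n -> A) -> Prop) :
  (forall A q x, clifford_system q -> P A q x -> P' A q x) -> locally P -> locally P'.
Proof.
move=> h hP k k0; have [e e0 he] := hP k k0; exists e => // A q x hn.
by apply: h; [case: hn|apply: he].
Qed.

Lemma locally_forall (I : finType) (P : I -> forall A : convAlgType R, ('I_m -> A) -> ('I_n -> A) -> Prop) :
  (forall i, locally (P i)) -> locally (fun A q x => forall i, P i A q x).
Proof.
move=> h; suff hs (s : seq I) : locally (fun A q x => forall i, i \in s -> P i A q x).
  by apply: locally_imp (hs (enum I)) => A q x _ hp i; apply: hp; rewrite mem_enum.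
elim: s => [|i s IH]; first by move=> k k0; exists 1.
apply: locally_imp (locally_and (h i) IH) => A q x _ [h1 h2] l; rewrite inE => /predU1P[->|] //.
exact: h2.
Qed.

Lemma bounded_geo F : bounded F -> locally (fun A q x =>
  forall i, exists2 nu, snorm i nu & geo nu (fun r => F r A q x)).
Proof.
move=> hF k k0; have [C [D [C0 D0 h]]] := hF k k0.
have D1 : 0 < 4 * (D + 1) by rewrite mulr_gt0 // ltr_wpDl.
exists (4 * (D + 1))^-1; first by rewrite invr_gt0.
move=> A q x [hq hn] i; have [nu hnu ht] := hn i; exists nu => //; exists C => // r.
have e0 : 0 <= (4 * (D + 1))^-1 by rewrite invr_ge0 ltW.
apply: le_trans (h A nu _ q x e0 ht r) _; apply: ler_wpM2l => //.
have De : D * (4 * (D + 1))^-1 <= 4^-1.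
  rewrite ler_pdivrMr // mulrA mulVf ?mul1r ?lerDl // pnatr_eq0 //.
have p0 : 0 <= D * (4 * (D + 1))^-1 by apply: mulr_ge0.
by apply: lerXn2r; rewrite ?nnegrE ?p0 // invr_ge0.
Qed.

(** F is the formal expansion and f the function to which it sums near R = 0. They are kept apart
    because f is often given by other means, such as [pol], and is unconstrained away from 0. *)
Definition germ Pq Px F f : Prop := [/\ forall r, word_sum Pq Px r (F r), bounded F &
  locally (fun A q x => tends (fun N => \sum_(r < N) F r A q x) (f A q x))].

(** The distance of f to its constant term is small in the tame norm itself, which is the form that
    [polar_near] consumes. *)
Lemma germ_close Pq Px F f : germ Pq Px F f -> forall kappa, 0 <= kappa -> forall d, 0 < d ->
  exists2 e, 0 < e & forall (A : convAlgType R) q x, near kappa e q x -> forall i (nu : A -> R), snorm i nu ->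
    tame nu kappa e q x -> nu (f A q x - F 0%N A q x) <= d.
Proof.
move=> [_ hF hf] k k0 d d0; have [C [D [C0 D0 h]]] := hF k k0; have [e1 e10 h1] := hf k k0.
have D1 : 0 < 4 * (D + 1) by rewrite mulr_gt0 // ltr_wpDl.
pose X := C * (D * 8) + 1; have X0 : 0 < X by rewrite ltr_wpDl // !mulr_ge0.
pose e := Num.min e1 (Num.min (4 * (D + 1))^-1 (d / X)).
have e0 : 0 < e by rewrite !lt_min e10 invr_gt0 D1 divr_gt0.
exists e => // A q x hn i nu hnu ht; have [hs _ _ _] := hnu.
have [ea eb ec] : [/\ e <= e1, e <= (4 * (D + 1))^-1 & e <= d / X].
  by rewrite /e; split; rewrite !ge_min lexx ?orbT.
have tf := h1 A q x (near_le ea hn).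
have De0 : 0 <= D * e by rewrite mulr_ge0 // ltW.
have De : D * e <= 4^-1.
  have h4 : e * (4 * (D + 1)) <= 1 by rewrite -ler_pdivlMr // div1r.
  have := ltW e0; lra.
have tg : tends (fun N => \sum_(r < N.+1) F r A q x + - F 0%N A q x) (f A q x - F 0%N A q x).
  apply: tendsD; last exact: (tends_eventually (N0 := 0%N)).
  by move=> j mu hmu; have := small_seq_shift 1 (tf j mu hmu); apply: small_seq_le => N; rewrite addn1.
apply: (tends_snorm_le hnu tg) => N.
rewrite big_ord_recl addrAC subrr add0r; apply: le_trans (seminorm_sum hs _ _ _) _.
apply: (@le_trans _ _ (\sum_(r < N) C * (D * e) * (4^-1) ^+ r)).
  apply: ler_sum => r _; apply: le_trans (h A nu e q x (ltW e0) ht _) _.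
  rewrite lift0 exprS -[leRHS]mulrA; apply: ler_wpM2l => //; apply: ler_wpM2l => //.
  by rewrite lerXn2r // nnegrE ?invr_ge0.
rewrite -mulr_sumr; apply: (@le_trans _ _ (C * (D * e) * 2)).
  by apply: ler_wpM2l (sum_geo4 _ _); rewrite mulr_ge0.
have : e * X <= d by rewrite -ler_pdivlMr.
rewrite /X; have : 0 <= C * (D * e) by rewrite mulr_ge0.
have -> : e * (C * (D * 8) + 1) = 8 * (C * (D * e)) + e by ring.
have := ltW e0; lra.
Qed.

Lemma germ_ext Pq Px F f g : germ Pq Px F f -> locally (fun A q x => f A q x = g A q x) -> germ Pq Px F g.
Proof.
move=> [h1 h2 h3] h; split=> //.
by apply: locally_imp (locally_and h h3) => A q x _ [->].
Qed.

Lemma germ_mono (Pq Pq' : pred 'I_m) (Px Px' : pred 'I_n) F f : (forall i, Pq i -> Pq' i) ->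
  (forall j, Px j -> Px' j) -> germ Pq Px F f -> germ Pq' Px' F f.
Proof.
move=> h h' [h1 h2 h3]; split=> // r; have [L [hL e]] := h1 r; exists L; split=> //.
apply: sub_all hL => p /andP[-> /=]; apply: sub_all => -[i|j] /=; [exact: h|exact: h'].
Qed.

Section GermAlgebra.
Variables (Pq : pred 'I_m) (Px : pred 'I_n).

Lemma germD F G f g : germ Pq Px F f -> germ Pq Px G g ->
  germ Pq Px (fun r A q x => F r A q x + G r A q x) (fun A q x => f A q x + g A q x).
Proof.
move=> [f1 f2 f3] [g1 g2 g3]; split; first by move=> r; apply: word_sumD.
  exact: bounded_add.
apply: locally_imp (locally_and f3 g3) => A q x _ [h1 h2] i nu hnu.
apply: small_seq_le (tendsD h1 h2 hnu) => N.
by rewrite big_split.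
Qed.

Lemma germZ (a : R) F f : germ Pq Px F f ->
  germ Pq Px (fun r A q x => a *: F r A q x) (fun A q x => a *: f A q x).
Proof.
move=> [f1 f2 f3]; split; first by move=> r; apply: word_sumZ.
  exact: bounded_scale.
apply: locally_imp f3 => A q x _ h1 i nu hnu.
apply: small_seq_le (tendsZ a h1 hnu) => N.
by rewrite scaler_sumr.
Qed.

Lemma germM F G f g : germ Pq Px F f -> germ Pq Px G g ->
  germ Pq Px (fun r A q x => cauchy_prod (fun s => F s A q x) (fun s => G s A q x) r)
    (fun A q x => f A q x * g A q x).
Proof.
move=> [f1 f2 f3] [g1 g2 g3]; split; first by move=> r; apply: word_sum_prod.
  exact: bounded_prod.
have h := locally_and (locally_and f3 g3) (locally_and (bounded_geo f2) (bounded_geo g2)).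
apply: locally_imp h => A q x _ [[h1 h2] [h3 h4]].
exact: tends_cauchy_prod.
Qed.

Lemma germ_const (f : natural_fun) : word_sum Pq Px 0 f ->
  (forall k, 0 <= k -> exists2 C, 0 <= C & forall (A : convAlgType R) (nu : A -> R) e q x, tame nu k e q x -> nu (f A q x) <= C) ->
  germ Pq Px (fun r A q x => if r is 0%N then f A q x else 0) f.
Proof.
move=> h hb; split.
- by case=> [|r]; [exact: h|exact: word_sum0].
- move=> k k0; have [C C0 hC] := hb k k0; exists C, 0; split=> // A nu e q x e0 ht r.
  case: r => [|r]; first by rewrite expr0 mulr1; apply: hC ht.
  by rewrite mul0r exprS mul0r mulr0 (seminorm0 (p := nu)) //; case: ht.
move=> k k0; exists 1 => // A q x _; apply: (tends_eventually (N0 := 1%N)) => N N1.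
by case: N N1 => // N _; rewrite big_ord_recl big1 ?addr0.
Qed.

Lemma germ1 : germ Pq Px (fun r A q x => series_one A r) (fun A q x => 1).
Proof.
have [|h1 h2 h3] := germ_const (word_sum1 Pq Px).
  by move=> k k0; exists k => // A nu e q x [].
have e r (A : convAlgType R) (q : 'I_m -> A) (x : 'I_n -> A) :
    (if r is 0%N then 1 else 0) = series_one A r by case: r.
split.
- by move=> r; apply: word_sum_ext (h1 r) => A q x; apply: e.
- move=> k k0; have [C [D [C0 D0 h]]] := h2 k k0; exists C, D; split=> // A nu e' q x e0 ht r.
  by rewrite -(e r A q x); apply: (h A nu e' q x e0 ht r).
- apply: locally_imp h3 => A q x _ h i nu hnu; apply: small_seq_le (h i nu hnu) => N.
  by under eq_bigr do rewrite -(e _ A q x).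
Qed.

Lemma germ_gen i : Pq i -> germ Pq Px (fun r A q x => if r is 0%N then q i else 0) (fun A q x => q i).
Proof.
move=> Pi; apply: germ_const; first exact: word_sum_gen.
by move=> k k0; exists k => // A nu e q x [].
Qed.

Lemma germ_var j : Px j -> germ Pq Px (fun r A q x => if r is 1%N then x j else 0) (fun A q x => x j).
Proof.
move=> Pj; split.
- by case=> [|[|r]]; [exact: word_sum0|exact: word_sum_var|exact: word_sum0].
- move=> k k0; exists 1, 1; split=> // A nu e q x e0 [hs _ _ _ hx] r.
  rewrite !mul1r; case: r => [|[|r]]; first by rewrite (seminorm0 hs).
    by rewrite expr1.
  by rewrite (seminorm0 hs) exprn_ge0.
move=> k k0; exists 1 => // A q x _; apply: (tends_eventually (N0 := 2%N)) => N N1.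
by case: N N1 => // -[//|N] _; rewrite !big_ord_recl big1 ?addr0 ?add0r.
Qed.

Lemma germ_lim F : (forall r, word_sum Pq Px r (F r)) -> bounded F -> exists f, germ Pq Px F f.
Proof.
move=> h hb; exists (fun A q x => xget 0 [set l | tends (fun N => \sum_(r < N) F r A q x) l]).
split=> //; apply: locally_imp (bounded_geo hb) => A q x _ hg.
have [l hl] := series_complete hg.
by apply: (xgetPex 0 (P := [set l | tends (fun N => \sum_(r < N) F r A q x) l])); exists l.
Qed.

(** Turns formal identities, such as [isqrt_series], into identities between values. *)
Lemma germ_uniq F G f g : germ Pq Px F f -> germ Pq Px G g ->
  (forall (A : convAlgType R) (q : 'I_m -> A) (x : 'I_n -> A), clifford_system q -> forall r, F r A q x = G r A q x) ->
  locally (fun A q x => f A q x = g A q x).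
Proof.
move=> [_ _ f3] [_ _ g3] e; apply: locally_imp (locally_and f3 g3) => A q x hq [h1 h2].
apply: tends_uniq h1 _ => i nu hnu; apply: small_seq_le (h2 i nu hnu) => N.
by rewrite (eq_bigr (fun r : 'I_N => G r A q x)) // => r _; apply: e.
Qed.

End GermAlgebra.

End Germs.

Section PolarNear.
Variables (R : realType) (A : convAlgType R).

(** With w = x + (1 + y) q, the element H + x + y B is w (1 + w^-1 E), where E has norm at most (1 +
    y) d and w^-1 at most 2 k / (1 + y). The growth in y cancels, and the perturbation is small for
    all x and y at once. *)
Lemma polar_near (nu : A -> R) (k d : R) (q H B : A) : snorm 1 nu -> q * q = -1 ->
  0 <= k -> nu q <= k -> nu 1 <= k -> 8 * (k * d) <= 1 -> nu (H - q) <= d -> nu (B - q) <= d ->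
  B * B = -1 -> B * H = H * B -> polar H B.
Proof.
move=> hnu qq k0 hq h1 kd hH hB BB BH; have [hs hm _ _] := hnu.
have n0 x : 0 <= nu x by apply: seminorm_ge0.
split=> // x y y0; pose z := (x +i* (1 + y))%C.
have z0 : z != 0 by rewrite eq_complex /= negb_and [1 + y == 0]gt_eqF ?orbT // ltr_wpDr.
have uz := cplx_unit qq z0; set w := cplx q z in uz.
pose E := (H - q) + y *: (B - q).
have -> : H + x%:A + y *: B = w * (1 - - (cplx q z^-1 * E)).
  rewrite opprK mulrDr mulr1 mulrA -cplxM // mulfV // cplx1 mul1r.
  rewrite /w /E /cplx /= scalerDl scale1r scalerBr.
  by set u := x%:A; set v := y *: q; set v' := y *: B; nc_ring.
rewrite unitrMl //; apply: (unit_1sub_small hnu); rewrite (seminormN hs).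
set N := x ^+ 2 + (1 + y) ^+ 2; have y1 : 0 < 1 + y by rewrite ltr_wpDr.
have N0 : 0 < N by rewrite ltr_wpDl ?sqr_ge0 // exprn_gt0.
have hE : nu E <= (1 + y) * d.
  apply: le_trans (proj1 hs _ _) _; rewrite (proj2 hs) ger0_norm // mulrDl mul1r.
  by apply: lerD => //; apply: ler_wpM2l.
have zV : z^-1 = ((x / N) +i* (- ((1 + y) / N)))%C by [].
have hx : `|x / N| <= (1 + y)^-1.
  rewrite normrM normfV [`|N|]gtr0_norm // ler_pdivrMr // mulrC ler_pdivlMr //.
  have := sqr_ge0 (`|x| - (1 + y)); rewrite sqrrB real_normK ?num_real // -/N.
  rewrite /N; have := mulr_ge0 (normr_ge0 x) (ltW y1); lra.
have hy : `|- ((1 + y) / N)| <= (1 + y)^-1.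
  rewrite normrN normrM normfV !gtr0_norm // ler_pdivrMr // mulrC ler_pdivlMr // -expr2.
  by rewrite lerDr sqr_ge0.
have hz : nu (cplx q z^-1) <= (1 + y)^-1 * (2 * k).
  rewrite zV /cplx /=; apply: le_trans (proj1 hs _ _) _; rewrite !(proj2 hs).
  have := ler_pM (normr_ge0 _) (n0 1) hx h1; have := ler_pM (normr_ge0 _) (n0 q) hy hq.
  lra.
apply: le_trans (hm _ _) _; apply: le_trans (ler_pM (n0 _) (n0 _) hz hE) _.
have -> : (1 + y)^-1 * (2 * k) * ((1 + y) * d) = 2 * (k * d) by field; rewrite gt_eqF.
lra.
Qed.

End PolarNear.

Section PolarGerms.
Variables (R : realType) (m n : nat).
Notation natural_fun := (natural_fun R m n).
Implicit Types (F G H X : nat -> natural_fun) (f g h : natural_fun) (Pq : pred 'I_m) (Px : pred 'I_n).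

Definition const_gen (k : 'I_m) f : Prop :=
  forall (A : convAlgType R) (q : 'I_m -> A) (x : 'I_n -> A), clifford_system q -> f A q x = q k.

Lemma germ_series_eq Pq Px F G f : germ Pq Px F f ->
  (forall r, word_sum Pq Px r (G r)) -> bounded G ->
  (forall (A : convAlgType R) (q : 'I_m -> A) (x : 'I_n -> A), clifford_system q ->
    forall r, F r A q x = G r A q x) -> germ Pq Px G f.
Proof.
move=> [_ _ hf] hG bG e; split=> //; apply: locally_imp hf => A q x hq h i nu hnu.
apply: small_seq_le (h i nu hnu) => N.
by rewrite (eq_bigr (fun r : 'I_N => F r A q x)) // => r _; rewrite e.
Qed.

(** Composition of series asks for a zero constant term at all q, whereas that of 1 + h^2 vanishes
    by the Clifford relations; overwriting it changes nothing on Clifford systems. *)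
Definition series_drop0 F : nat -> natural_fun := fun r => if r is 0%N then fun A _ _ => 0 else F r.

Lemma word_sum_drop0 Pq Px F r : (forall r, word_sum Pq Px r (F r)) ->
  word_sum Pq Px r (series_drop0 F r).
Proof. by move=> h; case: r => [|r]; [exact: word_sum0|exact: h]. Qed.

Lemma bounded_drop0 F : bounded F -> bounded (series_drop0 F).
Proof.
move=> h k k0; have [C [D [C0 D0 hC]]] := h k k0; exists C, D; split=> // A nu e q x e0 ht [|r].
  by rewrite (seminorm0 (p := nu)) ?mulr_ge0 ?exprn_ge0 ?mulr_ge0 //; case: ht.
exact: hC ht _.
Qed.

Lemma germ_drop0 Pq Px F f : germ Pq Px F f ->
  (forall (A : convAlgType R) (q : 'I_m -> A) (x : 'I_n -> A), clifford_system q -> F 0%N A q x = 0) ->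
  germ Pq Px (series_drop0 F) f.
Proof.
move=> hF F0; have [h1 h2 _] := hF; apply: (germ_series_eq hF).
- by move=> r; apply: word_sum_drop0.
- exact: bounded_drop0.
by move=> A q x hq [|r] //; apply: F0.
Qed.

Lemma germ_pol Pq Px H h k : germ Pq Px H h -> const_gen k (H 0%N) ->
  exists B, [/\ germ Pq Px B (fun A q x => pol (h A q x)), const_gen k (B 0%N) &
    locally (fun A q x => pol_dom (h A q x))].
Proof.
move=> gH H0; have gHH := germM gH gH.
set HH := (fun r A q x => cauchy_prod _ _ r) in gHH.
have gY0 := germD (germ1 R Pq Px) gHH.
set Y0 := (fun r A q x => series_one A r + _) in gY0.
have Y00 (A : convAlgType R) (q : 'I_m -> A) (x : 'I_n -> A) : clifford_system q -> Y0 0%N A q x = 0.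
  move=> hq; rewrite /Y0 /HH cauchy_prod0 /series_one (H0 A q x hq).
  by move/clifford_systemP: hq => [-> _]; rewrite subrr.
have gY := germ_drop0 gY0 Y00; set Y := series_drop0 Y0 in gY.
have [y1 y2 _] := gY.
have hal l : 0 <= isqrt_coef R l <= 1 by rewrite isqrt_coef_ge0 isqrt_coef_le1.
pose Z : nat -> natural_fun := fun r A q x => series_comp (isqrt_coef R) (fun s => Y s A q x) r.
have [||fz gZ] := @germ_lim R m n Pq Px Z.
- by move=> r; apply: word_sum_comp.
- exact: bounded_comp.
have gD := germD (germ1 R Pq Px) (germZ (-1) gY).
have gZZD := germM (germM gZ gZ) gD.
(* With z for [fz], this is z^2 (- h^2) = 1. Together with the commutation of z and h proved next,
   it gives h z the square -1, and [polar_near] identifies h z as the polarization. *)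
have l1 : locally (fun A q x => fz A q x * fz A q x * (1 + -1 *: (1 + h A q x * h A q x)) = 1).
  apply: (germ_uniq gZZD (germ1 R Pq Px)) => A q x hq r.
  under [X in cauchy_prod _ X]eq_fun do rewrite scaleN1r.
  exact: (congr1 (@^~ r) (isqrt_series (erefl (Y 0%N A q x)))).
have gB := germM gH gZ; have gB' := germM gZ gH.
have l2 : locally (fun A q x => h A q x * fz A q x = fz A q x * h A q x).
  apply: (germ_uniq gB gB') => A q x hq r; rewrite /Z comp_square_comm // => -[|s] //.
  by have := Y00 A q x hq; rewrite /Y0 /HH => ->.
set B := (fun r A q x => cauchy_prod _ _ r) in gB.
have B0 : const_gen k (B 0%N).
  move=> A q x hq; rewrite /B cauchy_prod0 (H0 A q x hq) /Z series_comp0 ?mulr1 //.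
  by rewrite /isqrt_coef big_ord0.
have lp : locally (fun A q x => polar (h A q x) (h A q x * fz A q x)).
  move=> kap kap0; have d0 : 0 < (8 * (kap + 1))^-1 by rewrite invr_gt0 mulr_gt0 // ltr_wpDl.
  have [e1 e10 h1] := germ_close gH kap0 d0; have [e2 e20 h2] := germ_close gB kap0 d0.
  have [e3 e30 h3] := locally_and l1 l2 kap0.
  exists (Num.min e1 (Num.min e2 e3)); first by rewrite !lt_min e10 e20.
  move=> A q x hn; have [hq hn'] := hn; have [nu hnu ht] := hn' 1%N.
  set e := Num.min _ _ in hn ht.
  have [ea eb ec] : [/\ e <= e1, e <= e2 & e <= e3].
    by rewrite /e; split; rewrite !ge_min lexx ?orbT.
  have [f1 f2] := h3 A q x (near_le ec hn).
  have c1 := h1 A q x (near_le ea hn) _ nu hnu (tame_le ea ht).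
  have c2 := h2 A q x (near_le eb hn) _ nu hnu (tame_le eb ht).
  rewrite (H0 A q x hq) in c1; rewrite (B0 A q x hq) in c2.
  have [_ _ n1 nq _] := ht; have /clifford_systemP[qq _] := hq.
  set a := h A q x in f1 f2 c1 c2 *; set z := fz A q x in f1 f2 c2 *.
  have zz : z * z * (a * a) = -1.
    have -> : z * z * (a * a) = - (z * z * (1 + -1 *: (1 + a * a))) by rewrite scaleN1r; nc_ring.
    by rewrite f1.
  have aaz : a * a * z = z * (a * a) by rewrite -mulrA f2 mulrA f2 -mulrA.
  have kd : 8 * (kap * (8 * (kap + 1))^-1) <= 1.
    by rewrite mulrA ler_pdivrMr ?mul1r ?mulr_gt0 ?ltr_wpDl // ler_wpM2l // lerDl.
  apply: (polar_near hnu (qq k) kap0 (nq k) n1 kd c1 c2).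
    rewrite {1}f2; have -> : z * a * (a * z) = z * (a * a * z) by nc_ring.
    by rewrite aaz mulrA.
  by rewrite -mulrA -f2.
exists B; split=> //; last by apply: locally_imp lp => A q x _ /polar_pol_dom.
by apply: germ_ext gB _; apply: locally_imp lp => A q x _ /pol_polar ->.
Qed.

End PolarGerms.

Section GramSchmidtGerms.
Variables (R : realType) (m n : nat).
Notation natural_fun := (natural_fun R m n).
Implicit Types (F G H X : nat -> natural_fun) (f g h : natural_fun) (Pq : pred 'I_m) (Px : pred 'I_n).

Lemma germ_inv Pq Px X f : germ Pq Px X f ->
  (forall (A : convAlgType R) (q : 'I_m -> A) (x : 'I_n -> A), clifford_system q -> X 0%N A q x = 0) ->
  exists G, [/\ germ Pq Px G (fun A q x => (1 + f A q x)^-1),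
    forall (A : convAlgType R) (q : 'I_m -> A) (x : 'I_n -> A), G 0%N A q x = 1 &
    locally (fun A q x => 1 + f A q x \is a GRing.unit)].
Proof.
move=> gX X0; have gU0 := germZ (-1) gX.
have [|] := germ_drop0 gU0 _; first by move=> A q x hq; rewrite X0 // scaler0.
set U := series_drop0 _ => u1 u2 u3; have gU : germ Pq Px U (fun A q x => -1 *: f A q x) by split.
have hal (l : nat) : 0 <= (1 : R) <= 1 by rewrite ler01 lexx.
pose Z : nat -> natural_fun := fun r A q x => series_comp (fun=> 1) (fun s => U s A q x) r.
have [||fz gZ] := @germ_lim R m n Pq Px Z.
- by move=> r; apply: word_sum_comp.
- exact: bounded_comp.
have gD := germD (germ1 R Pq Px) (germZ (-1) gU).
have l1 : locally (fun A q x => fz A q x * (1 + -1 *: (-1 *: f A q x)) = 1).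
  apply: (germ_uniq (germM gZ gD) (germ1 R Pq Px)) => A q x hq r.
  under [X in cauchy_prod _ X]eq_fun do rewrite scaleN1r.
  exact: (congr1 (@^~ r) (proj1 (geometric_series (erefl (U 0%N A q x))))).
have l2 : locally (fun A q x => (1 + -1 *: (-1 *: f A q x)) * fz A q x = 1).
  apply: (germ_uniq (germM gD gZ) (germ1 R Pq Px)) => A q x hq r.
  under [X in cauchy_prod X _]eq_fun do rewrite scaleN1r.
  exact: (congr1 (@^~ r) (proj2 (geometric_series (erefl (U 0%N A q x))))).
have l3 := locally_and l1 l2.
have inv (A : convAlgType R) (z y : A) : z * (1 + -1 *: (-1 *: y)) = 1 /\ (1 + -1 *: (-1 *: y)) * z = 1 ->
    1 + y \is a GRing.unit /\ z = (1 + y)^-1.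
  rewrite !scaleN1r opprK => -[h1 h2]; have u : 1 + y \is a GRing.unit by apply/unitrP; exists z.
  by split=> //; apply: (mulrI u); rewrite h2 divrr.
exists Z; split.
- by apply: germ_ext gZ _; apply: locally_imp l3 => A q x _ /inv[].
- by move=> A q x; apply: series_comp0.
by apply: locally_imp l3 => A q x _ /inv[].
Qed.

(** The constant term remains q_k: for j != k, q_k anticommutes with q_j and is its own odd part. *)
Lemma germ_gs_fold Pq Px (k : 'I_m) (Bs : 'I_m -> nat -> natural_fun) (fb : 'I_m -> natural_fun) s X f :
  (forall j, j \in s -> [/\ j != k, germ Pq Px (Bs j) (fb j), const_gen j (Bs j 0%N) &
     locally (fun A q x => fb j A q x * fb j A q x = -1)]) ->
  germ Pq Px X f -> const_gen k (X 0%N) ->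
  exists X', germ Pq Px X' (fun A q x => gs_fold (fun j => fb j A q x) s (f A q x)) /\
    const_gen k (X' 0%N).
Proof.
elim: s X f => [|j s IH] X f hs gX X0; first by exists X.
have [jk gB B0 bb] := hs j (mem_head _ _).
have g1 := germZ 2^-1 (germD gX (germM (germM gB gX) gB)).
have g2 := germ_ext g1 (locally_imp (fun A q x _ b => esym (odd_partE (f A q x) b)) bb).
apply: (IH _ _ _ g2) => [l ls|A q x hq]; first by apply: hs; rewrite inE ls orbT.
rewrite !cauchy_prod0 (X0 A q x hq) (B0 A q x hq); move/clifford_systemP: hq => [h1 h2].
by rewrite -odd_partE // odd_part_id //; apply: h2.
Qed.

(** Since the sets of letters increase with k, the kth component may use the expansions of the
    earlier ones; this is how (Fil) is obtained. *)
Lemma germ_OGS (Pq : 'I_m -> pred 'I_m) (Px : 'I_m -> pred 'I_n)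
    (As : 'I_m -> nat -> natural_fun) (fa : 'I_m -> natural_fun) :
  (forall j k : 'I_m, (j < k)%N -> (forall i, Pq j i -> Pq k i) /\ (forall i, Px j i -> Px k i)) ->
  (forall k, germ (Pq k) (Px k) (As k) (fa k)) -> (forall k, const_gen k (As k 0%N)) ->
  exists Bs fb, (forall k, germ (Pq k) (Px k) (Bs k) (fb k)) /\
    locally (fun A q x => OGS (fun k => fa k A q x) (fun k => fb k A q x)).
Proof.
move=> mono gA A0.
suff [Bs [fb h]] : exists (Bs : 'I_m -> nat -> natural_fun) (fb : 'I_m -> natural_fun),
    forall k : 'I_m, (k < m)%N -> [/\ germ (Pq k) (Px k) (Bs k) (fb k), const_gen k (Bs k 0%N) &
      locally (fun A q x => polar (GS_arg (fun k => fa k A q x) (fun k => fb k A q x) k) (fb k A q x))].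
  exists Bs, fb; split; first by move=> k; case: (h k (ltn_ord k)).
  have h3 k : locally (fun A q x => polar (GS_arg (fun k => fa k A q x) (fun k => fb k A q x) k) (fb k A q x)).
    by case: (h k (ltn_ord k)).
  by apply: locally_imp (locally_forall h3) => A q x _ hp; apply/OGS_polarP.
suff : forall l, (l <= m)%N -> exists (Bs : 'I_m -> nat -> natural_fun) (fb : 'I_m -> natural_fun),
    forall k : 'I_m, (k < l)%N -> [/\ germ (Pq k) (Px k) (Bs k) (fb k), const_gen k (Bs k 0%N) &
      locally (fun A q x => polar (GS_arg (fun k => fa k A q x) (fun k => fb k A q x) k) (fb k A q x))].
  by apply; rewrite leqnn.
elim=> [|l IH] lm; first by exists As, fa.
have [Bs [fb h]] := IH (ltnW lm); pose k0 := Ordinal lm.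
have [|X [gX X0]] := germ_gs_fold (s := below k0) (Bs := Bs) (fb := fb) _ (gA k0) (A0 k0).
  move=> j; rewrite mem_below => jk; have [gB B0 pB] := h j jk; split=> //.
  - by rewrite neq_ltn jk.
  - by have [h1 h2] := mono j k0 jk; apply: germ_mono gB.
  by apply: locally_imp pB => A q x _ [].
have [B [gB B0 dB]] := germ_pol gX X0.
pose f0 : natural_fun := fun A q x => pol (gs_fold (fun j => fb j A q x) (below k0) (fa k0 A q x)).
exists (fun k => if k == k0 then B else Bs k), (fun k => if k == k0 then f0 else fb k) => k kl.
have E (A : convAlgType R) (q : 'I_m -> A) x : GS_arg (fun k => fa k A q x)
     (fun k => (if k == k0 then f0 else fb k) A q x) k =
     GS_arg (fun k => fa k A q x) (fun k => fb k A q x) k.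
  apply: eq_gs_fold => j; rewrite mem_below => jk; rewrite ifF //; apply/eqP => ejk.
  by move: jk kl; rewrite ejk /= ltnS => /leq_trans h1 /h1; rewrite ltnn.
case: eqP => [kk0|kk0].
  rewrite kk0; split=> //; apply: locally_imp dB => A q x _ d.
  by have := E A q x; rewrite kk0 => ->; apply: pol_dom_polar.
have kl' : (k < l)%N.
  by move: kl; rewrite ltnS leq_eqVlt => /predU1P[ekl|//]; case: kk0; apply: val_inj.
have [h1 h2 h3] := h k kl'; split=> //.
by apply: locally_imp h3 => A q x _; rewrite E.
Qed.

End GramSchmidtGerms.

(** * Normal form of words under the Clifford relations *)

Section NormalForm.
Variables (R : realType) (m n : nat).
Notation letter := (letter m n).
Notation clifford A q := (@clifford_system R A m q).

Definition flip (iota : {ffun 'I_m -> bool}) (i : 'I_m) : {ffun 'I_m -> bool} :=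
  [ffun l => if l == i then ~~ iota l else iota l].

(** q_i moves left, with a sign for each later generator that is present, up to its own place, where
    q_i^2 = -1 is used if the place is taken. *)
Lemma mon_mul_gen (iota : {ffun 'I_m -> bool}) (i : 'I_m) : exists s : R,
  forall (A : convAlgType R) (q : 'I_m -> A), clifford A q ->
    cliff_mon q iota * q i = s *: cliff_mon q (flip iota i).
Proof.
rewrite /cliff_mon; suff h (t : seq 'I_m) : uniq t -> i \in t -> exists s : R,
    forall (A : convAlgType R) (q : 'I_m -> A), clifford A q ->
    (\prod_(l <- t) q l ^+ iota l) * q i = s *: \prod_(l <- t) q l ^+ flip iota i l.
  by apply: h; [exact: index_enum_uniq|exact: mem_index_enum].
elim/last_ind: t => [//|t l IH]; rewrite rcons_uniq => /andP[lt ut].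
rewrite mem_rcons inE => /predU1P[il|it].
  subst l; exists (if iota i then -1 else 1) => A q /clifford_systemP[qq _].
  rewrite -cats1 !big_cat !big_seq1 /= ffunE eqxx -mulrA.
  have -> : \prod_(l <- t) q l ^+ flip iota i l = \prod_(l <- t) q l ^+ iota l.
    rewrite !big_seq; apply: eq_bigr => l lt'; rewrite ffunE ifF //.
    by apply: contraNF lt => /eqP <-.
  case: (iota i); rewrite /= ?expr1 ?expr0 ?qq ?mul1r ?mulr1 ?scale1r //.
  by rewrite mulrN1 scaleN1r.
have [s hs] := IH ut it; have il : l != i by apply: contraNneq lt => ->.
exists (if iota l then - s else s) => A q hq; have /clifford_systemP[_ qa] := hq.
rewrite -cats1 !big_cat !big_seq1 /= ffunE (negbTE il) -mulrA.
case: (iota l); rewrite /= ?expr1 ?expr0 ?mulr1 ?mul1r; last exact: hs.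
by rewrite (qa _ _ il) mulrN mulrA hs // -scalerAl scaleNr.
Qed.

Definition supported (Pq : pred 'I_m) (Px : pred 'I_n) r (j : {ffun 'I_r -> 'I_n})
    (iota : {ffun 'I_r.+1 -> {ffun 'I_m -> bool}}) : Prop :=
  (forall s, Px (j s)) /\ (forall s i, iota s i -> Pq i).

(** Reading from the left, a generator is absorbed by the last monomial, and a variable opens a new
    slot followed by the empty monomial. *)
Lemma word_normal_form (Pq : pred 'I_m) (Px : pred 'I_n) (w : seq letter) :
  all (allowed Pq Px) w -> exists (j : {ffun 'I_(count (@is_var m n) w) -> 'I_n}) iota (s : R),
    supported Pq Px j iota /\
    forall (A : convAlgType R) (q : 'I_m -> A) x, clifford A q ->
      eval_word q x w = s *: cliff_word q x j iota.
Proof.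
suff h r : count (@is_var m n) w = r -> all (allowed Pq Px) w -> exists (j : {ffun 'I_r -> 'I_n}) iota (s : R),
    supported Pq Px j iota /\ forall (A : convAlgType R) (q : 'I_m -> A) x, clifford A q ->
      eval_word q x w = s *: cliff_word q x j iota by exact: h.
elim/last_ind: w r => [|w l IH] r.
  move=> <- _; exists [ffun i : 'I_0 => match i with Ordinal _ h => False_rect _ (notF h) end].
  exists [ffun=> [ffun=> false]], 1; split.
    by split=> [[]|s i]; rewrite // !ffunE.
  move=> A q x _; rewrite /eval_word big_nil scale1r /cliff_word big_ord0 mulr1.
  by rewrite ffunE /cliff_mon big1 // => i _; rewrite ffunE.
rewrite -cats1 count_cat all_cat /= addn0 andbT => + /andP[hw hl].
case: l hl => [i|j0] /= hl.
  rewrite addn0 => wr; have [j [iota [s [[sj si] e]]]] := IH r wr hw.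
  have [s' hs'] := mon_mul_gen (iota ord_max) i.
  exists j, [ffun l => if l == ord_max then flip (iota ord_max) i else iota l], (s * s'); split.
    split=> // l i'; rewrite ffunE; case: eqP => [_|_]; last exact: si.
    rewrite ffunE; case: eqP => [-> //|_]; exact: si.
  move=> A q x hq; rewrite /eval_word big_cat big_seq1 /= -/(eval_word q x w) e //.
  rewrite -scalerAl -scalerA; congr (_ *: _); rewrite /cliff_word.
  (* The last monomial is the leading factor of [cliff_word] when r = 0, and lies inside the product
     otherwise. *)
  case: r j iota wr {IH si sj e} hs' => [|r] j iota wr hs'.
    rewrite !big_ord0 !mulr1 ffunE; have -> : ord0 = ord_max :> 'I_1 by apply: val_inj.
    by rewrite eqxx hs'.
  rewrite !big_ord_recr /= !ffunE.
  have lm : lift ord0 ord_max = ord_max :> 'I_r.+2 by apply: val_inj.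
  rewrite lm eqxx -!mulrA hs' // -!scalerAr; congr (_ *: (cliff_mon q _ * (_ * _))).
  apply: eq_bigr => k _; rewrite ffunE ifF //.
  by apply/eqP => /(congr1 val) /=; rewrite /bump /= add1n => /eqP; rewrite eqSS ltn_eqF.
rewrite addn1 => wr; case: r wr => // r [wr]; have [j [iota [s [[sj si] e]]]] := IH r wr hw.
exists [ffun k => if unlift ord_max k is Some k' then j k' else j0].
exists [ffun k => if unlift ord_max k is Some k' then iota k' else [ffun=> false]], s; split.
  split=> [k|k i]; rewrite !ffunE; case: unliftP => [k' _|_] //; first exact: si.
  by rewrite ffunE.
move=> A q x hq; rewrite /eval_word big_cat big_seq1 /= -/(eval_word q x w) e //.
rewrite -scalerAl; congr (_ *: _); rewrite /cliff_word big_ord_recr /= !ffunE.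
have lm : lift ord0 ord_max = ord_max :> 'I_r.+2 by apply: val_inj.
rewrite lm !unlift_none /= [cliff_mon q [ffun=> false]]big1 ?mulr1; last by move=> i _; rewrite ffunE.
have l0 : ord0 = lift ord_max ord0 :> 'I_r.+2 by apply: val_inj.
have u0 : unlift ord_max (ord0 : 'I_r.+2) = Some ord0 by rewrite l0 liftK.
rewrite u0 mulrA; congr (_ * _ * _); apply: eq_bigr => k _.
have -> : widen_ord (leqnSn r) k = lift ord_max k by apply: val_inj; rewrite /= /bump leqNgt ltn_ord.
have -> : lift ord0 (lift ord_max k) = lift ord_max (lift ord0 k) :> 'I_r.+2.
  by apply: val_inj; rewrite /= /bump /= !add1n ltnS leqNgt ltn_ord.
by rewrite !ffunE !liftK.
Qed.

Definition cliff_sum r (phi : {ffun 'I_r -> 'I_n} -> {ffun 'I_r.+1 -> {ffun 'I_m -> bool}} -> R)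
    (A : convAlgType R) (q : 'I_m -> A) (x : 'I_n -> A) : A :=
  \sum_(iota : {ffun 'I_r.+1 -> {ffun 'I_m -> bool}}) \sum_(j : {ffun 'I_r -> 'I_n})
    phi j iota *: cliff_word q x j iota.

Lemma word_sum_cliff Pq Px r (f : natural_fun R m n) : word_sum Pq Px r f ->
  exists phi : {ffun 'I_r -> 'I_n} -> {ffun 'I_r.+1 -> {ffun 'I_m -> bool}} -> R,
  (forall j iota, phi j iota != 0 -> supported Pq Px j iota) /\
  forall (A : convAlgType R) (q : 'I_m -> A) x, clifford A q -> f A q x = cliff_sum phi q x.
Proof.
move=> [L [hL fL]]; suff [phi [h1 h2]] : exists phi : {ffun 'I_r -> 'I_n} -> {ffun 'I_r.+1 -> {ffun 'I_m -> bool}} -> R,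
    (forall j iota, phi j iota != 0 -> supported Pq Px j iota) /\
    forall (A : convAlgType R) (q : 'I_m -> A) x, clifford A q ->
      \sum_(p <- L) p.1 *: eval_word q x p.2 = cliff_sum phi q x.
  by exists phi; split=> // A q x hq; rewrite fL h2.
elim: L hL {fL} => [|[a w] L IH] /=.
  exists (fun _ _ => 0); split=> [j iota|A q x _]; first by rewrite eqxx.
  by rewrite big_nil /cliff_sum big1 // => iota _; rewrite big1 // => j _; rewrite scale0r.
move=> /andP[/andP[/eqP wr wa] /IH[phi [h1 h2]]]; have := word_normal_form wa; rewrite wr.
move=> [j0 [iota0 [s [hs e]]]].
exists (fun j iota => a * s * ((j == j0) && (iota == iota0))%:R + phi j iota); split=> [j iota|A q x hq].
  case: andP => [[/eqP -> /eqP ->] //|_]; rewrite mulr0 add0r; exact: h1.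
rewrite big_cons h2 // e // /cliff_sum.
under [RHS]eq_bigr do under eq_bigr do rewrite scalerDl.
under [RHS]eq_bigr do rewrite big_split /=.
rewrite big_split /=; congr (_ + _).
rewrite (bigD1 iota0) //= (bigD1 j0) //= !eqxx mulr1 scalerA.
rewrite big1 => [|j /negbTE ->]; last by rewrite mulr0 scale0r.
rewrite addr0 big1 ?addr0 // => iota /negbTE ni; rewrite big1 // => j _.
by rewrite ni andbF mulr0 scale0r.
Qed.

End NormalForm.

(** * The Clifford map *)

Section CliffordAlgebras.
Variables (R : realType) (V : vectType R) (q : {dot V for idfun}).

Lemma dotC u v : q u v = q v u.
Proof. by rewrite hermC /= expr0 mul1r. Qed.

Lemma dotDr u v w : q u (v + w) = q u v + q u w. Proof. by rewrite linearD. Qed.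

Lemma dotZr u v (a : R) : q u (a *: v) = a * q u v. Proof. by rewrite linearZ. Qed.

Lemma dotNr u v : q u (- v) = - q u v.
Proof. by rewrite -scaleN1r dotZr mulN1r. Qed.

Lemma dot_sumr u (I : finType) (P : pred I) (F : I -> V) :
  q u (\sum_(i | P i) F i) = \sum_(i | P i) q u (F i).
Proof.
apply: (big_morph (q u) (dotDr u)).
by rewrite -(scale0r (0 : V)) dotZr mul0r.
Qed.

Lemma dot_span0 (X : seq V) w v : (forall x, x \in X -> q w x = 0) -> v \in <<X>>%VS -> q w v = 0.
Proof.
move=> h /(coord_span (X := in_tuple X)) ->; rewrite dot_sumr big1 // => i _.
by rewrite dotZr h ?mem_nth // mulr0.
Qed.

Lemma dot_eq0 w : q w w = 0 -> w = 0.
Proof.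
by move=> h; apply/eqP; apply: contraTT (lexx (0 : R)) => /(@neq0_dnorm_gt0 _ _ _ q); rewrite h ltxx.
Qed.

Section Components.
Variables (n : nat) (a c : 'I_n -> V).
Hypotheses (fa : free (codom a)) (hc : orthogonal_components q a c).

Lemma component_neq0 k : c k != 0.
Proof.
apply/eqP => ck; have [] := hc k; rewrite ck subr0 => + _; apply/negP.
have : codom a = rcons [seq a j | j <- below k] (a k) ++ [seq a j | j <- drop k.+1 (enum 'I_n)].
  rewrite cat_rcons below_take -[a k :: _]/(map a (k :: drop k.+1 (enum 'I_n))) -map_cat.
  congr map; rewrite -{1}(cat_take_drop k (enum 'I_n)) (drop_nth k) ?size_enum_ord //.
  by rewrite nth_ord_enum.
move=> e; move: fa; rewrite e => /catl_free.
have p : perm_eq (rcons [seq a j | j <- below k] (a k)) (a k :: [seq a j | j <- below k]).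
  by rewrite perm_rcons.
by rewrite (perm_free p) free_cons => /andP[].
Qed.

Lemma component_orth i j : i != j -> q (c i) (c j) = 0.
Proof.
wlog ji : i j / (j < i)%N.
  move=> h ij; case: (ltngtP i j) => [ij'|ji|/val_inj e]; last by rewrite e eqxx in ij.
    by rewrite dotC h // eq_sym.
  exact: h.
move=> _; have [h1 _] := hc j; have [_ h2] := hc i.
have -> : c j = a j - (a j - c j) by rewrite subKr.
rewrite dotDr dotNr h2 // (dot_span0 _ h1) ?subr0 // => x /mapP[l]; rewrite mem_below => lj ->.
by apply: h2; apply: ltn_trans ji.
Qed.

(** T consists of the usual projection coefficients. The defect w is orthogonal to the c_j, hence to
    the a_j, with j < k; as it is also a combination of these vectors, q w w = 0. *)
Lemma component_expansion : exists T : 'I_n -> 'I_n -> R,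
  [/\ forall k j : 'I_n, (k < j)%N -> T k j = 0, forall k, T k k = 1 &
      forall k, a k = \sum_j T k j *: c j].
Proof.
pose T (k j : 'I_n) : R := if j == k then 1 else if (j < k)%N then q (a k) (c j) / q (c j) (c j) else 0.
exists T; split=> [k j kj|k|k].
- by rewrite /T ifF ?ifF //; [rewrite ltnNge ltnW|rewrite -val_eqE gtn_eqF].
- by rewrite /T eqxx.
pose w := a k - \sum_j T k j *: c j.
suff : w = 0 by move/eqP; rewrite subr_eq0 => /eqP.
have wE : w = (a k - c k) - \sum_(j | j != k) T k j *: c j.
  by rewrite /w (bigD1 k) //= {1}/T eqxx scale1r opprD addrA.
have wc (j : 'I_n) : (j < k)%N -> q (c j) w = 0.
  move=> jk; have nk : j != k by rewrite -val_eqE ltn_eqF.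
  have cj : q (c j) (c j) != 0 by rewrite gt_eqF // neq0_dnorm_gt0 // component_neq0.
  rewrite wE dotDr !dotNr dotDr dotNr (component_orth nk) subr0 dot_sumr (bigD1 j) //=.
  rewrite big1 ?addr0 => [|l /andP[_ lj]].
    by rewrite dotZr /T (negbTE nk) jk divfK // dotC subrr.
  by rewrite dotZr (component_orth (i := j)) ?mulr0 // eq_sym.
have wa (j : 'I_n) : (j < k)%N -> q w (a j) = 0.
  have [l] := ubnP j; elim: l j => // l IH j jl jk.
  have [h _] := hc j; have -> : a j = (a j - c j) + c j by rewrite subrK.
  rewrite dotDr [q w (c j)]dotC wc // addr0 (dot_span0 _ h) // => x /mapP[t]; rewrite mem_below => tj ->.
  by apply: IH; [exact: leq_trans tj jl|exact: ltn_trans jk].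
apply: dot_eq0; rewrite {2}wE dotDr dotNr dot_sumr big1 ?subr0 => [|j jk].
  by have [h _] := hc k; apply: (dot_span0 _ h) => x /mapP[t]; rewrite mem_below => tk ->; apply: wa.
rewrite dotZr; have [jk'|kj] := ltnP j k; first by rewrite dotC wc ?mulr0.
by rewrite /T (negbTE jk) ifF ?mul0r // ltnNge kj.
Qed.

End Components.

Section CliffordMap.
Variables (A : convAlgType R) (cl : {linear V -> A}).
Hypothesis hcl : forall v, cl v ^+ 2 = (- q v v)%:A.

Lemma cl_anticomm u v : cl u * cl v + cl v * cl u = (- 2 * q u v)%:A.
Proof.
have := hcl (u + v); rewrite expr2 linearD dotDr dotC dotDr [q (u + v) v]dotC dotDr.
have := hcl u; have := hcl v; rewrite !expr2 => hv hu.
have -> : (cl u + cl v) * (cl u + cl v) = cl u * cl u + cl v * cl v + (cl u * cl v + cl v * cl u).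
  by nc_ring.
rewrite hu hv -scalerDl => /(canRL (addKr _)) ->; rewrite -scaleNr -scalerDl.
by congr (_ *: _); rewrite [q v u]dotC; ring.
Qed.

Lemma cl_orthonormal m (e : 'I_m -> V) : (forall i, q (e i) (e i) = 1) ->
  (forall i j, i != j -> q (e i) (e j) = 0) -> clifford_system (cl \o e).
Proof.
move=> h1 h2 i j; rewrite /= cl_anticomm; congr ((_ * _) *: _).
by have [->|ij] := eqVneq i j; rewrite ?h1 ?h2.
Qed.

(** Let z be the image of the first vector, so that z^2 = -s. If z anticommutes with y, then (x z)
    (y z) = s x y; hence the ratios x z^-1 = - s^-1 x z inherit the relations of [cl_anticomm]. *)
Lemma cl_conformal m (e : 'I_m.+1 -> V) (s : R) : 0 < s -> (forall i, q (e i) (e i) = s) ->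
  (forall i j, i != j -> q (e i) (e j) = 0) -> floating_clifford_system (cl \o e).
Proof.
move=> s0 h1 h2; have sq i : cl (e i) * cl (e i) = - s%:A by rewrite -expr2 hcl h1 scaleNr.
have ue : cl (e ord0) \is a GRing.unit.
  have u : cl (e ord0) ^+ 2 \is a GRing.unit.
    by rewrite expr2 sq unitrN scaler_unit ?unitr1 // unitfE gt_eqF.
  by rewrite -(unitrX_pos _ (ltn0Sn 1)).
have ve : (cl (e ord0))^-1 = - (s^-1 *: cl (e ord0)).
  apply: (mulrI ue); rewrite divrr // mulrN -scalerAr sq scalerN opprK scalerA mulVf ?scale1r //.
  by rewrite gt_eqF.
split=> // i j /=; rewrite ve !(mulrN, mulNr, opprK) -!scalerAr -!scalerAl !scalerA.
set x := cl (e (lift ord0 i)); set y := cl (e (lift ord0 j)); set z := cl (e ord0).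
have zx k : z * cl (e (lift ord0 k)) = - (cl (e (lift ord0 k)) * z).
  by apply/eqP; rewrite -addr_eq0 cl_anticomm h2 ?mulr0 ?scale0r // neq_lift.
have zz : z * z = - s%:A by apply: sq.
have e1 u v : z * v = - (v * z) -> u * z * (v * z) = s *: (u * v).
  move=> h; have -> : u * z * (v * z) = u * (z * v) * z by nc_ring.
  rewrite h mulrN mulNr; have -> : u * (v * z) * z = u * v * (z * z) by nc_ring.
  by rewrite zz mulrN opprK -scalerAr mulr1.
rewrite (e1 x y) ?zx // (e1 y x) ?zx // -!scalerDr cl_anticomm !scalerA; congr (_ *: _).
have sn : s != 0 by rewrite gt_eqF.
rewrite divfK //; have [->|ij] := eqVneq i j; first by rewrite h1 mulr1 mulrCA mulVf ?mulr1.
by rewrite h2 ?(inj_eq lift_inj) // !mulr0 oppr0.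
Qed.

End CliffordMap.

End CliffordAlgebras.

(** * Agreement with the Gram-Schmidt procedure *)

Section GramSchmidtProcedure.
Variables (R : realType).

(** No polarization is computed: the normalized components form a Clifford system, which is a fixed
    point, and the given vectors arise from it by a lower triangular matrix with positive diagonal,
    so [OGS_trig] applies. *)
Lemma OGS_PGS n : PGS (@OGS R n).
Proof.
move=> V q A cl a c [_ hcl _] fa hc.
have [T [T0 T1 aE]] := component_expansion fa hc; have c0 := component_neq0 fa hc.
have co := component_orth hc; have cp k : 0 < q (c k) (c k) by apply: neq0_dnorm_gt0.
pose s k := Num.sqrt (q (c k) (c k)); have s0 k : 0 < s k by rewrite sqrtr_gt0.
have sn k : s k != 0 by rewrite gt_eqF.
pose e k := (s k)^-1 *: c k.
have hQ : clifford_system (cl \o e).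
  apply: (cl_orthonormal hcl) => [i|i j ij]; last by rewrite dotZr dotC dotZr co ?mulr0 // eq_sym.
  rewrite dotZr dotC dotZr -[q (c i) (c i)]sqr_sqrtr ?(ltW (cp i)) // -/(s i).
  by rewrite expr2 mulKf // mulVf.
have := OGS_trig (U := fun k j => T k j * s j) (fun=> 0) _ _ (OGS_fixed hQ).
have -> : (fun i => 0%:A + \sum_j (T i j * s j) *: (cl \o e) j) = cl \o a.
  apply/funext => i; rewrite scale0r add0r /= [in RHS]aE linear_sum; apply: eq_bigr => j _.
  by rewrite /e !linearZ /= scalerA mulrC mulfK.
by apply => [i j ij|i]; [rewrite T0 ?mul0r|rewrite T1 mul1r].
Qed.

Lemma OfGS_PGS n : PGS' (@OfGS R n).
Proof.
move=> V q A cl a c [_ hcl _] fa hc.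
have [T [T0 T1 aE]] := component_expansion fa hc; have c0 := component_neq0 fa hc.
have co := component_orth hc; have cp k : 0 < q (c k) (c k) by apply: neq0_dnorm_gt0.
(* These factors give every component the length of the first one. The first factor is 1, which is
   the condition of [OfGS_par] on the corner of the matrix. *)
pose s k := Num.sqrt (q (c ord0) (c ord0) / q (c k) (c k)).
have s0 k : 0 < s k by rewrite sqrtr_gt0 divr_gt0.
have sn k : s k != 0 by rewrite gt_eqF.
pose e k := s k *: c k.
have hQ : floating_clifford_system (cl \o e).
  apply: (cl_conformal hcl (cp ord0)) => [i|i j ij]; last by rewrite dotZr dotC dotZr co ?mulr0 // eq_sym.
  rewrite dotZr dotC dotZr mulrA -expr2 sqr_sqrtr ?divfK ?gt_eqF //.
  by rewrite divr_ge0 // ltW.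
have := OfGS_par (U := \matrix_(k, j) (T k j / s j)) _ _ _ (OfGS_fixed hQ).
have -> : (fun i => \sum_j (\matrix_(k, j) (T k j / s j)) i j *: (cl \o e) j) = cl \o a.
  apply/funext => i; rewrite /= [in RHS]aE linear_sum; apply: eq_bigr => j _.
  by rewrite /e !linearZ /= mxE scalerA mulrC divfK.
apply.
- by apply/is_trig_mxP => i j ij; rewrite mxE T0 ?mul0r.
- by move=> i; rewrite mxE T1 div1r invr_gt0.
by rewrite mxE T1 /s divff ?sqrtr1 ?divr1 // gt_eqF.
Qed.

End GramSchmidtProcedure.

(** * From uniform neighbourhoods to 0-open sets *)

Section Neighbourhoods.
Variables (R : realType) (m n : nat).

(** [near] asks for a norm at level 0 too, where the quotient is zero and [snorm_adapted] does not
    apply. *)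
Lemma snorm_zero (A : convAlgType R) : snorm 0 (fun=> 0 : R) (A := A).
Proof.
split=> [|x y|x _|d c c0]; [by split=> [x y|a x]; rewrite ?addr0 ?mulr0|by rewrite mulr0|by []|].
exists 0 => // x; rewrite mulr0 /coord_norm c0 ?filt0 // big1 // => j _.
by rewrite mxE normr0.
Qed.

(** The factor y serves the floating case, where the variables of the expansion are the R_k
    Q_1^-1. *)
Lemma locally_zero_open (A : convAlgType R) (q : 'I_m -> A) (y : A)
    (P : forall A : convAlgType R, ('I_m -> A) -> ('I_n -> A) -> Prop) :
  clifford_system q -> locally P -> exists U : set ('I_n -> A),
    [/\ zero_open U, U (fun=> 0) &
      forall x x', U x -> (forall k, x' k = x k * y) -> P A q x'].
Proof.
move=> hq hP; have [nu hnu] := @snorm_exists R A 1; have [hs hm _ _] := hnu.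
have n0 x : 0 <= nu x by apply: seminorm_ge0.
pose S := \sum_i nu (q i); pose kappa := nu 1 + S + 1.
have S0 : 0 <= S by apply: sumr_ge0.
have k0 : 0 <= kappa by rewrite !addr_ge0.
have [e e0 he] := hP _ k0; have e2 : 0 < e / 2 by rewrite divr_gt0.
pose T (x : 'I_n -> A) := \sum_k nu (x k * y); exists [set x | T x < e / 2]; split.
- apply: (zero_open_local hnu) => a /= ha; pose D := n%:R * nu y.
  have D0 : 0 <= D by rewrite mulr_ge0.
  have D1 : 0 < D + 1 by rewrite ltr_wpDl.
  pose d := (e / 2 - T a) / (D + 1).
  have d0 : 0 < d by rewrite divr_gt0 // subr_gt0.
  exists d => // a' ha'; apply: (@le_lt_trans _ _ (\sum_k (nu (a k * y) + d * nu y))).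
    apply: ler_sum => k _; have -> : a' k * y = a k * y + (a' k - a k) * y.
      by rewrite mulrBl addrC subrK.
    apply: le_trans (proj1 hs _ _) _; rewrite lerD2l; apply: le_trans (hm _ _) _.
    by rewrite ler_wpM2r.
  rewrite big_split /= sumr_const card_ord -/(T a).
  have -> : d * nu y *+ n = d * D by rewrite /D -mulr_natr; ring.
  have : d * (D + 1) = e / 2 - T a by rewrite divfK // gt_eqF.
  by lra.
- by rewrite /= /T big1 // => k _; rewrite mul0r (seminorm0 hs).
move=> x x' /= hx /funext ->; apply: he; split=> // -[|i].
  by exists (fun=> 0); [apply: snorm_zero|have [s1 s2 _ _] := snorm_zero A; split=> // _; apply: ltW].
pose d := Num.min 1 (e / 2); have d0 : 0 < d by rewrite lt_min ltr01.
(* The norm is adapted to 1, to the generators and to the perturbations at the given point: one e /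
   2 comes from the open set, the other from the adaptation. *)
have [mu hmu hF] := snorm_adapted (1 :: codom q ++ codom (fun k => x k * y)) hnu (ltn0Sn i) d0.
have dl : d <= 1 by rewrite ge_min lexx.
have dr : d <= e / 2 by rewrite ge_min lexx orbT.
exists mu => //; have [s1 s2 _ _] := hmu; split=> // [|l|k].
- by have := hF 1 (mem_head _ _); rewrite /kappa; lra.
- have := hF (q l); rewrite inE mem_cat codom_f orbT => /(_ isT).
  have : nu (q l) <= S by rewrite /S (bigD1 l) //= lerDl sumr_ge0.
  by rewrite /kappa; have := n0 1; lra.
have := hF (x k * y); rewrite inE mem_cat (codom_f (fun k => x k * y)) !orbT => /(_ isT).
have : nu (x k * y) <= T x by rewrite /T (bigD1 k) //= lerDl sumr_ge0.
by lra.
Qed.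

Lemma germ_coeffs (p : nat) (Pq : 'I_p -> pred 'I_m) (Px : 'I_p -> pred 'I_n)
    (Bs : 'I_p -> nat -> natural_fun R m n) (fb : 'I_p -> natural_fun R m n) :
  (forall k, germ (Pq k) (Px k) (Bs k) (fb k)) ->
  exists psi : forall k r, {ffun 'I_r -> 'I_n} -> {ffun 'I_r.+1 -> {ffun 'I_m -> bool}} -> R,
    (forall k r j iota, psi k r j iota != 0 -> supported (Pq k) (Px k) j iota) /\
    locally (fun A q x => forall k, tends (fun N => \sum_(r < N) cliff_sum (psi k r) q x) (fb k A q x)).
Proof.
move=> hg; have w k r : word_sum (Pq k) (Px k) r (Bs k r) by case: (hg k).
exists (fun k r => sval (cid (word_sum_cliff (w k r)))); split.
  by move=> k r j iota; case: cid => phi [h1 h2] /=; apply: h1.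
apply: locally_forall => k; have [_ _ h] := hg k; apply: locally_imp h => A q x hq h i nu hnu.
apply: small_seq_le (h i nu hnu) => N; rewrite [X in _ <= nu (X - _)](eq_bigr (fun r : 'I_N =>
  cliff_sum (sval (cid (word_sum_cliff (w k r)))) q x)) // => r _.
by case: cid => phi [h1 h2] /=; apply: h2.
Qed.

End Neighbourhoods.

Section Expansions.
Variables (R : realType) (n : nat).

Lemma OGS_Fil : Fil (@OGS R n).
Proof.
pose Pk (k : 'I_n) : pred 'I_n := fun i => (i <= k)%N.
have mono (j k : 'I_n) : (j < k)%N -> (forall i, Pk j i -> Pk k i) /\ (forall i, Pk j i -> Pk k i).
  by move=> jk; split=> i ij; apply: leq_trans ij (ltnW jk).
have gA k := germD (germ_gen R (Pk k) (leqnn k : Pk k k)) (germ_var R (Pk k) (leqnn k : Pk k k)).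
have [|Bs [fb [gB hO]]] := germ_OGS mono gA; first by move=> k A q x _; rewrite addr0.
have [psi [hsupp hpsi]] := germ_coeffs gB; exists psi => [A q hq|k r j iota /hsupp //].
have [U [oU U0 hU]] := locally_zero_open 1 hq (locally_and hO hpsi).
exists U; split=> // x Ux; have [|h1 h2] := hU x x Ux; first by move=> k; rewrite mulr1.
by exists (fun k => fb k A q x) => // k; apply: tends_conv_to (h2 k).
Qed.

Lemma OfGS_Fil : Fil' (@OfGS R n).
Proof.
have g0 : germ pred0 (fun j => j == ord0) (fun r A q x => if r is 1%N then x ord0 else 0)
    (fun (A : convAlgType R) (q : 'I_n -> A) (x : 'I_n.+1 -> A) => x ord0).
  exact: germ_var.
have [//|G [gG G0 uG]] := germ_inv g0.
pose Pq (k : 'I_n) : pred 'I_n := fun i => (i <= k)%N.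
pose Px (k : 'I_n) : pred 'I_n.+1 := fun j => (j <= lift ord0 k)%N.
have mono (j k : 'I_n) : (j < k)%N -> (forall i, Pq j i -> Pq k i) /\ (forall i, Px j i -> Px k i).
  move=> jk; split=> i; rewrite /Pq /Px => ij; apply: leq_trans ij _; first exact: ltnW.
  by rewrite !lift0 ltnS ltnW.
have gGk k : germ (Pq k) (Px k) G (fun (A : convAlgType R) (q : 'I_n -> A) x => (1 + x ord0)^-1).
  by apply: germ_mono gG => // j /eqP ->; rewrite /Px.
(* With q_k = Q_k Q_1^-1 and x_k = R_k Q_1^-1, the first entry is A_1 = (1 + x_1) Q_1 and the ratios
   are A_k A_1^-1 = (q_k + x_k) (1 + x_1)^-1. *)
have gA k := germM (germD (germ_gen R (Px k) (leqnn k : Pq k k))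
  (germ_var R (Pq k) (leqnn _ : Px k (lift ord0 k)))) (gGk k).
have [|Bs [fb [gB hO]]] := germ_OGS mono gA.
  by move=> k A q x hq; rewrite cauchy_prod0 G0 mulr1 addr0.
(* The components of the result, multiplied by Q_1^-1 on the right; the factor Q_1 is restored at
   the end. *)
pose gk (k : 'I_n.+1) (A : convAlgType R) (q : 'I_n -> A) (x : 'I_n.+1 -> A) :=
  if unlift ord0 k is Some i then fb i A q x * (1 + x ord0) else 1 + x ord0.
pose Qk (k : 'I_n.+1) : pred 'I_n := fun i => (lift ord0 i <= k)%N.
pose Xk (k : 'I_n.+1) : pred 'I_n.+1 := fun j => (j <= k)%N.
have hg k : exists Gs, germ (Qk k) (Xk k) Gs (gk k).
  have h1 : germ (Qk k) (Xk k) _ (fun (A : convAlgType R) (q : 'I_n -> A) x => 1 + x ord0) :=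
    germD (germ1 R (Qk k) (Xk k)) (germ_var R (Qk k) (leq0n k : Xk k ord0)).
  rewrite /gk; case: unliftP => [i ki|_]; last by eexists; apply: h1.
  have h2 : germ (Qk k) (Xk k) (Bs i) (fb i).
    by apply: germ_mono (gB i) => j; rewrite /Qk /Xk ki // !lift0.
  by eexists; apply: germM h2 h1.
have [Gs gGs] := choice hg.
have [psi [hsupp hpsi]] := germ_coeffs gGs; exists psi => [A q hq|k r j iota /hsupp //].
have [uq hc] := hq.
have [U [oU U0 hU]] := locally_zero_open (q ord0)^-1 hc (locally_and uG (locally_and hO hpsi)).
exists U; split=> // x Ux; pose qt i := q (lift ord0 i) / q ord0; pose xt k := x k / q ord0.
have [//|h1 [h2 h3]] := hU x xt Ux.
exists (fun k => gk k A qt xt * q ord0); last first.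
  move=> k; apply: tends_conv_to => i nu hnu; have := tendsMr (q ord0) (h3 k).
  by move=> h; apply: small_seq_le (h i nu hnu) => N; rewrite mulr_suml.
have e0 : q ord0 + x ord0 = (1 + xt ord0) * q ord0 by rewrite mulrDl mul1r divrK.
have u0 : q ord0 + x ord0 \is a GRing.unit by rewrite e0 unitrMl.
split=> //; exists (fun i => fb i A qt xt); last first.
  split=> [|i]; first by rewrite /gk unlift_none e0.
  by rewrite /gk liftK e0 mulrA.
move: h2; congr OGS; apply/funext => i; by rewrite e0 invrM // [RHS]mulrA [in RHS]mulrDl.
Qed.

End Expansions.
(* The number of components of the tuples is n.+1. *)
Theorem theorem3p5 (R : realType) (n : nat) :
  [/\ [/\ FQ_orthogonalization (@OGS R n.+1),
          [/\ vC (@OGS R n.+1), vL (@OGS R n.+1) & H_0 (@OGS R n.+1)],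
          [/\ PGS (@OGS R n.+1), Fil (@OGS R n.+1) & Par (@OGS R n.+1)] &
          FSt (@OGS R n.+1)],
      [/\ FQ_conform_orthogonalization (@OfGS R n),
          vC' (@OfGS R n) /\ vL (@OfGS R n),
          [/\ PGS' (@OfGS R n), Fil' (@OfGS R n) & Par (@OfGS R n)] &
          FSt (@OfGS R n)] &
      forall A : convAlgType R,
        zero_open (domain (@OGS R n.+1) (A := A)) /\
        zero_open (domain (@OfGS R n) (A := A))].
Proof.
have homP (A B : convAlgType R) (phi : {lrmorphism A -> B}) : alg_hom phi.
  by split=> [|x y|a x|x y]; rewrite ?rmorph1 ?raddfD ?linearZ ?rmorphM.
split.
- split; last by move=> A a b t t01; apply: OGS_segment.
  + split; [by move=> A a b b'; apply: OGS_uniq| |by have [psi h _] := OGS_Fil R n.+1; exists psi|by move=> A a b; apply: OGS_clifford].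
    split=> [A B phi a b|A B a b [q hq] [p hp]]; first by apply: OGS_hom; apply: homP.
    by exists (fun k => (q k, p k)); apply: OGS_pair.
  + split; [by move=> A q; apply: OGS_fixed|by move=> A a b iota; apply: OGS_sign|].
    by move=> A a b t t0; apply: OGS_scale.
  + split; [exact: OGS_PGS|exact: OGS_Fil|].
    move=> A a b U /is_trig_mxP U0 Up _ /(OGS_trig (U := fun i j => U i j) (fun=> 0) U0 Up).
    by congr OGS; apply/funext => i; rewrite scale0r add0r.
- split; last by move=> A a b t t01; apply: OfGS_segment.
  + split; [by move=> A a b b'; apply: OfGS_uniq| | |by have [psi h _] := OfGS_Fil R n; exists psi|by move=> A a b; apply: OfGS_clifford].
      split=> [A B phi a b|A B a b [q hq] [p hp]]; first by apply: OfGS_hom; apply: homP.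
      by exists (fun k => (q k, p k)); apply: OfGS_pair.
    by move=> A a b t1 t2 u1 u2; apply: OfGS_biv.
  + by split=> [A q|A a b iota]; [apply: OfGS_fixed|apply: OfGS_sign].
  + by split; [exact: OfGS_PGS|exact: OfGS_Fil|move=> A a b U; apply: OfGS_par].
move=> A; have [nu hnu] := @snorm_exists R A 1.
by split; [apply: (OGS_zero_open hnu)|apply: (OfGS_zero_open hnu)].
Qed.
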